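(* Let $(V_i)_{i\ge0}$, $(A_i)_{i\ge0}$, $(B_i)_{i\ge0}$ be mutually independent sequences of i.i.d. random variables with generic copies $V,A,B$, where $A,B\ge0$, $\mathbb{E}|V|<\infty$ and $\mathbb{E}|B-A|<\infty$. Let $W_0=w\ge0$ and $W_{i+1}=[V_iW_i+B_i-A_i]^+$ for $i=0,1,\dots$. Suppose that $\mathbb{P}(V=a)=p$ and $\mathbb{P}(V<0)=1-p$ with $a>0$ and $p\in(0,1)$, and let $V^-$ be a random variable with the law of $V$ conditioned on $V<0$. Suppose that $B$ and $A$ have rational Laplace–Stieltjes transforms $\Phi_B=N_B/D_B$ and $\Phi_A=N_A/D_A$, where $D_B(s)=\prod_{j=1}^{\ell}(s-s_j)$ with $\mathrm{Re}\,s_j<0$ for $j=1,\dots,\ell$, $D_A(s)=\prod_{i=1}^{m}(s-t_i)$ with $\mathrm{Re}\,t_i<0$ for $i=1,\dots,m$, and $N_B$, $N_A$ are polynomials of degree at most $\ell-1$, $m-1$ sharing no zeros with $D_B$, $D_A$ respectively. Put $D_Y(s)=D_B(s)D_A(-s)$, $N_Y(s)=N_B(s)N_A(-s)$ and $\Phi_Y(s)=\Phi_B(s)\Phi_A(-s)=N_Y(s)/D_Y(s)$. Then, for $r\in(0,1)$: (1) If $a=1$, then $$U_W(r,s)=\frac{D_Y(s)e^{-sw}+\sum_{k=0}^{m+\ell}a_k(r)s^k}{D_Y(s)-rp\,N_Y(s)},$$ where $$a_0(r)=\frac{r}{1-r}(1-p)(-1)^{\ell+m}\prod_{j=1}^{\ell}s_j\prod_{i=1}^{m}t_i,$$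 while the remaining constants $a_1(r),\dots,a_{m+\ell}(r)$ can be determined from the linear systems $$r(1-p)N_Y(s_j)\int_{-\infty}^0U_W(r,s_jy)\,\mathbb{P}(V^-\in \mathrm{d}y)=\sum_{k=0}^{m+\ell}a_k(r)s_j^k,\qquad j=1,\dots,\ell$$ (with $U_W(r,\cdot)$ expressed through the formula above), and $$\sum_{k=0}^{m+\ell}\delta_i(r)^k\,a_k(r)=-e^{-\delta_i(r)w}D_Y(\delta_i(r)),\qquad i=1,\dots,m,$$ where $\delta_1(r),\dots,\delta_m(r)$ are the $m$ zeros of $1-rp\,\Phi_Y(s)$ in the right half-plane $\mathrm{Re}\,s>0$. (2) If $a\ne1$, then $$U_W(r,s)=\sum_{h=0}^{\infty}\Big(e^{-a^hsw}+\frac{\sum_{k=0}^{m+\ell}a_k(r)(a^hs)^k}{D_Y(a^hs)}\Big)(rp)^h\prod_{j=0}^{h-1}\Phi_Y(a^js),$$ where $a_0(r)$ is given by the same expression as in (1), and the remaining constants $a_1(r),\dots,a_{m+\ell}(r)$ can be determined from the linear systems $$\sum_{k=0}^{m+\ell}(-t_i)^ka_k(r)\left(1+rp\,N_Y(-t_i)\sum_{h=0}^{\infty}\frac{a^{k(h+1)}(rp)^h\prod_{j=0}^{h-1}\Phi_Y(-a^{j+1}t_i)}{D_Y(-a^{h+1}t_i)}\right)=-rp\,N_Y(-t_i)\sum_{h=0}^{\infty}e^{a^{h+1}t_iw}(rp)^h\prod_{j=0}^{h-1}\Phi_Y(-a^{j+1}t_i)$$ for $i=1,\dots,m$, and $$\sum_{k=0}^{m+\ell}d_k(r,s_j)\,a_k(r)=r(1-p)N_Y(s_j)\sum_{h=0}^{\infty}(rp)^h\int_{-\infty}^0e^{-a^hs_jyw}\prod_{i=0}^{h-1}\Phi_Y(a^is_jy)\,\mathbb{P}(V^-\in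 \mathrm{d}y)$$ for $j=1,\dots,\ell$, where $$d_k(r,s_j)=s_j^k\left(1-r(1-p)N_Y(s_j)\sum_{h=0}^{\infty}(rp)^h\int_{-\infty}^0\frac{(a^hy)^k\prod_{i=0}^{h-1}\Phi_Y(a^is_jy)}{D_Y(a^hs_jy)}\,\mathbb{P}(V^-\in \mathrm{d}y)\right).$$
   Context: Notation: $[x]^+=\max\{x,0\}$; $\Phi_X(s)=\mathbb{E}e^{-sX}$ for a non-negative random variable $X$, with rational transforms read as rational functions where needed; $U_W(r,s)=\sum_{i=0}^\infty r^i\,\mathbb{E}e^{-sW_i}$ for $\mathrm{Re}\,s\ge0$. Empty products equal 1.
   Formalization: Unique determination is claimed only for distinct s_j (in (2) also t_i), and in (1) for U_W continuous at the δ_i; in (2) the displayed systems are stated where no D_Y(-a^{h+1}t_i) vanishes and the integrals over V^- exist with absolutely convergent sums. *)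

(* Defs.v *)
From HB Require Import structures.
From mathcomp Require Import all_boot all_order all_algebra.
From mathcomp Require Import all_classical all_reals all_analysis.
From mathcomp Require Export complex.

Set Implicit Arguments.
Unset Strict Implicit.
Unset Printing Implicit Defensive.

Import Order.TTheory GRing.Theory Num.Theory.
Import numFieldNormedType.Exports.

Local Open Scope classical_set_scope.
Local Open Scope ring_scope.
Local Open Scope complex_scope.

Section ComplexAnalysis.
Context {R : realType}.
Local Notation C := R[i].

Definition cexp (z : C) : C :=
  (expR (complex.Re z))%:C * (cos (complex.Im z) +i* sin (complex.Im z)).

Definition cabs (z : C) : R := complex.Re `|z|.

Definition cint d (T : measurableType d) (mu : {measure set T -> \bar R})
    (D : set T) (f : T -> C) : C :=
  (\int[mu]_(x in D) complex.Re (f x)) +i* (\int[mu]_(x in D) complex.Im (f x)).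

(* R[i]^o carries the norm topology of the complex plane. *)
Definition cseries (u : nat -> C) : nat -> R[i]^o :=
  fun n => \sum_(0 <= i < n) u i.

Definition csum (u : nat -> C) : C := limn (cseries u).

Definition has_csum (u : nat -> C) (z : C) : Prop :=
  cseries u @ \oo --> (z : R[i]^o).

Definition polyval n (b : 'I_n.+1 -> C) (s : C) : C :=
  \sum_(k < n.+1) b k * s ^+ k.

(* z_0, ..., z_(n-1) lists the zeros of q in the open right half-plane, each
   repeated according to its multiplicity. *)
Definition rhp_zeros n (q : {poly C}) (z : 'I_n -> C) : Prop :=
  (forall i, 0 < complex.Re (z i)) /\
  exists2 g : {poly C}, q = g * \prod_(i < n) ('X - (z i)%:P) &
    forall x : C, 0 < complex.Re x -> ~~ root g x.

(* u is the quotient num / den on the open right half-plane, its removable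
   singularities being filled in by continuity. *)
Definition rhp_quotient (num den u : C -> C) : Prop :=
  (forall s : C, 0 < complex.Re s -> den s != 0 -> u s = num s / den s) /\
  (forall s : R[i]^o, 0 < complex.Re s ->
     {for s, continuous (u : R[i]^o -> R[i]^o)}).

End ComplexAnalysis.

Section Process.
Context {R : realType} d {T : measurableType d}.
Local Notation C := R[i].

Definition LST (P : probability T R) (X : T -> R) (s : C) : C :=
  cint P setT (fun x => cexp (- (s * (X x)%:C))).

Definition identically_distributed (P : probability T R)
    (X : nat -> {RV P >-> R}) : Prop :=
  forall (i : nat) (E : set R), measurable E ->
    P (X i @^-1` E) = P (X 0%N @^-1` E).

Definition mutually_independent (P : probability T R) (I : eqType)
    (X : I -> {RV P >-> R}) : Prop :=
  forall (J : seq I) (E : I -> set R), uniq J ->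
    (forall i, measurable (E i)) ->
    fine (P (\big[setI/setT]_(i <- J) (X i @^-1` E i))) =
      \prod_(i <- J) fine (P (X i @^-1` E i)).

Definition joint_family (P : probability T R) (V A B : nat -> {RV P >-> R})
    (i : nat + nat + nat) : {RV P >-> R} :=
  match i with
  | inl (inl n) => V n
  | inl (inr n) => A n
  | inr n => B n
  end.

Fixpoint reflected (V A B : nat -> T -> R) (w : R) (i : nat) : T -> R :=
  if i is j.+1 then
    fun x => Num.max (V j x * reflected V A B w j x + B j x - A j x) 0
  else fun=> w.

Definition U_W (P : probability T R) (V A B : nat -> T -> R) (w r : R)
    (s : C) : C :=
  csum (fun i => (r ^+ i)%:C * LST P (reflected V A B w i) s).

End Process.

Section Systems.
Context {R : realType}.
Local Notation C := R[i].
Variables (l m : nat) (s_ : 'I_l -> C) (t_ : 'I_m -> C) (NB NA : {poly C}).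
Variables (w a p r : R) (nu : probability R R).
(* nu is the law of V^-. *)

Definition prod_roots n (z : 'I_n -> C) : {poly C} :=
  \prod_(j < n) ('X - (z j)%:P).

Definition D_Y : {poly C} := prod_roots s_ * (prod_roots t_ \Po (- 'X)).
Definition N_Y : {poly C} := NB * (NA \Po (- 'X)).
Definition Phi_Y (s : C) : C := N_Y.[s] / D_Y.[s].

(* The numerator of 1 - r p Phi_Y over the common denominator D_Y.  Its zeros
   are what the zeros of 1 - r p Phi_Y means: N_Y and D_Y may share a zero
   -t_i, and the count of m zeros in the right half-plane includes it. *)
Definition den1 : {poly C} := D_Y - (r * p)%:C *: N_Y.

Definition const_a0 : C :=
  (r / (1 - r) * (1 - p))%:C * (-1) ^+ (l + m)
    * \prod_(j < l) s_ j * \prod_(i < m) t_ i.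

(* The system at the s_j, with the function u in the role of U_W(r, .). *)
Definition s_system1 (b : 'I_(m + l).+1 -> C) (u : C -> C) (j : 'I_l) : Prop :=
  (r * (1 - p))%:C * N_Y.[s_ j]
    * cint nu `]-oo, 0[ (fun y => u (s_ j * y%:C)) = polyval b (s_ j).

Definition delta_system (b : 'I_(m + l).+1 -> C) (delta : 'I_m -> C)
    (i : 'I_m) : Prop :=
  \sum_(k < (m + l).+1) delta i ^+ k * b k
  = - cexp (- (delta i * w%:C)) * D_Y.[delta i].

Definition U_term (b : 'I_(m + l).+1 -> C) (s : C) (h : nat) : C :=
  (cexp (- ((a ^+ h)%:C * s * w%:C))
     + polyval b ((a ^+ h)%:C * s) / D_Y.[(a ^+ h)%:C * s])
  * ((r * p) ^+ h)%:C * \prod_(j < h) Phi_Y ((a ^+ j)%:C * s).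

(* The summands of the two series in the system at the -t_i. *)
Definition t_coef_term (i : 'I_m) (k h : nat) : C :=
  (a ^+ (k * h.+1))%:C * ((r * p) ^+ h)%:C
    * (\prod_(j < h) Phi_Y (- ((a ^+ j.+1)%:C * t_ i)))
    / D_Y.[- ((a ^+ h.+1)%:C * t_ i)].

Definition t_rhs_term (i : 'I_m) (h : nat) : C :=
  cexp ((a ^+ h.+1)%:C * t_ i * w%:C) * ((r * p) ^+ h)%:C
    * \prod_(j < h) Phi_Y (- ((a ^+ j.+1)%:C * t_ i)).

Definition t_system (b : 'I_(m + l).+1 -> C) (i : 'I_m) : Prop :=
  \sum_(k < (m + l).+1) (- t_ i) ^+ k * b k
     * (1 + (r * p)%:C * N_Y.[- t_ i] * csum (t_coef_term i k))
  = - (r * p)%:C * N_Y.[- t_ i] * csum (t_rhs_term i).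

(* No denominator of the system at -t_i vanishes. *)
Definition t_regular (i : 'I_m) : Prop :=
  forall h : nat, D_Y.[- ((a ^+ h.+1)%:C * t_ i)] != 0.

Definition t_convergent (i : 'I_m) : Prop :=
  (forall k : 'I_(m + l).+1, cvgn (cseries (t_coef_term i k))) /\
  cvgn (cseries (t_rhs_term i)).

(* The integrands of the system at the s_j. *)
Definition d_integrand (j : 'I_l) (k h : nat) (y : R) : C :=
  ((a ^+ h * y) ^+ k)%:C * (\prod_(i < h) Phi_Y ((a ^+ i)%:C * s_ j * y%:C))
    / D_Y.[(a ^+ h)%:C * s_ j * y%:C].

Definition s_rhs_integrand (j : 'I_l) (h : nat) (y : R) : C :=
  cexp (- ((a ^+ h)%:C * s_ j * y%:C * w%:C))
    * \prod_(i < h) Phi_Y ((a ^+ i)%:C * s_ j * y%:C).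

Definition d_coef (j : 'I_l) (k : nat) : C :=
  s_ j ^+ k * (1 - (r * (1 - p))%:C * N_Y.[s_ j]
    * csum (fun h => ((r * p) ^+ h)%:C * cint nu `]-oo, 0[ (d_integrand j k h))).

Definition s_system (b : 'I_(m + l).+1 -> C) (j : 'I_l) : Prop :=
  \sum_(k < (m + l).+1) d_coef j k * b k
  = (r * (1 - p))%:C * N_Y.[s_ j]
      * csum (fun h => ((r * p) ^+ h)%:C
                         * cint nu `]-oo, 0[ (s_rhs_integrand j h)).

Definition abs_convergent (f : nat -> R -> C) : Prop :=
  (\sum_(0 <= h <oo)
      (((r * p) ^+ h)%:E * \int[nu]_(y in `]-oo, 0%R[) (cabs (f h y))%:E)
    < +oo)%E.

(* The half-line s_j y, y < 0, may run through the poles of the functions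
   Phi_Y(a^i .), in which case the integrals of the system at s_j need not
   exist.  s_regular says that they exist, and that the sums over h converge
   absolutely: poles are negligible for nu and every sum of integrals is finite
   in absolute value. *)
Definition s_regular (j : 'I_l) : Prop :=
  [/\ {ae nu, forall y, forall h : nat, D_Y.[(a ^+ h)%:C * s_ j * y%:C] != 0},
      (forall k : 'I_(m + l).+1, abs_convergent (d_integrand j k)) &
      abs_convergent (s_rhs_integrand j)].

End Systems.

(* Main.v *)
Require Import Defs.
From HB Require Import structures.
From mathcomp Require Import all_boot all_order all_algebra.
From mathcomp Require Import all_classical all_reals all_analysis measurable_realfun.
From mathcomp Require Import ring lra.

Set Implicit Arguments.
Unset Strict Implicit.
Unset Printing Implicit Defensive.

Import Order.TTheory GRing.Theory Num.Theory.
Import numFieldNormedType.Exports.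

Local Open Scope classical_set_scope.
Local Open Scope ring_scope.
Local Open Scope complex_scope.

(** A law on the half-line with a rational transform [N / D], the zeros of [D] lying in the left
    half-plane, integrates test functions like a linear combination of densities y^j e^(sigma y), by
    partial fractions. Hence the transform of its overshoot over any level u is again a polynomial
    Q_u over the same [D] ([overshoot_poly_exists]). Write Z_n for the transform of W_n. Integrating
    out A_n, then B_n, then V_n in the recursion, and clearing denominators, gives D_Y(s) Z_(n+1)(s)
    = p N_Y(s) Z_n(a s) + C_n(s) with C_n a polynomial of degree at most m + l ([chain_step]): V = a
    leaves a transform, while the reflection at 0 and the event V < 0 contribute only polynomials.

    Multiplying by r^(n+1) and summing yields the functional equation D_Y(s) (U(s) - e^(-sw)) = r p
    N_Y(s) U(a s) + C(s), and the a_k are the coefficients of C. The value C(0) comes from Z_n(0) =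
    1. At a zero s_j of D_B the polynomial Q_u reduces to N_B(s_j) e^(s_j u), which turns C(s_j)
    into the integral of U along the ray s_j y, y < 0 ([chain_s_defect]). At -t_i the left side
    vanishes, which expresses C(-t_i) through U(-a t_i) ([t_equation]).

    For a = 1 the equation is solved for U by division. The numerator must vanish at the zeros of
    D_Y - r p N_Y in the right half-plane; there are m of them because no zero of D_Y - x N_Y meets
    the imaginary axis as x goes from 0 to r p ([rhp_zeros_perturb]). For a different from 1 the
    equation is iterated along the orbit a^h s; the products of Phi_Y decrease geometrically
    ([weight_geometric]), so the iteration converges to the stated series, and substituting it in
    the relations at -t_i and s_j gives the linear systems.

    Uniqueness rests on a dual family. Starting the same recursion from (B_0 - u)^+ produces
    solutions of the equation without source that violate the relation at s_j by a multiple of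
    e^(s_j u); combining several levels u isolates one s_j at a time ([dual_basis]). For a = 1 their
    remainders span all polynomials that can occur as the difference of two candidates
    ([dual_remainder_span]). For a different from 1 they reduce the nonsingularity of the system to
    the independence of the equations at the -t_i, which follows from an asymptotic argument
    ([pole_functional_free]). *)

Notation Re := complex.Re.
Notation Im := complex.Im.

(** * Modulus, real part and imaginary part *)

Section ComplexModulus.
Context {R : realType}.
Local Notation C := R[i].
Implicit Types z w : C.

Lemma normE_cabs z : `|z| = (cabs z)%:C.
Proof. by rewrite /cabs normc_def. Qed.

Lemma cabsE z : cabs z = Num.sqrt (Re z ^+ 2 + Im z ^+ 2).
Proof. by rewrite /cabs normc_def. Qed.

Lemma cabs_ge0 z : 0 <= cabs z.
Proof. by rewrite cabsE sqrtr_ge0. Qed.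

Lemma cabsM z w : cabs (z * w) = cabs z * cabs w.
Proof. by apply: complexI; rewrite rmorphM -!normE_cabs normrM. Qed.

Lemma cabs_eq0 z : (cabs z == 0) = (z == 0).
Proof. by rewrite -(inj_eq (@complexI _)) -normE_cabs rmorph0 normr_eq0. Qed.

Lemma cabs0 : cabs (0 : C) = 0.
Proof. by apply/eqP; rewrite cabs_eq0. Qed.

Lemma cabs_gt0 z : (0 < cabs z) = (z != 0).
Proof. by rewrite lt_def cabs_eq0 cabs_ge0 andbT. Qed.

Lemma cabs1 : cabs (1 : C) = 1.
Proof. by apply: complexI; rewrite -normE_cabs normr1 rmorph1. Qed.

Lemma cabsN z : cabs (- z) = cabs z.
Proof. by rewrite /cabs normrN. Qed.

Lemma cabsV z : cabs z^-1 = (cabs z)^-1.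
Proof. by apply: complexI; rewrite fmorphV -!normE_cabs normfV. Qed.

Lemma cabsX z n : cabs (z ^+ n) = cabs z ^+ n.
Proof. by elim: n => [|n IH]; rewrite ?expr0 ?cabs1// !exprS cabsM IH. Qed.

Lemma cabs_real (x : R) : cabs x%:C = `|x|.
Proof. by rewrite cabsE /= expr0n/= addr0 sqrtr_sqr. Qed.

Lemma ler_cabsD z w : cabs (z + w) <= cabs z + cabs w.
Proof. by rewrite -lecR rmorphD -!normE_cabs ler_normD. Qed.

Lemma ler_cabsB z w : cabs (z - w) <= cabs z + cabs w.
Proof. by rewrite -(cabsN w) ler_cabsD. Qed.

Lemma cabs_distC z w : cabs (z - w) = cabs (w - z).
Proof. by rewrite -cabsN opprB. Qed.

Lemma cabs_prod I (s : seq I) (P : pred I) (F : I -> C) :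
  cabs (\prod_(i <- s | P i) F i) = \prod_(i <- s | P i) cabs (F i).
Proof. by apply: (big_morph cabs cabsM cabs1). Qed.

Lemma ler_cabs_sum I (s : seq I) (P : pred I) (F : I -> C) :
  cabs (\sum_(i <- s | P i) F i) <= \sum_(i <- s | P i) cabs (F i).
Proof.
elim/big_rec2: _ => [|i y1 y2 _ IH]; first by rewrite cabs0.
by apply: le_trans (ler_cabsD _ _) _; rewrite lerD2l.
Qed.

Lemma ler_Re_cabs z : `|Re z| <= cabs z.
Proof. by rewrite cabsE -sqrtr_sqr ler_wsqrtr// lerDl sqr_ge0. Qed.

Lemma ler_Im_cabs z : `|Im z| <= cabs z.
Proof. by rewrite cabsE -sqrtr_sqr ler_wsqrtr// lerDr sqr_ge0. Qed.

Lemma cabs_le_ReIm z : cabs z <= `|Re z| + `|Im z|.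
Proof.
case: z => x y /=; rewrite (_ : x +i* y = x%:C + 'i%C * y%:C); last first.
  by apply/eqP; rewrite eq_complex /=; apply/andP; split; apply/eqP; ring.
apply: le_trans (ler_cabsD _ _) _; rewrite cabsM !cabs_real.
by rewrite (_ : cabs 'i%C = 1) ?mul1r// cabsE/= expr0n/= expr1n add0r sqrtr1.
Qed.

Lemma ReD z w : Re (z + w) = Re z + Re w. Proof. by case: z w => [? ?] []. Qed.
Lemma ImD z w : Im (z + w) = Im z + Im w. Proof. by case: z w => [? ?] []. Qed.
Lemma ReN z : Re (- z) = - Re z. Proof. by case: z. Qed.
Lemma ImN z : Im (- z) = - Im z. Proof. by case: z. Qed.
Lemma ReM z w : Re (z * w) = Re z * Re w - Im z * Im w.
Proof. by case: z w => [? ?] []. Qed.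
Lemma ImM z w : Im (z * w) = Re z * Im w + Im z * Re w.
Proof. by case: z w => [? ?] [] *. Qed.
Lemma ReMr z (x : R) : Re (z * x%:C) = Re z * x.
Proof. by rewrite ReM /= mulr0 subr0. Qed.
Lemma ImMr z (x : R) : Im (z * x%:C) = Im z * x.
Proof. by rewrite ImM /= mulr0 add0r. Qed.
Lemma ReMl z (x : R) : Re (x%:C * z) = x * Re z.
Proof. by rewrite mulrC ReMr mulrC. Qed.
Lemma ImMl z (x : R) : Im (x%:C * z) = x * Im z.
Proof. by rewrite mulrC ImMr mulrC. Qed.
Lemma Re_sum I (s : seq I) (P : pred I) (F : I -> C) :
  Re (\sum_(i <- s | P i) F i) = \sum_(i <- s | P i) Re (F i).
Proof. by apply: (big_morph _ ReD). Qed.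
Lemma Im_sum I (s : seq I) (P : pred I) (F : I -> C) :
  Im (\sum_(i <- s | P i) F i) = \sum_(i <- s | P i) Im (F i).
Proof. by apply: (big_morph _ ImD). Qed.
Lemma complex_eq z w : Re z = Re w -> Im z = Im w -> z = w.
Proof. by case: z w => [? ?] [? ?] /= -> ->. Qed.

End ComplexModulus.

(** * Limits and continuity of complex-valued functions *)

Section ComplexConvergence.
Context {R : realType}.
Local Notation C := R[i].

(** Convergence by components lets real limit and integration lemmas apply directly; [cvg_ccvgP]
    relates it to the norm topology used in [has_csum]. *)
Definition ccvg T (F : set_system T) (u : T -> C) (z : C) : Prop :=
  (Re (u x) @[x --> F] --> Re z) /\ (Im (u x) @[x --> F] --> Im z).

Section Filter.
Context {T : Type} {F : set_system T} {FF : Filter F}.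
Implicit Types (u v : T -> C) (x y z : C).

Lemma ccvg_distP u z : ccvg F u z <->
  (forall e : R, 0 < e -> \forall x \near F, cabs (u x - z) < e).
Proof.
split=> [[/cvgrPdist_lt hr /cvgrPdist_lt hi] e e0|h].
  have e2 : 0 < e / 2 by rewrite divr_gt0.
  near=> x.
  apply: le_lt_trans (cabs_le_ReIm _) _; rewrite (splitr e) ReD ImD ReN ImN.
  by apply: ltrD; rewrite distrC; near: x; [exact: hr|exact: hi].
split; apply/cvgrPdist_lt => e e0; near=> x.
  rewrite -ReN -ReD; apply: le_lt_trans (ler_Re_cabs _) _.
  by rewrite cabs_distC; near: x; exact: h.
rewrite -ImN -ImD; apply: le_lt_trans (ler_Im_cabs _) _.
by rewrite cabs_distC; near: x; exact: h.
Unshelve. all: by end_near. Qed.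

Lemma ccvgP u z : ccvg F u z <-> (cabs (u x - z) @[x --> F] --> 0).
Proof.
rewrite ccvg_distP; split=> [h|/cvgrPdist_lt h e e0].
  apply/cvgrPdist_lt => e e0; near=> x.
  by rewrite sub0r normrN ger0_norm ?cabs_ge0//; near: x; exact: h.
by near=> x; rewrite -[cabs _]ger0_norm ?cabs_ge0// -normrN -sub0r; near: x;
  exact: h.
Unshelve. all: by end_near. Qed.

Lemma cvg_ccvgP u z : (u : T -> C^o) @ F --> (z : C^o) <-> ccvg F u z.
Proof.
rewrite ccvg_distP; split=> [/cvgrPdist_lt h e e0|h].
  have e0' : (0 : C) < e%:C by rewrite ltcR.
  near=> x; rewrite -ltcR cabs_distC -normE_cabs.
  by near: x; exact: h.
(* A positive element of [C] has zero imaginary part, so the radius is in fact real. *)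
apply/cvgrPdist_lt => e; rewrite ltcE /= => /andP[/eqP ie re].
near=> x; rewrite normE_cabs ltcE/= ie eqxx/= cabs_distC.
by near: x; exact: h.
Unshelve. all: by end_near. Qed.

Lemma ccvg_cst z : ccvg F (fun=> z) z.
Proof. by split; exact: cvg_cst. Qed.

Lemma ccvgD u v x y : ccvg F u x -> ccvg F v y ->
  ccvg F (fun t => u t + v t) (x + y).
Proof.
move=> [ur ui] [vr vi]; split.
  by under eq_fun do rewrite ReD; rewrite ReD; exact: cvgD.
by under eq_fun do rewrite ImD; rewrite ImD; exact: cvgD.
Qed.

Lemma ccvgN u x : ccvg F u x -> ccvg F (fun t => - u t) (- x).
Proof.
move=> [ur ui]; split.
  by under eq_fun do rewrite ReN; rewrite ReN; exact: cvgN.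
by under eq_fun do rewrite ImN; rewrite ImN; exact: cvgN.
Qed.

Lemma ccvgM u v x y : ccvg F u x -> ccvg F v y ->
  ccvg F (fun t => u t * v t) (x * y).
Proof.
move=> [ur ui] [vr vi]; split.
  by under eq_fun do rewrite ReM; rewrite ReM; apply: cvgB; exact: cvgM.
by under eq_fun do rewrite ImM; rewrite ImM; apply: cvgD; exact: cvgM.
Qed.

Lemma ccvgV u x : x != 0 -> ccvg F u x -> ccvg F (fun t => (u t)^-1) x^-1.
Proof.
move=> x0 [ur ui].
have E (z : C) : z^-1 = (Re z / (Re z ^+ 2 + Im z ^+ 2))
    +i* (- (Im z) / (Re z ^+ 2 + Im z ^+ 2)) by case: z => a b; rewrite /= mulNr.
have N0 : Re x ^+ 2 + Im x ^+ 2 != 0.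
  by apply: contraNneq x0 => h; rewrite -cabs_eq0 cabsE h sqrtr0.
have cN : (Re (u t) ^+ 2 + Im (u t) ^+ 2)^-1 @[t --> F] -->
    (Re x ^+ 2 + Im x ^+ 2)^-1.
  by apply: cvgV => //; apply: cvgD; rewrite expr2; under eq_fun do rewrite expr2;
    exact: cvgM.
split.
  by under eq_fun do rewrite E /=; rewrite E /=; exact: cvgM.
by under eq_fun do rewrite E /=; rewrite E /=; apply: cvgM => //; exact: cvgN.
Qed.

Lemma ccvg_sum (I : Type) (s : seq I) (P : pred I) (u : I -> T -> C) (x : I -> C) :
  (forall i, P i -> ccvg F (u i) (x i)) ->
  ccvg F (fun t => \sum_(i <- s | P i) u i t) (\sum_(i <- s | P i) x i).
Proof.
move=> h; elim: s => [|i s IH].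
  rewrite big_nil; under eq_fun do rewrite big_nil; exact: ccvg_cst.
rewrite big_cons; under eq_fun do rewrite big_cons.
by case: ifP => [Pi|_] //; apply: ccvgD => //; exact: h.
Qed.

Lemma ccvg_prod (I : Type) (s : seq I) (P : pred I) (u : I -> T -> C) (x : I -> C) :
  (forall i, P i -> ccvg F (u i) (x i)) ->
  ccvg F (fun t => \prod_(i <- s | P i) u i t) (\prod_(i <- s | P i) x i).
Proof.
move=> h; elim: s => [|i s IH].
  rewrite big_nil; under eq_fun do rewrite big_nil; exact: ccvg_cst.
rewrite big_cons; under eq_fun do rewrite big_cons.
by case: ifP => [Pi|_] //; apply: ccvgM => //; exact: h.
Qed.

Lemma ccvgX u x n : ccvg F u x -> ccvg F (fun t => u t ^+ n) (x ^+ n).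
Proof.
move=> h; elim: n => [|n IH].
  by under eq_fun do rewrite expr0; exact: ccvg_cst.
by under eq_fun do rewrite exprS; rewrite exprS; exact: ccvgM.
Qed.

Lemma ccvg_real (f : T -> R) (x : R) :
  f @ F --> x -> ccvg F (fun t => (f t)%:C) x%:C.
Proof. by move=> h; split => //=; exact: cvg_cst. Qed.

Lemma ccvg_horner (p : {poly C}) u x :
  ccvg F u x -> ccvg F (fun t => p.[u t]) p.[x].
Proof.
move=> h; under eq_fun do rewrite horner_coef; rewrite horner_coef.
by apply: ccvg_sum => i _; apply: ccvgM; [exact: ccvg_cst|exact: ccvgX].
Qed.

Lemma ccvg0_le u (g : T -> R) : (\forall x \near F, cabs (u x) <= g x) ->
  g @ F --> 0 -> ccvg F u 0.
Proof.
move=> ug g0; apply/ccvgP; under eq_fun do rewrite subr0.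
apply: squeeze_cvgr g0; last exact: (@cvg_cst R).
by apply: filterS ug => x ->; rewrite cabs_ge0.
Qed.

Lemma ccvg_near_eq u v x : (\forall t \near F, u t = v t) ->
  ccvg F u x -> ccvg F v x.
Proof.
move=> uv /ccvg_distP h; apply/ccvg_distP => e e0.
by near=> t; rewrite -(near uv t)//; near: t; exact: h.
Unshelve. all: by end_near. Qed.

Lemma ccvg_cabs u x : ccvg F u x -> (cabs (u t) @[t --> F] --> cabs x).
Proof.
move=> /ccvg_distP h; apply/cvgrPdist_lt => e e0; near=> t.
have : cabs (u t - x) < e by near: t; exact: h.
apply: le_lt_trans; rewrite ler_norml.
have := ler_cabsD (x - u t) (u t); have := ler_cabsD (u t - x) x.
by rewrite !subrK (cabs_distC x) => ? ?; apply/andP; split; lra.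
Unshelve. all: by end_near. Qed.

End Filter.

Lemma ccvg_unique T (F : set_system T) {FF : ProperFilter F} (u : T -> C) x y :
  ccvg F u x -> ccvg F u y -> x = y.
Proof.
move=> [xr xi] [yr yi]; apply: complex_eq.
- exact: (cvg_unique (@Rhausdorff R) xr yr).
- exact: (cvg_unique (@Rhausdorff R) xi yi).
Qed.

Lemma ccvg_comp T S (F : set_system T) (G : set_system S) (f : T -> S)
    (u : S -> C) x :
  f @ F --> G -> ccvg G u x -> ccvg F (u \o f) x.
Proof. by move=> fG [ur ui]; split; [exact: cvg_comp fG ur|exact: cvg_comp fG ui]. Qed.

(** Continuity with real radii, which avoids the partial order of [C]; [ccontinuous_atP] gives the
    equivalence with the topological notion. *)
Definition ccontinuous_at (u : C -> C) (s : C) : Prop :=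
  forall e : R, 0 < e -> exists2 h : R, 0 < h &
    forall z, cabs (z - s) < h -> cabs (u z - u s) < e.

Lemma ccontinuous_atP (u : C -> C) (s : C) :
  {for (s : C^o), continuous (u : C^o -> C^o)} <-> ccontinuous_at u s.
Proof.
split=> [/(cvg_ccvgP (F := nbhs (s : C^o))) /ccvg_distP h e e0|h].
  have /nbhs_ballP[d d0 sd] := h e e0.
  move: d0; rewrite /= ltcE /= => /andP[/eqP id rd].
  exists (Re d) => // z zd; apply: sd.
  by rewrite -ball_normE /= normE_cabs ltcE/= id eqxx/= cabs_distC.
apply/(cvg_ccvgP (F := nbhs (s : C^o))); apply/ccvg_distP => e e0.
have [d d0 hd] := h e e0.
apply/nbhs_ballP; exists (d%:C) => /=; first by rewrite ltcR.
move=> z; rewrite -ball_normE /= normE_cabs ltcR cabs_distC => zs.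
by rewrite cabs_distC; apply: hd; rewrite cabs_distC.
Qed.

Lemma ccontinuous_at_cvg T (F : set_system T) {FF : Filter F} (u : C -> C) (s : C)
    (f : T -> C) : ccontinuous_at u s -> ccvg F f s -> ccvg F (u \o f) (u s).
Proof.
move=> us /ccvg_distP fs; apply/ccvg_distP => e /us[h h0 hu].
by near=> t; apply: hu; near: t; exact: fs.
Unshelve. all: by end_near. Qed.

End ComplexConvergence.

(** * The complex exponential *)

Section ComplexExponential.
Context {R : realType}.
Local Notation C := R[i].
Implicit Types z w : C.

Lemma cexpD z w : cexp (z + w) = cexp z * cexp w.
Proof.
rewrite /cexp ReD ImD expRD cosD sinD rmorphM /=.
rewrite mulrACA; congr (_ * _).
by apply: complex_eq; rewrite ?ReM ?ImM /=; ring.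
Qed.

Lemma cexp0 : cexp (0 : C) = 1.
Proof.
by rewrite /cexp /= expR0 cos0 sin0 mul1r.
Qed.

Lemma cexpN z : cexp (- z) = (cexp z)^-1.
Proof.
have h : cexp (- z) * cexp z = 1 by rewrite -cexpD addNr cexp0.
have z0 : cexp z != 0 by apply: contra_eq_neq h => ->; rewrite mulr0 eq_sym oner_eq0.
by apply: (mulIf z0); rewrite h mulVf.
Qed.

Lemma cexp_neq0 z : cexp z != 0.
Proof.
have h : cexp (- z) * cexp z = 1 by rewrite -cexpD addNr cexp0.
by apply: contra_eq_neq h => ->; rewrite mulr0 eq_sym oner_eq0.
Qed.

Lemma cexpMn z n : cexp (z *+ n) = cexp z ^+ n.
Proof. by elim: n => [|n IH]; rewrite ?mulr0n ?cexp0// mulrS cexpD exprS IH. Qed.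

Lemma cabs_cexp z : cabs (cexp z) = expR (Re z).
Proof.
rewrite /cexp cabsM cabs_real ger0_norm ?expR_ge0// cabsE /= cos2Dsin2 sqrtr1.
by rewrite mulr1.
Qed.

Lemma cexp_real (x : R) : cexp x%:C = (expR x)%:C.
Proof. by rewrite /cexp /= cos0 sin0 mulr1. Qed.

Lemma Re_cexp z : Re (cexp z) = expR (Re z) * cos (Im z).
Proof. by rewrite /cexp ReMl. Qed.

Lemma Im_cexp z : Im (cexp z) = expR (Re z) * sin (Im z).
Proof. by rewrite /cexp ImMl. Qed.

Lemma cabs_cexp_le1 z : Re z <= 0 -> cabs (cexp z) <= 1.
Proof. by move=> z0; rewrite cabs_cexp -expR0 ler_expR. Qed.

Lemma ccvg_cexp T (F : set_system T) {FF : Filter F} (u : T -> C) z :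
  ccvg F u z -> ccvg F (fun t => cexp (u t)) (cexp z).
Proof.
move=> [ur ui]; split.
  under eq_fun do rewrite Re_cexp; rewrite Re_cexp; apply: cvgM.
    by apply: continuous_cvg => //; exact: continuous_expR.
  by apply: continuous_cvg => //; exact: continuous_cos.
under eq_fun do rewrite Im_cexp; rewrite Im_cexp; apply: cvgM.
  by apply: continuous_cvg => //; exact: continuous_expR.
by apply: continuous_cvg => //; exact: continuous_sin.
Qed.

End ComplexExponential.

(** * Complex series dominated by geometric ones *)

Section ComplexSeries.
Context {R : realType}.
Local Notation C := R[i].
Implicit Types (u v : nat -> C) (z x y : C).

Lemma has_csumP u z :
  has_csum u z <-> ccvg \oo (fun n => \sum_(0 <= i < n) u i) z.
Proof. exact: (cvg_ccvgP (F := \oo)). Qed.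

Lemma has_csum_unique u x y : has_csum u x -> has_csum u y -> x = y.
Proof. by move=> /has_csumP ux /has_csumP uy; apply: ccvg_unique ux uy. Qed.

Lemma has_csumE u z : has_csum u z -> csum u = z.
Proof.
move=> uz; have cu : cvgn (cseries u) by apply/cvg_ex; exists z.
exact: (has_csum_unique (u := u) cu uz).
Qed.

Lemma has_csum_cvg u z : has_csum u z -> cvgn (cseries u).
Proof. by move=> uz; apply/cvg_ex; exists z. Qed.

Lemma has_csumD u v x y : has_csum u x -> has_csum v y ->
  has_csum (fun n => u n + v n) (x + y).
Proof.
move=> /has_csumP ux /has_csumP vy; apply/has_csumP.
by under eq_fun do rewrite big_split; exact: ccvgD.
Qed.

Lemma has_csumZ u x c : has_csum u x -> has_csum (fun n => c * u n) (c * x).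
Proof.
move=> /has_csumP ux; apply/has_csumP.
by under eq_fun do rewrite -mulr_sumr; apply: ccvgM => //; exact: ccvg_cst.
Qed.

Lemma has_csumN u x : has_csum u x -> has_csum (fun n => - u n) (- x).
Proof.
by move=> /(has_csumZ (c := -1)); rewrite mulN1r; under eq_fun do rewrite mulN1r.
Qed.

Lemma has_csumB u v x y : has_csum u x -> has_csum v y ->
  has_csum (fun n => u n - v n) (x - y).
Proof. by move=> ux vy; exact: (has_csumD ux (has_csumN vy)). Qed.

Lemma has_csum_sum (I : Type) (s : seq I) (P : pred I) (u : I -> nat -> C) (x : I -> C) :
  (forall i, P i -> has_csum (u i) (x i)) ->
  has_csum (fun n => \sum_(i <- s | P i) u i n) (\sum_(i <- s | P i) x i).
Proof.
move=> h; apply/has_csumP; under eq_fun do rewrite exchange_big.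
by apply: ccvg_sum => i Pi; apply/has_csumP; exact: h.
Qed.

Lemma ccvg_shiftS u x : ccvg \oo (fun n => u n.+1) x <-> ccvg \oo u x.
Proof.
rewrite /ccvg -(cvg_shiftS (fun n => Re (u n))) -(cvg_shiftS (fun n => Im (u n))).
by [].
Qed.

Lemma has_csum_shift u x : has_csum u x <-> has_csum (fun n => u n.+1) (x - u 0%N).
Proof.
rewrite !has_csumP; split=> h.
  have : ccvg \oo (fun n => \sum_(0 <= i < n.+1) u i - u 0%N) (x - u 0%N).
    apply: ccvgD; last exact: ccvg_cst.
    by apply/(ccvg_shiftS (fun n => \sum_(0 <= i < n) u i)).
  by congr ccvg; apply/funext => n; rewrite big_nat_recl// addrC addKr.
have : ccvg \oo (fun n => \sum_(0 <= i < n) u i.+1 + u 0%N) (x - u 0%N + u 0%N).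
  by apply: ccvgD => //; exact: ccvg_cst.
rewrite subrK (_ : (fun n => _) = (fun n => \sum_(0 <= i < n.+1) u i)); last first.
  by apply/funext => n; rewrite big_nat_recl// addrC.
by move/(ccvg_shiftS (fun n => \sum_(0 <= i < n) u i)).
Qed.

(** Both the power series in [r] and the series along orbits are dominated in this way. *)
Definition geometric_bound u := exists K q : R,
  [/\ 0 <= q, q < 1 & forall n, cabs (u n) <= K * q ^+ n].

Lemma geometric_bound_csum u : geometric_bound u -> has_csum u (csum u).
Proof.
move=> [K [q [q0 q1 h]]].
have cvgK : cvgn (series (fun n => K * q ^+ n)).
  by apply: is_cvg_geometric_series; rewrite ger0_norm.
have cvgr (f : C -> R) : (forall z, `|f z| <= cabs z) -> cvgn (series (fun n => f (u n))).
  move=> fz; apply: normed_cvg; apply: series_le_cvg cvgK => n //.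
  - exact: normr_ge0.
  - exact: (le_trans (cabs_ge0 (u n)) (h n)).
  - exact: (le_trans (fz _) (h n)).
have [/cvg_ex[x hx] /cvg_ex[y hy]] := (cvgr _ (@ler_Re_cabs R), cvgr _ (@ler_Im_cabs R)).
have : has_csum u (x +i* y).
  apply/has_csumP; split.
    by under eq_fun do rewrite Re_sum; exact: hx.
  by under eq_fun do rewrite Im_sum; exact: hy.
by move=> ux; rewrite (has_csumE ux).
Qed.

Lemma cabs_csum_le u (K q : R) : 0 <= q -> q < 1 ->
  (forall n, cabs (u n) <= K * q ^+ n) -> cabs (csum u) <= K / (1 - q).
Proof.
move=> q0 q1 h.
have /has_csumP /ccvg_cabs hu : has_csum u (csum u).
  by apply: geometric_bound_csum; exists K, q.
apply: (ler_cvg_to hu (@cvg_geometric_series _ K q _)).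
  by rewrite ger0_norm.
near=> n; apply: le_trans (ler_cabs_sum _ _ _) _.
by apply: ler_sum => i _; exact: h.
Unshelve. all: by end_near. Qed.

Lemma has_csum_tail u x N :
  has_csum u x -> has_csum (fun i => u (N + i)%N) (x - \sum_(0 <= i < N) u i).
Proof.
move=> ux; elim: N => [|N IH].
  rewrite (big_geq (leqnn 0)) subr0; exact: ux.
rewrite (big_nat_recr _ _ _ (leq0n N)) /= opprD addrA.
have -> : (fun i => u (N.+1 + i)%N) = (fun i => u (N + i.+1)%N).
  by apply/funext => i; rewrite addSnnS.
have /= := (has_csum_shift (fun i => u (N + i)%N) _).1 IH.
by rewrite addn0.
Qed.

(** Tannery's theorem: the tails beyond [N] are at most K q^N / (1 - q) uniformly in [n], and the
    first [N] terms converge one by one. *)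
Lemma ccvg_csum (u : nat -> nat -> C) (v : nat -> C) (K q : R) : 0 <= q -> q < 1 ->
  0 <= K -> (forall n i, cabs (u n i) <= K * q ^+ i) ->
  (forall i, ccvg \oo (u ^~ i) (v i)) ->
  ccvg \oo (fun n => csum (u n)) (csum v).
Proof.
move=> q0 q1 K0 uK uv.
have vK i : cabs (v i) <= K * q ^+ i.
  have cu : cabs (u n i) @[n --> \oo] --> cabs (v i) by apply: ccvg_cabs; exact: uv.
  have cK : (fun=> K * q ^+ i) @ \oo --> K * q ^+ i by exact: cvg_cst.
  by apply: (ler_cvg_to cu cK); apply: nearW => n; exact: uK.
have tail w N : (forall i, cabs (w i) <= K * q ^+ i) ->
    cabs (csum w - \sum_(0 <= i < N) w i) <= (K * q ^+ N) / (1 - q).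
  move=> wK; have gw : geometric_bound w by exists K, q.
  have <- := has_csumE (has_csum_tail (N := N) (geometric_bound_csum gw)).
  by apply: cabs_csum_le => // i; rewrite -mulrA -exprD; exact: wK.
have h0 : (K * q ^+ N) / (1 - q) @[N --> \oo] --> (0 : R).
  have q1' : `|q| < 1 by rewrite ger0_norm.
  have := cvgMr_tmp (b := (1 - q)^-1) (cvg_geometric K q1').
  by rewrite mul0r => h; exact: h.
apply/ccvg_distP => e e0.
have e3 : 0 < e / 3 by rewrite divr_gt0.
move/cvgrPdist_lt : h0 => /(_ _ e3)[N _ /(_ N (leqnn N))] /=.
rewrite sub0r normrN ger0_norm; last first.
  by rewrite divr_ge0 ?subr_ge0 ?(ltW q1)// mulr_ge0// exprn_ge0.
move=> hN.
have cs : ccvg \oo (fun n => \sum_(0 <= i < N) u n i) (\sum_(0 <= i < N) v i).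
  by apply: ccvg_sum => i _; exact: uv.
move/ccvg_distP : cs => /(_ _ e3) cs.
near=> n.
have -> : csum (u n) - csum v = (csum (u n) - \sum_(0 <= i < N) u n i)
    + ((\sum_(0 <= i < N) u n i - \sum_(0 <= i < N) v i)
    - (csum v - \sum_(0 <= i < N) v i)) by ring.
apply: le_lt_trans (ler_cabsD _ _) _.
have -> : e = e / 3 + (e / 3 + e / 3) by field.
apply: ltrD; first exact: le_lt_trans (tail _ N (uK n)) hN.
apply: le_lt_trans (ler_cabsB _ _) _; apply: ltrD; first by near: n.
exact: le_lt_trans (tail _ N vK) hN.
Unshelve. all: by end_near. Qed.

Lemma geometric_boundW (u : nat -> C) (K r : R) : 0 <= r -> r < 1 ->
  (forall n, cabs (u n) <= K) -> geometric_bound (fun n => (r ^+ n)%:C * u n).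
Proof.
move=> r0 r1 h; exists K, r; split => // n.
rewrite cabsM cabs_real ger0_norm ?exprn_ge0// mulrC ler_wpM2r ?exprn_ge0//.
Qed.

(** Ratio test. The ratio is a factor [rho n] rather than a quotient, so that terms of [u] may
    vanish. *)
Lemma geometric_bound_ratio u (rho : nat -> C) (x : C) :
  (forall n, u n.+1 = rho n * u n) -> ccvg \oo rho x -> cabs x < 1 ->
  geometric_bound u.
Proof.
move=> hu hr x1.
pose q := (cabs x + 1) / 2.
have q1 : q < 1 by rewrite /q; lra.
have q0 : 0 < q by rewrite /q; have := cabs_ge0 x; lra.
have qx : 0 < q - cabs x by rewrite /q; lra.
have /cvgrPdist_lt hc : cabs (rho n) @[n --> \oo] --> cabs x by exact: ccvg_cabs.
have [N _ hN] := hc _ qx.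
have hq n : (N <= n)%N -> cabs (rho n) <= q.
  by move=> /hN /=; rewrite ltr_norml => /andP[h _]; lra.
(* This constant handles the indices up to [N]; beyond, each step multiplies by at most [q]. *)
pose K := \sum_(i < N.+1) cabs (u i) / q ^+ i.
have KN n : (n <= N)%N -> cabs (u n) <= K * q ^+ n.
  move=> nN; rewrite -ler_pdivrMr ?exprn_gt0// /K.
  rewrite (bigD1 (Ordinal (nN : (n < N.+1)%N)))//= lerDl sumr_ge0// => i _.
  by rewrite divr_ge0 ?cabs_ge0 ?exprn_ge0// ltW.
exists K, q; split => //; first exact: ltW.
elim=> [|n IH]; first exact: KN.
have [/KN//|Nn] := leqP n.+1 N.
rewrite hu cabsM exprS mulrCA ler_pM ?cabs_ge0//.
exact: hq.
Qed.

Lemma geometric_bound_le u v K : (forall n, cabs (v n) <= K * cabs (u n)) -> 0 <= K ->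
  geometric_bound u -> geometric_bound v.
Proof.
move=> h K0 [L [q [q0 q1 hL]]]; exists (K * L), q; split => // n.
by apply: le_trans (h n) _; rewrite -mulrA ler_wpM2l.
Qed.

Lemma geometric_bound_cvg0 u : geometric_bound u -> ccvg \oo u 0.
Proof.
move=> [K [q [q0 q1 h]]]; apply: (ccvg0_le (g := fun n => K * q ^+ n)).
  by apply: nearW => n; exact: h.
by apply: cvg_geometric; rewrite ger0_norm.
Qed.

End ComplexSeries.

(** * Measurability of complex-valued functions *)

Section ComplexMeasurability.
Context {R : realType} d {T : measurableType d}.
Local Notation C := R[i].
Implicit Types (D : set T) (f g : T -> C).

Definition cmeasurable D f : Prop :=
  measurable_fun D (fun x => Re (f x)) /\ measurable_fun D (fun x => Im (f x)).

Lemma cmeasurable_cst D (c : C) : cmeasurable D (fun=> c).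
Proof. by split; exact: measurable_cst. Qed.

Lemma cmeasurable_real D (h : T -> R) :
  measurable_fun D h -> cmeasurable D (fun x => (h x)%:C).
Proof. by move=> mh; split => //; exact: measurable_cst. Qed.

Lemma cmeasurableD D f g : cmeasurable D f -> cmeasurable D g ->
  cmeasurable D (fun x => f x + g x).
Proof.
move=> [fr fi] [gr gi]; split.
  by under eq_fun do rewrite ReD; exact: measurable_funD.
by under eq_fun do rewrite ImD; exact: measurable_funD.
Qed.

Lemma cmeasurableN D f : cmeasurable D f -> cmeasurable D (fun x => - f x).
Proof.
move=> [fr fi]; split.
  by under eq_fun do rewrite ReN; exact: measurable_funN.
by under eq_fun do rewrite ImN; exact: measurable_funN.
Qed.

Lemma cmeasurableM D f g : cmeasurable D f -> cmeasurable D g ->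
  cmeasurable D (fun x => f x * g x).
Proof.
move=> [fr fi] [gr gi]; split.
  by under eq_fun do rewrite ReM; apply: measurable_funB; exact: measurable_funM.
by under eq_fun do rewrite ImM; apply: measurable_funD; exact: measurable_funM.
Qed.

Lemma cmeasurable_sum D (I : Type) (s : seq I) (P : pred I) (F : I -> T -> C) :
  (forall i, P i -> cmeasurable D (F i)) ->
  cmeasurable D (fun x => \sum_(i <- s | P i) F i x).
Proof.
move=> h; elim: s => [|i s IH].
  by under [X in cmeasurable _ X]eq_fun do rewrite big_nil; exact: cmeasurable_cst.
under [X in cmeasurable _ X]eq_fun do rewrite big_cons.
by case Pi: (P i) => //; apply: cmeasurableD => //; exact: h.
Qed.

Lemma cmeasurable_prod D (I : Type) (s : seq I) (P : pred I) (F : I -> T -> C) :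
  (forall i, P i -> cmeasurable D (F i)) ->
  cmeasurable D (fun x => \prod_(i <- s | P i) F i x).
Proof.
move=> h; elim: s => [|i s IH].
  by under [X in cmeasurable _ X]eq_fun do rewrite big_nil; exact: cmeasurable_cst.
under [X in cmeasurable _ X]eq_fun do rewrite big_cons.
by case Pi: (P i) => //; apply: cmeasurableM => //; exact: h.
Qed.

Lemma cmeasurableX D f n : cmeasurable D f -> cmeasurable D (fun x => f x ^+ n).
Proof.
move=> h; elim: n => [|n IH].
  by under [X in cmeasurable _ X]eq_fun do rewrite expr0; exact: cmeasurable_cst.
by under [X in cmeasurable _ X]eq_fun do rewrite exprS; exact: cmeasurableM.
Qed.

Lemma cmeasurable_horner D (p : {poly C}) f :
  cmeasurable D f -> cmeasurable D (fun x => p.[f x]).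
Proof.
move=> h; under [X in cmeasurable _ X]eq_fun do rewrite horner_coef.
apply: cmeasurable_sum => i _; apply: cmeasurableM; first exact: cmeasurable_cst.
exact: cmeasurableX.
Qed.

Lemma measurable_cos : measurable_fun [set: R] (@cos R).
Proof. by apply: continuous_measurable_fun; exact: continuous_cos. Qed.

Lemma measurable_sin : measurable_fun [set: R] (@sin R).
Proof. by apply: continuous_measurable_fun; exact: continuous_sin. Qed.

Lemma cmeasurable_cexp D f : cmeasurable D f -> cmeasurable D (fun x => cexp (f x)).
Proof.
move=> [fr fi]; split.
  under eq_fun do rewrite Re_cexp; apply: measurable_funM.
    by apply: measurableT_comp => //; exact: measurable_expR.
  by apply: measurableT_comp => //; exact: measurable_cos.
under eq_fun do rewrite Im_cexp; apply: measurable_funM.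
  by apply: measurableT_comp => //; exact: measurable_expR.
by apply: measurableT_comp => //; exact: measurable_sin.
Qed.

Lemma measurable_inv : measurable_fun [set: R] (@GRing.inv R).
Proof.
(* The formula holds at 0 as well, where the inverse is 0 by convention, because of the factor
   [x]. *)
rewrite (_ : GRing.inv = fun x : R => x * expR (- ln (x ^+ 2))); last first.
  apply/funext => x; have [->|x0] := eqVneq x 0; first by rewrite invr0 mul0r.
  have x2 : 0 < x ^+ 2 by rewrite exprn_even_gt0.
  rewrite expRN lnK ?posrE// expr2 invfM mulrA divff// mul1r.
  by [].
apply: measurable_funM => //; apply: measurableT_comp; first exact: measurable_expR.
apply: measurable_funN; apply: measurableT_comp; first exact: measurable_ln.
exact: exprn_measurable.
Qed.

Lemma cmeasurableV D f : cmeasurable D f -> cmeasurable D (fun x => (f x)^-1).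
Proof.
move=> [fr fi].
have E (z : C) : z^-1 = (Re z * (Re z ^+ 2 + Im z ^+ 2)^-1)
    +i* (- (Im z) * (Re z ^+ 2 + Im z ^+ 2)^-1) by case: z => a b; rewrite /= mulNr.
have mi : measurable_fun D (fun x => (Re (f x) ^+ 2 + Im (f x) ^+ 2)^-1).
  apply: measurableT_comp; first exact: measurable_inv.
  by apply: measurable_funD; exact: measurable_funX.
split.
  by under eq_fun do rewrite E /=; exact: measurable_funM.
by under eq_fun do rewrite E /=; apply: measurable_funM => //; exact: measurable_funN.
Qed.

Lemma cmeasurable_cabs D f : cmeasurable D f -> measurable_fun D (fun x => cabs (f x)).
Proof.
move=> [fr fi]; under eq_fun do rewrite cabsE.
have ms : measurable_fun [set: R] (@Num.sqrt R).
  by apply: continuous_measurable_fun => x; exact: sqrt_continuous.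
apply: measurableT_comp => //.
by apply: measurable_funD; exact: measurable_funX.
Qed.

Lemma cmeasurable_ifT (b : T -> bool) f g : measurable_fun setT b ->
  cmeasurable setT f -> cmeasurable setT g ->
  cmeasurable setT (fun x => if b x then f x else g x).
Proof.
move=> mb [fr fi] [gr gi]; split.
  rewrite (_ : (fun x => _) = fun x => if b x then Re (f x) else Re (g x)).
    exact: measurable_fun_ifT.
  by apply/funext => x; case: ifP.
rewrite (_ : (fun x => _) = fun x => if b x then Im (f x) else Im (g x)).
  exact: measurable_fun_ifT.
by apply/funext => x; case: ifP.
Qed.

Lemma cmeasurable_cvg D (u : nat -> T -> C) f :
  (forall n, cmeasurable D (u n)) ->
  (forall x, D x -> ccvg \oo (fun n => u n x) (f x)) -> cmeasurable D f.
Proof.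
move=> mu uf; split.
  by apply: (measurable_fun_cvg (h := fun n x => Re (u n x))) => [n|x /uf[]//];
    have [] := mu n.
by apply: (measurable_fun_cvg (h := fun n x => Im (u n x))) => [n|x /uf[]//];
  have [] := mu n.
Qed.

Lemma cmeasurableS D f : cmeasurable setT f -> cmeasurable D f.
Proof. by move=> [? ?]; split; exact: measurable_funTS. Qed.

End ComplexMeasurability.

Lemma cmeasurable_comp (R : realType) d d' (T : measurableType d)
    (T' : measurableType d') (h : T' -> T) (f : T -> R[i]) (D : set T') :
  cmeasurable setT f -> measurable_fun D h -> cmeasurable D (fun x => f (h x)).
Proof. by move=> [fr fi] mh; split; [exact: measurableT_comp fr mh|exact: measurableT_comp fi mh]. Qed.

(** * Integration of complex-valued functions *)

Section ComplexIntegral.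
Context {R : realType} d {T : measurableType d} (mu : {measure set T -> \bar R}).
Local Notation C := R[i].
Implicit Types (D : set T) (f g : T -> C).

Definition cintegrable D f : Prop :=
  mu.-integrable D (EFin \o (fun x => Re (f x))) /\
  mu.-integrable D (EFin \o (fun x => Im (f x))).

Lemma cintegrable_measurable D f : cintegrable D f -> cmeasurable D f.
Proof. by move=> [/measurable_int/measurable_EFinP ? /measurable_int/measurable_EFinP]. Qed.

Lemma cintegrable_le D f (g : T -> R) : measurable D -> cmeasurable D f ->
  mu.-integrable D (EFin \o g) -> (forall x, D x -> cabs (f x) <= g x) ->
  cintegrable D f.
Proof.
move=> mD [fr fi] ig fg; split.
  apply: (le_integrable mD _ _ ig); first exact/measurable_EFinP.
  move=> x Dx; rewrite lee_fin/= (le_trans (ler_Re_cabs _))//.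
  by rewrite (le_trans (fg _ Dx))// ler_norm.
apply: (le_integrable mD _ _ ig); first exact/measurable_EFinP.
move=> x Dx; rewrite lee_fin/= (le_trans (ler_Im_cabs _))//.
by rewrite (le_trans (fg _ Dx))// ler_norm.
Qed.

Lemma cintegrable_cabs D f : measurable D -> cintegrable D f ->
  mu.-integrable D (EFin \o (fun x => cabs (f x))).
Proof.
move=> mD fint; have [fr fi] := fint.
apply: (le_integrable (g := fun x => (`|Re (f x)| + `|Im (f x)|)%:E) mD).
- exact/measurable_EFinP/cmeasurable_cabs/cintegrable_measurable.
- move=> x Dx; rewrite /= lee_fin (ger0_norm (cabs_ge0 _)).
  by rewrite ger0_norm ?addr_ge0//; exact: cabs_le_ReIm.
- by apply: (integrableD mD (f := EFin \o _) (g := EFin \o _));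
    exact: (integrable_norm).
Qed.

Lemma cintegrableD D f g : measurable D -> cintegrable D f -> cintegrable D g ->
  cintegrable D (fun x => f x + g x).
Proof.
move=> mD [fr fi] [gr gi]; split.
  rewrite (_ : _ \o _ = (EFin \o (fun x => Re (f x))) \+ (EFin \o (fun x => Re (g x))))%E.
    exact: integrableD.
  by apply/funext => x /=; rewrite ReD.
rewrite (_ : _ \o _ = (EFin \o (fun x => Im (f x))) \+ (EFin \o (fun x => Im (g x))))%E.
  exact: integrableD.
by apply/funext => x /=; rewrite ImD.
Qed.

Lemma cintD D f g : measurable D -> cintegrable D f -> cintegrable D g ->
  cint mu D (fun x => f x + g x) = cint mu D f + cint mu D g.
Proof.
move=> mD [fr fi] [gr gi]; apply: complex_eq; rewrite ?ReD ?ImD /=.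
  by under eq_Rintegral do rewrite ReD; exact: RintegralD.
by under eq_Rintegral do rewrite ImD; exact: RintegralD.
Qed.

Lemma cintegrableZ D f c : measurable D -> cintegrable D f ->
  cintegrable D (fun x => c * f x).
Proof.
move=> mD fint.
have mf := cintegrable_measurable fint.
apply: (cintegrable_le (g := fun x => cabs c * cabs (f x)) mD).
- by apply: cmeasurableM => //; exact: cmeasurable_cst.
- rewrite (_ : _ \o _ = (fun x => (cabs c)%:E * (EFin \o (fun x => cabs (f x))) x)%E).
    by apply: integrableZl => //; exact: cintegrable_cabs.
  by apply/funext => x.
- by move=> x _; rewrite cabsM.
Qed.

Lemma integrableZlR D (h : T -> R) (k : R) : measurable D ->
  mu.-integrable D (EFin \o h) -> mu.-integrable D (EFin \o (fun x => k * h x)).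
Proof.
move=> mD ih; rewrite (_ : _ \o _ = (fun x => k%:E * (EFin \o h) x)%E).
  exact: integrableZl.
by apply/funext => x.
Qed.

Lemma cintZ D f c : measurable D -> cintegrable D f ->
  cint mu D (fun x => c * f x) = c * cint mu D f.
Proof.
move=> mD [fr fi]; apply: complex_eq; rewrite ?ReM ?ImM /=.
  under eq_Rintegral do rewrite ReM.
  by rewrite RintegralB ?RintegralZl//; exact: integrableZlR.
under eq_Rintegral do rewrite ImM.
by rewrite RintegralD ?RintegralZl//; exact: integrableZlR.
Qed.

Lemma cintegrableN D f : measurable D -> cintegrable D f ->
  cintegrable D (fun x => - f x).
Proof.
by move=> mD /(cintegrableZ (-1) mD); under [X in cintegrable _ X]eq_fun do rewrite mulN1r.
Qed.

Lemma cintN D f : measurable D -> cintegrable D f ->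
  cint mu D (fun x => - f x) = - cint mu D f.
Proof.
by move=> mD fi; under [X in cint _ _ X]eq_fun do rewrite -mulN1r; rewrite cintZ// mulN1r.
Qed.

Lemma cintegrableB D f g : measurable D -> cintegrable D f -> cintegrable D g ->
  cintegrable D (fun x => f x - g x).
Proof. by move=> mD fi gi; apply: cintegrableD => //; exact: cintegrableN. Qed.

Lemma cintB D f g : measurable D -> cintegrable D f -> cintegrable D g ->
  cint mu D (fun x => f x - g x) = cint mu D f - cint mu D g.
Proof. by move=> mD fi gi; rewrite cintD ?cintN//; exact: cintegrableN. Qed.

Lemma eq_cint D f g : (forall x, D x -> f x = g x) -> cint mu D f = cint mu D g.
Proof.
move=> fg; rewrite /cint; congr (_ +i* _); apply: eq_Rintegral => x;
  by rewrite inE => /fg ->.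
Qed.

Lemma cint0 D : cint mu D (fun=> 0) = 0.
Proof.
by apply: complex_eq => /=; rewrite /Rintegral integral0.
Qed.

Lemma cintegrable0 D : cintegrable D (fun=> 0).
Proof. by split; exact: integrable0. Qed.

Lemma cintegrable_sum D (I : Type) (s : seq I) (F : I -> T -> C) :
  measurable D -> (forall i, cintegrable D (F i)) ->
  cintegrable D (fun x => \sum_(i <- s) F i x).
Proof.
move=> mD h; elim: s => [|i s IH].
  by under [X in cintegrable _ X]eq_fun do rewrite big_nil; exact: cintegrable0.
by under [X in cintegrable _ X]eq_fun do rewrite big_cons; exact: cintegrableD.
Qed.

Lemma cint_sum D (I : Type) (s : seq I) (F : I -> T -> C) :
  measurable D -> (forall i, cintegrable D (F i)) ->
  cint mu D (fun x => \sum_(i <- s) F i x) = \sum_(i <- s) cint mu D (F i).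
Proof.
move=> mD h; elim: s => [|i s IH].
  by rewrite big_nil; under [X in cint _ _ X]eq_fun do rewrite big_nil; exact: cint0.
rewrite big_cons -IH -cintD//; last exact: cintegrable_sum.
by apply: eq_cint => x _; rewrite big_cons.
Qed.

(** A unimodular factor rotates the integral onto the positive half-line; its modulus is then the
    integral of a real part, which the modulus of the integrand dominates. *)
Lemma cabs_cint_le D f : measurable D -> cintegrable D f ->
  cabs (cint mu D f) <= \int[mu]_(x in D) cabs (f x).
Proof.
move=> mD fint; set z := cint mu D f.
have [z0|z0] := eqVneq z 0.
  by rewrite z0 cabs0; apply: Rintegral_ge0 => x _; exact: cabs_ge0.
pose c : C := (cabs z)%:C / z.
have cz : c * z = (cabs z)%:C by rewrite /c divfK.
have c1 : cabs c = 1.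
  by rewrite /c cabsM cabsV cabs_real ger0_norm ?cabs_ge0// divff ?cabs_eq0.
have -> : cabs z = \int[mu]_(x in D) Re (c * f x).
  by have := congr1 (@Re R) cz; rewrite -cintZ//= => <-.
apply: le_Rintegral => //.
- by have [] := cintegrableZ c mD fint.
- exact: cintegrable_cabs.
- move=> x _; apply: le_trans (ler_norm _) _; apply: le_trans (ler_Re_cabs _) _.
  by rewrite cabsM c1 mul1r.
Qed.

Lemma cint_dct D (u : nat -> T -> C) f (g : T -> R) : measurable D ->
  (forall n, cmeasurable D (u n)) -> 
  {ae mu, forall x, D x -> ccvg \oo (fun n => u n x) (f x)} ->
  cmeasurable D f ->
  mu.-integrable D (EFin \o g) -> {ae mu, forall x n, D x -> cabs (u n x) <= g x} ->
  ccvg \oo (fun n => cint mu D (u n)) (cint mu D f).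
Proof.
move=> mD mu' uf mf ig ug.
have H (h : C -> R) : (forall n, measurable_fun D (fun x => h (u n x))) ->
    measurable_fun D (fun x => h (f x)) ->
    (forall z, `|h z| <= cabs z) ->
    (forall x, ccvg \oo (fun n => u n x) (f x) -> h (u n x) @[n --> \oo] --> h (f x)) ->
    (\int[mu]_(x in D) h (u n x)) @[n --> \oo] --> \int[mu]_(x in D) h (f x).
  move=> mh mhf hle hcv.
  have [||||ifh _ hc] := @dominated_convergence _ _ _ mu D mD
    (fun n x => (h (u n x))%:E) (fun x => (h (f x))%:E) (EFin \o g) _ _ _ ig _.
  - by move=> n; exact/measurable_EFinP.
  - exact/measurable_EFinP.
  - apply: filterS uf => x uf Dx; apply: cvg_EFin; first by near=> n.
    exact: hcv (uf Dx).
  - by apply: filterS ug => x ug n Dx; rewrite lee_fin (le_trans (hle _))// ug.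
  have fn := integrable_fin_num mD ifh.
  apply: fine_cvg; rewrite /Rintegral fineK//.
split.
  by apply: (H (@Re R)) => [n|||x []//]; [have [] := mu' n|have [] := mf|exact: ler_Re_cabs].
by apply: (H (@Im R)) => [n|||x []//]; [have [] := mu' n|have [] := mf|exact: ler_Im_cabs].
Unshelve. all: by end_near. Qed.

Lemma cint_mkcond D f : cint mu D f = cint mu setT (fun x => if x \in D then f x else 0).
Proof.
rewrite /cint; congr (_ +i* _); rewrite Rintegral_mkcond; apply: eq_Rintegral => x _;
  by rewrite /patch; case: ifP.
Qed.

Lemma ae_eq_cint D f g : measurable D -> cmeasurable D f -> cmeasurable D g ->
  {ae mu, forall x, D x -> f x = g x} -> cint mu D f = cint mu D g.
Proof.
move=> mD [fr fi] [gr gi] fg; rewrite /cint /Rintegral; congr (fine _ +i* fine _).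
  apply: ae_eq_integral => //; try exact/measurable_EFinP.
  by apply: filterS fg => x fg Dx; rewrite fg.
apply: ae_eq_integral => //; try exact/measurable_EFinP.
by apply: filterS fg => x fg Dx; rewrite fg.
Qed.

End ComplexIntegral.

Section FiniteComplexIntegral.
Context {R : realType} d {T : measurableType d} (P : probability T R).
Local Notation C := R[i].
Implicit Types (D : set T) (f g : T -> C).

Lemma cintegrable_bounded D f (K : R) : measurable D -> cmeasurable D f ->
  (forall x, D x -> cabs (f x) <= K) -> cintegrable P D f.
Proof.
move=> mD mf fK; apply: (cintegrable_le (g := cst K)) => //.
exact: finite_measure_integrable_cst.
Qed.

Lemma cabs_cint_bounded D f (K : R) : measurable D -> cmeasurable D f -> 0 <= K ->
  (forall x, D x -> cabs (f x) <= K) -> cabs (cint P D f) <= K.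
Proof.
move=> mD mf K0 fK; have fi := cintegrable_bounded mD mf fK.
apply: le_trans (cabs_cint_le mD fi) _.
apply: (@le_trans _ _ (\int[P]_(x in D) K)).
  apply: le_Rintegral => //; first exact: cintegrable_cabs.
  exact: finite_measure_integrable_cst.
rewrite Rintegral_cst// ler_piMr//.
rewrite -lee_fin fineK ?fin_num_measure//; exact: probability_le1.
Qed.

Lemma cint_cst (c : C) : cint P setT (fun=> c) = c.
Proof.
have h (k : R) : \int[P]_(_ in setT) k = k.
  rewrite Rintegral_cst// (_ : fine _ = 1) ?mulr1//.
  by rewrite [X in fine X](probability_setT P).
by case: c => x y; apply: complex_eq; rewrite /= h.
Qed.

Lemma cint_dct_bounded D (u : nat -> T -> C) f (K : R) : measurable D ->
  (forall n, cmeasurable D (u n)) ->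
  (forall x, D x -> ccvg \oo (fun n => u n x) (f x)) ->
  (forall n x, D x -> cabs (u n x) <= K) ->
  ccvg \oo (fun n => cint P D (u n)) (cint P D f).
Proof.
move=> mD mu uf uK; apply: (cint_dct (g := cst K)) => //.
- exact: aeW.
- exact: cmeasurable_cvg uf.
- exact: finite_measure_integrable_cst.
- by apply: aeW => x n; exact: uK.
Qed.

(** Dominated convergence for the partial sums, all bounded by K / (1 - q). *)
Lemma cint_has_csum D (u : nat -> T -> C) (f : T -> C) (K q : R) : measurable D ->
  (forall n, cmeasurable D (u n)) -> 0 <= q -> q < 1 -> 0 <= K ->
  (forall n x, D x -> cabs (u n x) <= K * q ^+ n) ->
  (forall x, D x -> has_csum (u ^~ x) (f x)) ->
  has_csum (fun n => cint P D (u n)) (cint P D f).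
Proof.
move=> mD mu q0 q1 K0 uK uf; apply/has_csumP.
have ui n : cintegrable P D (u n).
  by apply: cintegrable_bounded => // x Dx; exact: uK.
have -> : (fun n => \sum_(0 <= i < n) cint P D (u i)) =
          (fun n => cint P D (fun x => \sum_(0 <= i < n) u i x)).
  by apply/funext => n; rewrite cint_sum.
apply: (cint_dct_bounded (K := K / (1 - q))) => //.
- by move=> n; exact: cmeasurable_sum.
- by move=> x Dx; apply/has_csumP; exact: uf.
- move=> n x Dx; apply: le_trans (ler_cabs_sum _ _ _) _.
  apply: (@le_trans _ _ (\sum_(0 <= i < n) K * q ^+ i)).
    by apply: ler_sum => i _; exact: uK.
  rewrite -mulr_sumr ler_wpM2l// -[leRHS]mul1r ler_pdivlMr ?subr_gt0//.
  rewrite mulrC big_mkord -opprB mulNr -subrX1 opprB.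
  by rewrite gerBl exprn_ge0.
Qed.

End FiniteComplexIntegral.

Lemma integral_probability_cst (R : realType) d (T : measurableType d)
    (P : probability T R) (k : R) : (\int[P]_x k%:E = k%:E)%E.
Proof. by rewrite integral_cst// [X in (_ * X)%E](probability_setT P) mule1. Qed.

(** * Fubini for bounded functions on a product of probabilities *)

Section ComplexFubini.
Context {R : realType} d1 d2 {T1 : measurableType d1} {T2 : measurableType d2}.
Context (P1 : probability T1 R) (P2 : probability T2 R).
Local Notation C := R[i].
Variables (f : T1 * T2 -> C) (K : R).
Hypotheses (mf : cmeasurable setT f) (fK : forall z, cabs (f z) <= K).

Let fint : cintegrable (P1 \x P2)%E setT f.
Proof.
have h (g : T1 * T2 -> R) : measurable_fun setT g -> (forall z, `|g z| <= K) ->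
    (P1 \x P2)%E.-integrable setT (EFin \o g).
  move=> mg gK; apply/integrable12ltyP; first exact/measurable_EFinP.
  apply: (@le_lt_trans _ _ (\int[P1]_x \int[P2]_y (K%:E))%E).
    apply: ge0_le_integral => //.
    - by move=> x _; apply: integral_ge0.
    - apply: (@measurable_fun_fubini_tonelli_F _ _ _ _ _ P2 (abse \o (EFin \o g))).
        by apply: measurableT_comp => //; exact/measurable_EFinP.
      by move=> z; exact: abse_ge0.
    - move=> x _; apply: ge0_le_integral => //.
      + apply: measurableT_comp => //; apply/measurable_EFinP.
        exact: measurableT_comp.
      + by move=> y _; rewrite lee_fin; exact: gK.
  under eq_integral do rewrite integral_probability_cst.
  by rewrite integral_probability_cst ltry.
by split; apply: h => [|z]; [case: mf|apply: le_trans (fK z); exact: ler_Re_cabs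
  |case: mf|apply: le_trans (fK z); exact: ler_Im_cabs].
Qed.

Let sec1 x : cintegrable P2 setT (fun y => f (x, y)).
Proof.
apply: (@cintegrable_bounded _ _ _ _ _ _ K) => //.
exact: (cmeasurable_comp mf (pair1_measurable x)).
Qed.

Let sec2 y : cintegrable P1 setT (fun x => f (x, y)).
Proof.
apply: (@cintegrable_bounded _ _ _ _ _ _ K) => //.
exact: (cmeasurable_comp mf (pair2_measurable y)).
Qed.

Lemma cmeasurable_fubini : cmeasurable setT (fun x => cint P2 setT (fun y => f (x, y))).
Proof.
have [fr fi] := fint; split; apply/measurable_EFinP.
  have := measurable_fubini_F fr; congr measurable_fun; apply/funext => x /=.
  by rewrite /fubini_F /Rintegral fineK//; apply: integrable_fin_num => //; case: (sec1 x).
have := measurable_fubini_F fi; congr measurable_fun; apply/funext => x /=.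
by rewrite /fubini_F /Rintegral fineK//; apply: integrable_fin_num => //; case: (sec1 x).
Qed.

Lemma cint_prod : cint P1 setT (fun x => cint P2 setT (fun y => f (x, y))) =
  cint (P1 \x P2)%E setT f.
Proof.
have [fr fi] := fint; rewrite /cint; congr (_ +i* _) => /=.
  rewrite [RHS]/Rintegral -(integral12_prod_meas1 fr); congr fine.
  apply: eq_integral => x _.
  by rewrite /fubini_F /Rintegral fineK//; apply: integrable_fin_num => //; case: (sec1 x).
rewrite [RHS]/Rintegral -(integral12_prod_meas1 fi); congr fine.
apply: eq_integral => x _.
by rewrite /fubini_F /Rintegral fineK//; apply: integrable_fin_num => //; case: (sec1 x).
Qed.

Lemma cint_fubini : cint P1 setT (fun x => cint P2 setT (fun y => f (x, y))) =
  cint P2 setT (fun y => cint P1 setT (fun x => f (x, y))).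
Proof.
have [fr fi] := fint; rewrite cint_prod /cint; congr (_ +i* _) => /=.
  rewrite [LHS]/Rintegral -(integral21_prod_meas1 fr); congr fine.
  apply: eq_integral => x _.
  by rewrite /fubini_G /Rintegral fineK//; apply: integrable_fin_num => //; case: (sec2 x).
rewrite [LHS]/Rintegral -(integral21_prod_meas1 fi); congr fine.
apply: eq_integral => x _.
by rewrite /fubini_G /Rintegral fineK//; apply: integrable_fin_num => //; case: (sec2 x).
Qed.

End ComplexFubini.

(** * Independence and integration of functions of independent variables *)

Lemma measurable_preimage_fun d (T : measurableType d) d' (T' : measurableType d')
    (Y : T -> T') (E : set T') :
  measurable_fun setT Y -> measurable E -> measurable (Y @^-1` E).
Proof. by move=> mY mE; rewrite -[_ @^-1` _]setTI; exact: mY. Qed.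

Section Independence.
Context {R : realType} d {T : measurableType d} (P : probability T R).
Local Notation C := R[i].

(** Dynkin's argument extends the identity from rectangles to the sigma-algebra they generate. In
    the application [G] is a cylinder and [c] its probability. *)
Lemma pushforward_rectangles (Y Z : T -> R) (G : set T) (c : R) :
  measurable_fun setT Y -> measurable_fun setT Z -> measurable G -> 0 <= c ->
  (forall E F, measurable E -> measurable F ->
    P (Y @^-1` E `&` Z @^-1` F `&` G) = (c%:E * P (Y @^-1` E `&` Z @^-1` F))%E) ->
  forall X : set (R * R), measurable X ->
    P ((fun t => (Y t, Z t)) @^-1` X `&` G) =
      (c%:E * P ((fun t => (Y t, Z t)) @^-1` X))%E.
Proof.
move=> mY mZ mG c0 hEF.
pose phi t := (Y t, Z t).
have mphi : measurable_fun setT phi by exact/measurable_fun_pair.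
have mpre (X : set (R * R)) : measurable X -> measurable (phi @^-1` X).
  by move=> mX; rewrite -[_ @^-1` _]setTI; exact: mphi.
rewrite measurable_prod_measurableType.
have hT : P (phi @^-1` setT `&` G) = (c%:E * P (phi @^-1` setT))%E.
  have := hEF _ _ (@measurableT _ R) (@measurableT _ R).
  by rewrite !preimage_setT setTI.
apply: dynkin_induction => /=.
- by rewrite measurable_prod_measurableType.
- move=> _ _ [A1 mA1 [A2 mA2 <-]] [B1 mB1 [B2 mB2 <-]].
  exists (A1 `&` B1); first exact: measurableI.
  exists (A2 `&` B2); first exact: measurableI.
  by rewrite setXI.
- exact: hT.
- by move=> _ [A mA [B mB <-]]; exact: (hEF A B).
- move=> S mS HS; rewrite preimage_setC.
  have -> : ~` (phi @^-1` S) `&` G = (phi @^-1` setT `&` G) `\` (phi @^-1` S `&` G).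
    rewrite preimage_setT setTI setDE setCI setIUr setIC.
    by rewrite [X in _ `|` X](_ : _ = set0) ?setU0// setICr.
  have mSG : measurable (phi @^-1` S `&` G) by apply: measurableI => //; exact: mpre.
  have mTG : measurable (phi @^-1` setT `&` G) by apply: measurableI => //; exact: mpre.
  rewrite measureD//; last first.
    by rewrite ltey_eq fin_num_measure//; exact: mTG.
  rewrite (setIidr (A := _ `&` _)); last by move=> t [? ?]; split.
  have eT : P (phi @^-1` setT) = 1%E by rewrite preimage_setT probability_setT.
  rewrite [X in (X - _)%E]hT [X in (_ - X)%E]HS eT probability_setC; last exact: mpre.
  by rewrite muleBr// fin_num_adde_defr.
- move=> F mF tF HF; rewrite preimage_bigcup setI_bigcupl.
  have tF' : trivIset setT (fun i => phi @^-1` F i).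
    by move=> i j _ _ [t [Fi Fj]]; apply: tF => //; exists (phi t).
  rewrite measure_bigcup//=; last 2 first.
  - by move=> i _; apply: measurableI => //; exact: mpre.
  - by move=> i j _ _ [t [[Fi _] [Fj _]]]; apply: tF => //; exists (phi t).
  rewrite measure_bigcup//=; last by move=> i _; exact: mpre.
  rewrite -nneseriesZl//=.
  by apply: eq_eseriesr => i _; exact: HF.
Qed.

Lemma cint_comp_eq_law (Y Z : T -> R) (f : R -> C) (K : R) :
  measurable_fun setT Y -> measurable_fun setT Z ->
  (forall E, measurable E -> P (Y @^-1` E) = P (Z @^-1` E)) ->
  cmeasurable setT f -> (forall x, cabs (f x) <= K) ->
  cint P setT (f \o Y) = cint P setT (f \o Z).
Proof.
move=> mY mZ YZ mf fK.
pose Y' : {mfun T >-> R} := MeasurableFun.Pack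
  (MeasurableFun.Class (isMeasurableFun.Build _ _ _ _ _ mY)).
pose Z' : {mfun T >-> R} := MeasurableFun.Pack
  (MeasurableFun.Class (isMeasurableFun.Build _ _ _ _ _ mZ)).
have H (h : R -> R) : measurable_fun setT h -> (forall x, `|h x| <= K) ->
    (\int[P]_x (h (Y x))%:E = \int[P]_x (h (Z x))%:E)%E.
  move=> mh hK.
  have ih (X : {mfun T >-> R}) : P.-integrable (X @^-1` setT) ((EFin \o h) \o X).
    rewrite preimage_setT; apply: (le_integrable (g := cst K%:E) measurableT) => //.
    - by apply/measurable_EFinP; exact: measurableT_comp.
    - by move=> x _; rewrite /= lee_fin (le_trans (hK _))// ler_norm.
    - exact: finite_measure_integrable_cst.
  have hm : measurable_fun setT (EFin \o h) by exact/measurable_EFinP.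
  have e1 := integral_pushforward mY hm (ih Y') measurableT.
  have e2 := integral_pushforward mZ hm (ih Z') measurableT.
  rewrite !preimage_setT in e1 e2.
  rewrite -[LHS]e1 -[RHS]e2.
  by apply: eq_measure_integral => A mA _; exact: YZ.
have [fr fi] := mf.
rewrite /cint /Rintegral; congr (fine _ +i* fine _).
  by apply: (H (fun x => Re (f x))) => // x; apply: le_trans (fK x); exact: ler_Re_cabs.
by apply: (H (fun x => Im (f x))) => // x; apply: le_trans (fK x); exact: ler_Im_cabs.
Qed.

(** The joint law agrees with the product of the marginal laws on rectangles, hence everywhere; the
    rest is Fubini. *)
Lemma cint_indep (Y Z : T -> R) (f : R * R -> C) (K : R) :
  measurable_fun setT Y -> measurable_fun setT Z ->
  (forall E F, measurable E -> measurable F ->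
    P (Y @^-1` E `&` Z @^-1` F) = (P (Y @^-1` E) * P (Z @^-1` F))%E) ->
  cmeasurable setT f -> (forall z, cabs (f z) <= K) ->
  cint P setT (fun t => f (Y t, Z t)) =
  cint P setT (fun t => cint P setT (fun t' => f (Y t, Z t'))).
Proof.
move=> mY mZ YZ mf fK.
pose Y' : {mfun T >-> R} := MeasurableFun.Pack
  (MeasurableFun.Class (isMeasurableFun.Build _ _ _ _ _ mY)).
pose Z' : {mfun T >-> R} := MeasurableFun.Pack
  (MeasurableFun.Class (isMeasurableFun.Build _ _ _ _ _ mZ)).
have mphi : measurable_fun setT (fun t => (Y t, Z t)) by exact/measurable_fun_pair.
pose W : {mfun T >-> (R * R)%type} := MeasurableFun.Pack
  (MeasurableFun.Class (isMeasurableFun.Build _ _ _ _ _ mphi)).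
have tr d' (T' : measurableType d') (X : {mfun T >-> T'}) (g : T' -> C) (L : R) :
    cmeasurable setT g -> (forall x, cabs (g x) <= L) ->
    cint (distribution P X) setT g = cint P setT (g \o X).
  move=> [gr gi] gL.
  have H (h : T' -> R) : measurable_fun setT h -> (forall x, `|h x| <= L) ->
    (\int[distribution P X]_x (h x)%:E = \int[P]_x (h (X x))%:E)%E.
    move=> mh hL.
    have ih : P.-integrable (X @^-1` setT) ((EFin \o h) \o X).
      rewrite preimage_setT; apply: (le_integrable (g := cst L%:E) measurableT) => //.
      - by apply/measurable_EFinP; exact: measurableT_comp.
      - by move=> x _; rewrite /= lee_fin (le_trans (hL _))// ler_norm.
      - exact: finite_measure_integrable_cst.
    have hm : measurable_fun setT (EFin \o h) by exact/measurable_EFinP.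
    have e1 := integral_pushforward (measurable_funPT X) hm ih measurableT.
    by rewrite preimage_setT in e1.
  rewrite /cint /Rintegral; congr (fine _ +i* fine _).
    by apply: (H (fun x => Re (g x))) => // x; apply: le_trans (gL x); exact: ler_Re_cabs.
  by apply: (H (fun x => Im (g x))) => // x; apply: le_trans (gL x); exact: ler_Im_cabs.
have sec y : cmeasurable setT (fun z => f (y, z)).
  exact: (cmeasurable_comp mf (pair1_measurable y)).
have -> : cint P setT (fun t => cint P setT (fun t' => f (Y t, Z t'))) =
    cint (distribution P Y') setT (fun y => cint (distribution P Z') setT (fun z => f (y, z))).
  rewrite (tr _ _ Y' _ K).
  - by apply: eq_cint => t _ /=; rewrite (tr _ _ Z' _ K).
  - exact: (cmeasurable_fubini (distribution P Y') (distribution P Z') mf fK).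
  - move=> y; apply: cabs_cint_bounded => //.
    by apply: le_trans (fK (0, 0)); exact: cabs_ge0.
rewrite (cint_prod _ _ mf fK) -[LHS](tr _ _ W f K)//.
rewrite /cint /Rintegral; congr (fine _ +i* fine _);
  apply: eq_measure_integral => A mA _; apply/esym;
  apply: product_measure_unique => // E F mE mF; exact: YZ.
Qed.

Section Family.
Context {I : eqType} (X : I -> {RV P >-> R}) (indep : mutually_independent X).

Lemma probability_fineK (A : set T) : measurable A -> (fine (P A))%:E = P A.
Proof. by move=> mA; rewrite fineK// fin_num_measure. Qed.

Lemma measurable_cylinder (J : seq I) (E : I -> set R) :
  (forall i, measurable (E i)) -> measurable (\big[setI/setT]_(i <- J) (X i @^-1` E i)).
Proof.
by move=> mE; apply: bigsetI_measurable => i _; apply: measurable_preimage_fun.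
Qed.

(** Independence of [Y] from the subfamily indexed by [S], tested on finite cylinders. The product
    on the right is the probability of the cylinder, by [indep_from_cylinder]. *)
Definition indep_from (Y : T -> R) (S : pred I) : Prop :=
  measurable_fun setT Y /\
  forall (F : set R) (J : seq I) (E : I -> set R), measurable F -> uniq J ->
    all S J -> (forall i, measurable (E i)) ->
    P (Y @^-1` F `&` \big[setI/setT]_(i <- J) (X i @^-1` E i)) =
      (P (Y @^-1` F) * (\prod_(i <- J) fine (P (X i @^-1` E i)))%:E)%E.

Lemma indep_from_cylinder (J : seq I) (E : I -> set R) : uniq J ->
  (forall i, measurable (E i)) ->
  P (\big[setI/setT]_(i <- J) (X i @^-1` E i)) =
      (\prod_(i <- J) fine (P (X i @^-1` E i)))%:E.
Proof.
by move=> uJ mE; rewrite -indep// probability_fineK//; exact: measurable_cylinder.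
Qed.

Lemma indep_from_cst (w : R) (S : pred I) : indep_from (fun=> w) S.
Proof.
split=> // F J E mF uJ _ mE; rewrite -indep_from_cylinder//.
have [Fw|Fw] := pselect (F w).
  rewrite [_ @^-1` _](_ : _ = setT); last by apply/seteqP; split.
  by rewrite setTI probability_setT mul1e.
rewrite [_ @^-1` _](_ : _ = set0); last by apply/seteqP; split.
by rewrite set0I !measure0 mul0e.
Qed.

Lemma indep_from_comp1 (psi : R -> R) (i : I) : measurable_fun setT psi ->
  indep_from (psi \o X i) (predC1 i).
Proof.
move=> mpsi; split; first exact: measurableT_comp.
move=> F J E mF uJ SJ mE.
have iJ : i \notin J by apply/negP => /(allP SJ); rewrite /= eqxx.
have mpF : measurable (psi @^-1` F) by exact: measurable_preimage_fun.
(* As [i] is not in [J], the event on [X i] and the cylinder over [J] form one cylinder over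
   [i :: J]. *)
pose E' j := if j == i then psi @^-1` F else E j.
have mE' j : measurable (E' j) by rewrite /E'; case: ifP.
have := @indep_from_cylinder (i :: J) E' _ mE'; rewrite /= iJ uJ => /(_ isT).
rewrite !big_cons /E' eqxx EFinM probability_fineK; last exact: measurable_preimage_fun.
move=> h.
have eqJ : \big[setI/setT]_(j <- J) (X j @^-1` (if j == i then psi @^-1` F else E j))
    = \big[setI/setT]_(j <- J) (X j @^-1` E j).
  by apply: eq_big_seq => j jJ; case: eqP => // ji; rewrite -ji jJ in iJ.
rewrite -eqJ; apply: (etrans h); congr (_ * _%:E)%E.
by apply: eq_big_seq => j jJ; case: eqP => // ji; rewrite -ji jJ in iJ.
Qed.

Lemma indep_from_pair (Y : T -> R) (S : pred I) (i : I) : indep_from Y S -> S i ->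
  forall E F, measurable E -> measurable F ->
    P (Y @^-1` E `&` X i @^-1` F) = (P (Y @^-1` E) * P (X i @^-1` F))%E.
Proof.
move=> [mY hY] Si E F mE mF.
have := hY E [:: i] (fun=> F) mE isT; rewrite /= Si => /(_ isT (fun=> mF)).
rewrite !big_cons !big_nil setIT mulr1 probability_fineK//.
exact: measurable_preimage_fun.
Qed.

(** Absorbing [X i] into [Y] costs only the index [i]: a cylinder over other indices factors out on
    rectangles of ([Y], [X i]), hence on the preimages under [psi] by [pushforward_rectangles]. *)
Lemma indep_from_step (Y : T -> R) (S : pred I) (i : I) (psi : R * R -> R) :
  measurable_fun setT psi -> indep_from Y S -> S i ->
  indep_from (fun t => psi (Y t, X i t)) (predI S (predC1 i)).
Proof.
move=> mpsi YS Si; have [mY hY] := YS.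
have mphi : measurable_fun setT (fun t => (Y t, X i t)).
  by apply/measurable_fun_pair => //; exact: measurable_funPT.
split; first exact: measurableT_comp.
move=> F J E mF uJ SJ mE.
set G := \big[setI/setT]_(j <- J) _; set c := \prod_(j <- J) _.
have c0 : 0 <= c by apply: prodr_ge0 => j _; rewrite fine_ge0.
rewrite muleC.
have mG : measurable G by exact: measurable_cylinder.
have mpF : measurable (psi @^-1` F) by exact: measurable_preimage_fun.
apply: (pushforward_rectangles mY (measurable_funPT (X i)) mG c0 _ mpF).
move=> E1 F1 mE1 mF1.
have iJ : i \notin J by apply/negP => /(allP SJ) /=; rewrite eqxx andbF.
have SJ' : all S J by apply: sub_all SJ => j /= /andP[].
pose E' j := if j == i then F1 else E j.
have mE' j : measurable (E' j) by rewrite /E'; case: ifP.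
have := hY E1 (i :: J) E' mE1; rewrite /= iJ uJ Si SJ' => /(_ isT isT mE').
rewrite !big_cons /E' eqxx EFinM probability_fineK; last exact: measurable_preimage_fun.
have -> : \big[setI/setT]_(j <- J) (X j @^-1` (if j == i then F1 else E j)) = G.
  by apply: eq_big_seq => j jJ; case: eqP => // ji; rewrite -ji jJ in iJ.
have -> : \prod_(j <- J) fine (P (X j @^-1` (if j == i then F1 else E j))) = c.
  by apply: eq_big_seq => j jJ; case: eqP => // ji; rewrite -ji jJ in iJ.
rewrite setIA => ->.
by rewrite muleA -(indep_from_pair YS Si)// muleC.
Qed.

Lemma cint_indep_from (Y : T -> R) (S : pred I) (i : I) (f : R * R -> C) (K : R) :
  indep_from Y S -> S i -> cmeasurable setT f -> (forall z, cabs (f z) <= K) ->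
  cint P setT (fun t => f (Y t, X i t)) =
  cint P setT (fun t => cint P setT (fun t' => f (Y t, X i t'))).
Proof.
move=> YS Si mf fK; apply: cint_indep mf fK => //.
- by case: YS.
- exact: indep_from_pair Si.
Qed.

End Family.
End Independence.

(** * Integrals of monomials times exponentials over a segment *)

Section ExponentialIntegrals.
Context {R : realType}.
Local Notation C := R[i].
Local Notation leb := (@lebesgue_measure R).

Definition cder (F f : R -> C) : Prop := forall y : R,
  is_derive y 1 (fun x => Re (F x)) (Re (f y)) /\
  is_derive y 1 (fun x => Im (F x)) (Im (f y)).

Lemma is_derive_continuous (F : R -> R) (f : R -> R) :
  (forall y : R, is_derive y 1 F (f y)) -> continuous F.
Proof. by move=> h y; apply: differentiable_continuous; apply/derivable1_diffP. Qed.

Lemma FTC_is_derive (F f : R -> R) (u : R) : 0 < u -> continuous f ->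
  (forall y : R, is_derive y 1 F (f y)) ->
  \int[leb]_(y in `[0, u]) f y = F u - F 0.
Proof.
move=> u0 cf dF; rewrite /Rintegral (continuous_FTC2 (F := F))//.
- exact: continuous_subspaceT.
- have cF := is_derive_continuous dF.
  split; first by move=> x _.
  + by apply: cvg_at_right_filter; exact: cF.
  + by apply: cvg_at_left_filter; exact: cF.
- by move=> x _; rewrite derive1E derive_val.
Qed.

Lemma cint_FTC (F f : R -> C) (u : R) : 0 <= u ->
  continuous (fun x => Re (f x)) -> continuous (fun x => Im (f x)) -> cder F f ->
  cint leb `[0, u] f = F u - F 0.
Proof.
rewrite le_eqVlt => /predU1P[<-|u0] cr ci dF.
  rewrite subrr; apply: complex_eq => /=; rewrite set_itv1 Rintegral_set1//.
apply: complex_eq; rewrite ?ReD ?ImD ?ReN ?ImN /=.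
  apply: (@FTC_is_derive (fun x => Re (F x)) (fun x => Re (f x))) => // y.
  by have [] := dF y.
apply: (@FTC_is_derive (fun x => Im (F x)) (fun x => Im (f x))) => // y.
by have [] := dF y.
Qed.

(** An unnormalised Gamma density with complex rate [z]: its Laplace transform at s is (s + z)^-(j +
    1), the building block of partial fractions. *)
Definition expmonom (j : nat) (z : C) (y : R) : C :=
  (y ^+ j / j`!%:R)%:C * cexp (- (z * y%:C)).

Lemma is_derive_monom (j : nat) (y : R) :
  is_derive y 1 (fun x : R => x ^+ j.+1 / j.+1`!%:R) (y ^+ j / j`!%:R).
Proof.
pose p : {poly R} := (j.+1`!%:R)^-1 *: 'X^(j.+1).
have -> : (fun x : R => x ^+ j.+1 / j.+1`!%:R) = horner p.
  by apply/funext => x; rewrite /p hornerZ hornerXn mulrC.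
apply: is_derive_eq; rewrite /p derivZ derivXn hornerZ hornerMn hornerXn /=.
rewrite factS natrM -mulr_natr.
have j0 : (j`!%:R : R) != 0 by rewrite pnatr_eq0 -lt0n fact_gt0.
have j1 : (j.+1%:R : R) != 0 by rewrite pnatr_eq0.
by field; rewrite j0 addrC natr1 j1.
Qed.

Lemma cder_cexp (z : C) :
  cder (fun y => cexp (- (z * y%:C))) (fun y => - z * cexp (- (z * y%:C))).
Proof.
have fE (a b : R) : (fun x : R => a * x + b * x) = fun x => (a + b) * x.
  by apply/funext => x; rewrite mulrDl.
have dl (k y : R) : is_derive y 1 (fun x => k * x) k.
  have -> : (fun x : R => k * x) = k \*: id by [].
  by apply: is_derive_eq; rewrite /GRing.scale/= mulr1.
move=> y; split.
  have -> : (fun x : R => Re (cexp (- (z * x%:C)))) =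
      (expR \o (fun x => - Re z * x)) * (cos \o (fun x => - Im z * x)).
    by apply/funext => x; rewrite Re_cexp ReN ImN ReMr ImMr -!mulNr.
  have d1 := is_derive1_comp (is_derive_expR (- Re z * y)) (dl (- Re z) y).
  have d2 := is_derive1_comp (is_derive_cos (- Im z * y)) (dl (- Im z) y).
  apply: is_derive_eq.
  rewrite ReM ReN ImN Re_cexp Im_cexp ReN ImN ReMr ImMr /= !mulNr /GRing.scale /=.
  by rewrite cosN sinN; ring.
have -> : (fun x : R => Im (cexp (- (z * x%:C)))) =
    (expR \o (fun x => - Re z * x)) * (sin \o (fun x => - Im z * x)).
  by apply/funext => x; rewrite Im_cexp ReN ImN ReMr ImMr -!mulNr.
have d1 := is_derive1_comp (is_derive_expR (- Re z * y)) (dl (- Re z) y).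
have d2 := is_derive1_comp (is_derive_sin (- Im z * y)) (dl (- Im z) y).
apply: is_derive_eq.
rewrite ImM ReN ImN Re_cexp Im_cexp ReN ImN ReMr ImMr /= !mulNr /GRing.scale /=.
by rewrite cosN sinN; ring.
Qed.

Lemma cderMl (p q : R -> R) (F f : R -> C) :
  (forall y : R, is_derive y 1 p (q y)) -> cder F f ->
  cder (fun y => (p y)%:C * F y) (fun y => (q y)%:C * F y + (p y)%:C * f y).
Proof.
move=> dp dF y; have [dr di] := dF y; have dpy := dp y; split.
  have -> : (fun x => Re ((p x)%:C * F x)) = p * (fun x => Re (F x)).
    by apply/funext => x; rewrite ReMl.
  by apply: is_derive_eq; rewrite ReD !ReMl /GRing.scale /=; ring.
have -> : (fun x => Im ((p x)%:C * F x)) = p * (fun x => Im (F x)).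
  by apply/funext => x; rewrite ImMl.
by apply: is_derive_eq; rewrite ImD !ImMl /GRing.scale /=; ring.
Qed.

Lemma cder_expmonomS j z :
  cder (expmonom j.+1 z) (fun y => expmonom j z y - z * expmonom j.+1 z y).
Proof.
have := cderMl (is_derive_monom j) (cder_cexp z); congr cder.
by apply/funext => y; rewrite /expmonom; ring.
Qed.

Lemma cder_expmonom0 z : cder (expmonom 0 z) (fun y => - (z * expmonom 0 z y)).
Proof.
have E : expmonom 0 z = fun y => cexp (- (z * y%:C)).
  by apply/funext => y; rewrite /expmonom expr0 fact0 divr1 mul1r.
by rewrite E; have := cder_cexp z; congr cder; apply/funext => y; rewrite mulNr.
Qed.

Lemma continuous_expmonom j z :
  continuous (fun y => Re (expmonom j z y)) /\ continuous (fun y => Im (expmonom j z y)).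
Proof.
have h : exists f, cder (expmonom j z) f.
  by case: j => [|j]; eexists; [exact: cder_expmonom0|exact: cder_expmonomS].
by case: h => f hf; split; apply: is_derive_continuous => y; have [] := hf y.
Qed.

Lemma cmeasurable_expmonom D j z : cmeasurable D (expmonom j z).
Proof.
have [cr ci] := continuous_expmonom j z.
by apply: cmeasurableS; split; exact: continuous_measurable_fun.
Qed.

Lemma cintegrable_continuous_seg (f : R -> C) (u : R) :
  continuous (fun y => Re (f y)) -> continuous (fun y => Im (f y)) ->
  cintegrable leb `[0, u] f.
Proof.
move=> cr ci; split; apply: continuous_compact_integrable;
  try exact: segment_compact; exact: continuous_subspaceT.
Qed.

(** Induction by integration by parts: the derivative of [expmonom j.+1 z] is
    [expmonom j z - z * expmonom j.+1 z]. The power of [z] stays on the left, so that z = 0 is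
    allowed. *)
Lemma cint_expmonom_seg j z (u : R) : 0 <= u ->
  z ^+ j.+1 * cint leb `[0, u] (expmonom j z) =
  1 - cexp (- (z * u%:C)) * \sum_(q < j.+1) (z * u%:C) ^+ q / q`!%:R.
Proof.
move=> u0.
have ii k : cintegrable leb `[0, u] (expmonom k z).
  by have [cr ci] := continuous_expmonom k z; exact: cintegrable_continuous_seg.
elim: j => [|j IH].
  have [cr ci] := continuous_expmonom 0 z.
  have := @cint_FTC (expmonom 0 z) (fun y => - (z * expmonom 0 z y)) u u0 _ _
    (cder_expmonom0 z).
  rewrite cintN//; last exact: cintegrableZ.
  rewrite cintZ// expr1 big_ord1 expr0 fact0 divr1 mulr1 => h.
  have -> : z * cint leb `[0, u] (expmonom 0 z) = - (expmonom 0 z u - expmonom 0 z 0).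
    rewrite -h ?opprK//.
      have -> : (fun x => Re (- (z * expmonom 0 z x))) =
         fun x => - (Re z * Re (expmonom 0 z x) - Im z * Im (expmonom 0 z x)).
        by apply/funext => x; rewrite ReN ReM.
      move=> x; apply: cvgN; apply: cvgB; apply: cvgM; (exact: cvg_cst || exact: cr || exact: ci).
    have -> : (fun x => Im (- (z * expmonom 0 z x))) =
       fun x => - (Re z * Im (expmonom 0 z x) + Im z * Re (expmonom 0 z x)).
      by apply/funext => x; rewrite ImN ImM.
    move=> x; apply: cvgN; apply: cvgD; apply: cvgM; (exact: cvg_cst || exact: cr || exact: ci).
  by rewrite /expmonom !expr0 fact0 divr1 !mul1r mulr0 oppr0 cexp0 opprB.
have [cr ci] := continuous_expmonom j z.
have [cr1 ci1] := continuous_expmonom j.+1 z.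
have := @cint_FTC (expmonom j.+1 z) (fun y => expmonom j z y - z * expmonom j.+1 z y)
  u u0 _ _ (cder_expmonomS j z).
rewrite cintB//; last exact: cintegrableZ.
rewrite cintZ// => h.
have {}h : cint leb `[0, u] (expmonom j z) - z * cint leb `[0, u] (expmonom j.+1 z)
   = expmonom j.+1 z u - expmonom j.+1 z 0.
  apply: h.
    have -> : (fun x => Re (expmonom j z x - z * expmonom j.+1 z x)) =
       fun x => Re (expmonom j z x) - (Re z * Re (expmonom j.+1 z x) - Im z * Im (expmonom j.+1 z x)).
      by apply/funext => x; rewrite ReD ReN (ReM z).
    move=> x; apply: cvgB; first exact: cr.
    apply: cvgB; apply: cvgM; (exact: cvg_cst || exact: cr1 || exact: ci1).
  have -> : (fun x => Im (expmonom j z x - z * expmonom j.+1 z x)) =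
     fun x => Im (expmonom j z x) - (Re z * Im (expmonom j.+1 z x) + Im z * Re (expmonom j.+1 z x)).
    by apply/funext => x; rewrite ImD ImN (ImM z).
  move=> x; apply: cvgB; first exact: ci.
  apply: cvgD; apply: cvgM; (exact: cvg_cst || exact: cr1 || exact: ci1).
have {}h : z * cint leb `[0, u] (expmonom j.+1 z) =
    cint leb `[0, u] (expmonom j z) - expmonom j.+1 z u.
  rewrite [expmonom j.+1 z 0](_ : _ = 0) ?subr0 in h; last first.
    by rewrite /expmonom expr0n/= mul0r mul0r.
  by rewrite -h opprB addrC subrK.
rewrite exprSr -mulrA h mulrBr IH [in RHS]big_ord_recr /= mulrDr opprD addrA; congr (_ - _).
rewrite /expmonom exprMn rmorphM rmorphXn fmorphV rmorph_nat.
by move: (cexp _) => e; rewrite -!mulrA [RHS]mulrC -!mulrA.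
Qed.

Lemma cabs_expmonom j z (y : R) : 0 <= y ->
  cabs (expmonom j z y) = y ^+ j / j`!%:R * expR (- (Re z * y)).
Proof.
move=> y0; rewrite /expmonom cabsM cabs_real cabs_cexp ReN ReMr ger0_norm//.
by rewrite divr_ge0 ?exprn_ge0.
Qed.

Lemma monom_le_expR (k : R) j (y : R) : 0 < k -> 0 <= y ->
  y ^+ j / j`!%:R <= k ^- j * expR (k * y).
Proof.
move=> k0 y0; rewrite ler_pdivlMl ?exprn_gt0// mulrA -exprMn.
have ky : 0 <= k * y by rewrite mulr_ge0// ltW.
case: j => [|j]; first by rewrite expr0 divr1 (le_trans _ (expR_ge1Dx _))// lerDl.
by rewrite (le_trans _ (expR_ge1Dxn j ky))// lerDr.
Qed.
End ExponentialIntegrals.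
Lemma cmeasurable_if (R : realType) d (T : measurableType d) (D : set T)
    (b : T -> bool) (f g : T -> R[i]) : measurable D -> measurable_fun D b ->
  cmeasurable D f -> cmeasurable D g -> cmeasurable D (fun x => if b x then f x else g x).
Proof.
move=> mD mb [fr fi] [gr gi]; split.
  rewrite (_ : (fun x => _) = fun x => if b x then Re (f x) else Re (g x)).
    by apply: measurable_fun_if => //;
      [apply: measurable_funS fr|apply: measurable_funS gr] => //; exact: subIsetl.
  by apply/funext => x; case: ifP.
rewrite (_ : (fun x => _) = fun x => if b x then Im (f x) else Im (g x)).
  by apply: measurable_fun_if => //;
    [apply: measurable_funS fi|apply: measurable_funS gi] => //; exact: subIsetl.
by apply/funext => x; case: ifP.
Qed.

(** * Monomials times exponentials on the half-line *)

Section ExponentialTail.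
Context {R : realType}.
Local Notation C := R[i].
Local Notation leb := (@lebesgue_measure R).

Lemma mem_set_seg (u y : R) : (y \in (`[0, u]%classic : set R)) = (0 <= y <= u).
Proof. by rewrite mem_setE in_itv. Qed.

Lemma mem_set_ray (y : R) : (y \in (`[0, +oo[%classic : set R)) = (0 <= y).
Proof. by rewrite mem_setE in_itv andbT. Qed.

(** Half of the decay rate is spent on absorbing the monomial. *)
Lemma cabs_expmonom_le j (z : C) (y : R) : 0 < Re z -> 0 <= y ->
  cabs (expmonom j z y) <= (Re z / 2) ^- j * expR (- (Re z / 2 * y)).
Proof.
move=> z0 y0; rewrite cabs_expmonom//.
have k0 : 0 < Re z / 2 by rewrite divr_gt0.
apply: (@le_trans _ _ ((Re z / 2) ^- j * expR (Re z / 2 * y) * expR (- (Re z * y)))).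
  by rewrite ler_wpM2r ?expR_ge0// monom_le_expR.
rewrite -mulrA -expRD (_ : _ + _ = - (Re z / 2 * y))//; lra.
Qed.

Lemma cintegrable_expmonom j (z : C) : 0 < Re z ->
  cintegrable leb `[0, +oo[ (expmonom j z).
Proof.
move=> z0; have k0 : 0 < Re z / 2 by rewrite divr_gt0.
pose g y := (Re z / 2) ^- j / (Re z / 2) * exponential_pdf (Re z / 2) y.
apply: (@cintegrable_le _ _ _ leb _ _ g) => //.
- exact: cmeasurable_expmonom.
- apply: integrableZlR => //; apply: integrableS (integrable_exponential_pdf _) => //.
- move=> y; rewrite /= in_itv/= andbT => y0.
  apply: le_trans (cabs_expmonom_le _ z0 y0) _.
  by rewrite /g exponential_pdfE// mulrA divfK ?gt_eqF// mulNr.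
Qed.

Lemma cint_seg_cvg (g : R -> C) : cintegrable leb `[0, +oo[ g ->
  ccvg \oo (fun n => cint leb `[0, n%:R] g) (cint leb `[0, +oo[ g).
Proof.
move=> ig.
have mseg n : measurable (`[0, n%:R]%classic : set R) by [].
have e n : cint leb `[0, n%:R] g =
    cint leb `[0, +oo[ (fun y => if y \in (`[0, n%:R]%classic : set R) then g y else 0).
  rewrite cint_mkcond [RHS]cint_mkcond; apply: eq_cint => y _.
  by rewrite mem_set_seg mem_set_ray; case: (0 <= y).
under eq_fun do rewrite e.
apply: (@cint_dct _ _ _ leb _
  (fun n y => if y \in (`[0, n%:R]%classic : set R) then g y else 0) _
  (fun y => cabs (g y))) => //.
- move=> n; apply: cmeasurable_if => //.
  + rewrite (_ : (fun y => y \in _) = (fun y : R => (0 <= y) && (y <= n%:R))).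
      by apply: measurable_and; apply: measurable_fun_ler.
    by apply/funext => y; exact: mem_set_seg.
  + exact: (cintegrable_measurable ig).
- apply: aeW => y; rewrite /= in_itv/= andbT => y0.
  apply: (ccvg_near_eq (u := fun=> g y)); last exact: ccvg_cst.
  near=> n; rewrite mem_set_seg y0/= ifT//; near: n.
  exact: nbhs_infty_ger.
- exact: (cintegrable_measurable ig).
- exact: cintegrable_cabs.
- by apply: aeW => y n _; case: ifP => // _; rewrite cabs0 cabs_ge0.
Unshelve. all: by end_near. Qed.

Lemma cint_expmonom j (z : C) : 0 < Re z ->
  z ^+ j.+1 * cint leb `[0, +oo[ (expmonom j z) = 1.
Proof.
move=> z0; have k0 : 0 < Re z / 2 by rewrite divr_gt0.
have h1 : ccvg \oo (fun n : nat => z ^+ j.+1 * cint leb `[0, n%:R] (expmonom j z))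
   (z ^+ j.+1 * cint leb `[0, +oo[ (expmonom j z)).
  by apply: ccvgM; [exact: ccvg_cst|apply/cint_seg_cvg/cintegrable_expmonom].
have h2 : ccvg \oo (fun n : nat => 1 - \sum_(q < j.+1) z ^+ q * expmonom q z n%:R)
   (1 - \sum_(q < j.+1) z ^+ q * 0).
  apply: ccvgD; first exact: ccvg_cst.
  apply: ccvgN; apply: ccvg_sum => q _; apply: ccvgM; first exact: ccvg_cst.
  apply: geometric_bound_cvg0.
  (* At the integers the exponential bound is a geometric sequence. *)
  exists ((Re z / 2) ^- q), (expR (- (Re z / 2))); split.
  - exact: expR_ge0.
  - by rewrite expR_lt1 oppr_lt0.
  - move=> n; apply: le_trans (cabs_expmonom_le _ z0 _) _ => //.
    by rewrite -expRM_natr mulNr.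
apply: (ccvg_unique h1).
have -> : (fun n : nat => z ^+ j.+1 * cint leb `[0, n%:R] (expmonom j z)) =
   (fun n : nat => 1 - \sum_(q < j.+1) z ^+ q * expmonom q z n%:R).
  apply/funext => n; rewrite cint_expmonom_seg// mulr_sumr; congr (_ - _).
  apply: eq_bigr => q _; rewrite /expmonom exprMn !rmorphM fmorphV rmorphXn !rmorph_nat.
  by move: (cexp _) => e; rewrite mulrC -!mulrA.
by move: h2; under eq_bigr do rewrite mulr0; rewrite sumr_const mul0rn subr0.
Qed.

Lemma cint_seg_tail (g : R -> C) (u : R) : 0 <= u -> cintegrable leb `[0, +oo[ g ->
  cint leb `[0, +oo[ (fun y => if u < y then g y else 0) =
  cint leb `[0, +oo[ g - cint leb `[0, u] g.
Proof.
move=> u0 ig.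
have su : `[0, u]%classic `<=` (`[0, +oo[%classic : set R).
  by move=> y; rewrite /= !in_itv/= => /andP[-> _].
have mu : measurable_fun (`[0, +oo[%classic : set R) (fun y : R => u < y).
  by apply: measurable_funTS; apply: measurable_fun_ltr.
have [mr mi] := cintegrable_measurable ig.
have ilt : cintegrable leb `[0, +oo[ (fun y => if u < y then g y else 0).
  apply: (@cintegrable_le _ _ _ leb _ _ (fun y => cabs (g y))) => //.
  - apply: cmeasurable_if => //; exact: cmeasurable_cst.
  - exact: cintegrable_cabs.
  - by move=> y _; case: ifP => // _; rewrite cabs0 cabs_ge0.
apply/esym/eqP; rewrite subr_eq; apply/eqP.
have -> : cint leb `[0, u] g = cint leb `[0, +oo[ (fun y => g y - if u < y then g y else 0).
  rewrite cint_mkcond [RHS]cint_mkcond; apply: eq_cint => y _.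
  rewrite mem_set_seg mem_set_ray; case: (0 <= y) => //=.
  by case: leP; rewrite ?subr0 ?subrr.
by rewrite cintB// addrC subrK.
Qed.

End ExponentialTail.

(** * Partial fraction decomposition *)

Section PartialFractions.
Context {R : realType}.
Local Notation C := R[i].
Local Notation leb := (@lebesgue_measure R).
Implicit Types (D N E : {poly C}) (rs : seq C).

(** Membership means that [N / D] is a linear combination of the fractions 1 / (X - sigma)^(j + 1)
    with sigma in [rs]. Each fraction is represented by its cofactor [E] in [D], which keeps
    everything polynomial. *)
Inductive pfrac_span rs D : {poly C} -> Prop :=
| PfracSpan0 : pfrac_span rs D 0
| PfracSpanD c sigma j E N : sigma \in rs -> D = E * ('X - sigma%:P) ^+ j.+1 ->
    pfrac_span rs D N -> pfrac_span rs D (c *: E + N).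

Lemma pfrac_spanD rs D N1 N2 :
  pfrac_span rs D N1 -> pfrac_span rs D N2 -> pfrac_span rs D (N1 + N2).
Proof.
elim=> [|c sigma j E N srs DE _ IH] h; first by rewrite add0r.
by rewrite -addrA; apply: PfracSpanD srs DE _; exact: IH.
Qed.

Lemma pfrac_spanZ rs D c N : pfrac_span rs D N -> pfrac_span rs D (c *: N).
Proof.
elim=> [|d sigma j E M srs DE _ IH]; first by rewrite scaler0; exact: PfracSpan0.
by rewrite scalerDr scalerA; apply: PfracSpanD srs DE _.
Qed.

Lemma pfrac_span1 rs D sigma j E : sigma \in rs -> D = E * ('X - sigma%:P) ^+ j.+1 ->
  pfrac_span rs D E.
Proof.
move=> srs DE; rewrite -[E]addr0 -[E]scale1r.
by apply: PfracSpanD srs DE _; exact: PfracSpan0.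
Qed.

(** Resolvent identity: for distinct poles, (X - tau) - (X - sigma) is the constant sigma - tau,
    which splits the fraction into two with one factor fewer. *)
Lemma pfrac_span_pair rs D sigma tau j E : sigma \in rs -> tau \in rs ->
  D = E * (('X - sigma%:P) * ('X - tau%:P) ^+ j) -> pfrac_span rs D E.
Proof.
move=> srs trs; elim: j E => [|j IH] E DE.
  by apply: (pfrac_span1 (j := 0) srs); rewrite DE expr0 mulr1.
have [st|st] := eqVneq sigma tau.
  by apply: (pfrac_span1 (j := j.+1) srs); rewrite DE -st -exprS.
have -> : E = (sigma - tau)^-1 *: (E * ('X - tau%:P) + (- 1) *: (E * ('X - sigma%:P))).
  have -> : E * ('X - tau%:P) + (- 1) *: (E * ('X - sigma%:P)) = (sigma - tau) *: E.
    by rewrite scaleN1r -mul_polyC polyCB; ring.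
  by rewrite scalerA mulVf ?subr_eq0// scale1r.
apply: pfrac_spanZ; apply: pfrac_spanD; last apply: pfrac_spanZ.
  by apply: IH; rewrite DE exprS; ring.
by apply: (pfrac_span1 (j := j) trs); rewrite DE; ring.
Qed.

Lemma pfrac_span_cons rs D tau N : pfrac_span rs D N ->
  pfrac_span (tau :: rs) (D * ('X - tau%:P)) N.
Proof.
elim=> [|c sigma j E M srs DE _ IH]; first exact: PfracSpan0.
apply: pfrac_spanD => //; apply: pfrac_spanZ.
apply: (@pfrac_span_pair _ _ tau sigma j.+1); rewrite ?inE ?eqxx ?srs ?orbT//.
by rewrite DE; ring.
Qed.

Lemma pfrac_span_consM rs D tau N : pfrac_span rs D N ->
  pfrac_span (tau :: rs) (D * ('X - tau%:P)) (N * ('X - tau%:P)).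
Proof.
elim=> [|c sigma j E M srs DE _ IH]; first by rewrite mul0r; exact: PfracSpan0.
rewrite mulrDl; apply: pfrac_spanD => //; rewrite -scalerAl; apply: pfrac_spanZ.
apply: (@pfrac_span1 _ _ sigma j); rewrite ?inE ?srs ?orbT//.
by rewrite DE; ring.
Qed.

Lemma pfrac_span_one tau rs :
  pfrac_span (tau :: rs) (\prod_(z <- tau :: rs) ('X - z%:P)) 1.
Proof.
elim: rs tau => [|z rs IH] tau.
  apply: (@pfrac_span1 _ _ tau 0); rewrite ?inE ?eqxx//.
  by rewrite big_cons big_nil mulr1 mul1r expr1.
by rewrite big_cons mulrC; apply: pfrac_span_cons; exact: IH.
Qed.

(** Dividing the numerator by X - tau leaves a quotient that lives on the remaining poles and a
    constant, dealt with by [pfrac_span_one]. *)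
Lemma pfrac_spanP rs N : (size N <= size rs)%N ->
  pfrac_span rs (\prod_(z <- rs) ('X - z%:P)) N.
Proof.
elim: rs N => [|tau rs IH] N.
  by rewrite leqn0 size_poly_eq0 => /eqP ->; exact: PfracSpan0.
move=> sN; rewrite big_cons mulrC.
have [q [c [Nq sq]]] : exists q c, N = q * ('X - tau%:P) + c%:P /\ (size q <= size rs)%N.
  exists (N %/ ('X - tau%:P)), N.[tau].
  rewrite -modp_XsubC -divp_eq; split => //.
  by rewrite size_divp ?polyXsubC_eq0// size_XsubC leq_subLR.
rewrite Nq; apply: pfrac_spanD; first exact: pfrac_span_consM (IH q sq).
rewrite -[c%:P]mulr1 mul_polyC; apply: pfrac_spanZ.
by have := pfrac_span_one tau rs; rewrite big_cons mulrC.
Qed.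
End PartialFractions.

(** * Densities with a rational Laplace transform *)

Section ExponentialDensity.
Context {R : realType}.
Local Notation C := R[i].
Local Notation leb := (@lebesgue_measure R).
Implicit Types (D N E : {poly C}) (f : R -> C) (Q : R -> {poly C}).

Lemma cabs_coef_le (p : {poly C}) k : cabs p`_k <= \sum_(i < size p) cabs p`_i.
Proof.
have [kp|pk] := ltnP k (size p).
  by rewrite (bigD1 (Ordinal kp))//= lerDl sumr_ge0// => i _; exact: cabs_ge0.
by rewrite nth_default// cabs0 sumr_ge0// => i _; exact: cabs_ge0.
Qed.

(* [f] is the density with Laplace transform [N / D], and
   [(Q u).[s] / D.[s]] is the transform of the overshoot over the level [u]. *)
Record exp_density D N (n : nat) f Q : Prop := ExpDensity {
  ed_cont : continuous (fun y => Re (f y)) /\ continuous (fun y => Im (f y));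
  ed_int : cintegrable leb `[0, +oo[ f;
  ed_lap : forall z, 0 <= Re z ->
    D.[z] * cint leb `[0, +oo[ (fun y => cexp (- (z * y%:C)) * f y) = N.[z];
  ed_seg : forall z (u : R), 0 <= u ->
    D.[z] * cint leb `[0, u] (fun y => cexp (- (z * y%:C)) * f y) =
      N.[z] - cexp (- (z * u%:C)) * (Q u).[z];
  ed_size : forall u, (size (Q u) <= n)%N;
  ed_meas : forall k, cmeasurable setT (fun u => (Q u)`_k);
  ed_bnd : exists K : R, forall (u : R) k, 0 <= u -> cabs (Q u)`_k <= K }.

Lemma continuous_cexp_line z :
  continuous (fun y : R => Re (cexp (- (z * y%:C)))) /\
  continuous (fun y : R => Im (cexp (- (z * y%:C)))).
Proof.
by split; apply: is_derive_continuous => y; have [] := cder_cexp z y.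
Qed.

Lemma cmeasurable_cexp_line (S : set R) z : cmeasurable S (fun y : R => cexp (- (z * y%:C))).
Proof.
have [cr ci] := continuous_cexp_line z.
by apply: cmeasurableS; split; exact: continuous_measurable_fun.
Qed.

Lemma cintegrable_seg_mul f z (u : R) :
  continuous (fun y => Re (f y)) -> continuous (fun y => Im (f y)) ->
  cintegrable leb `[0, u] (fun y => cexp (- (z * y%:C)) * f y).
Proof.
move=> cr ci; have [er ei] := continuous_cexp_line z.
apply: cintegrable_continuous_seg.
  under eq_fun do rewrite ReM.
  by move=> x; apply: cvgB; apply: cvgM; (exact: er || exact: ei || exact: cr || exact: ci).
under eq_fun do rewrite ImM.
by move=> x; apply: cvgD; apply: cvgM; (exact: er || exact: ei || exact: cr || exact: ci).
Qed.

Lemma cintegrable_mul_bounded f (h : R -> C) (K : R) :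
  cintegrable leb `[0, +oo[ f -> cmeasurable setT h ->
  (forall y, 0 <= y -> cabs (h y) <= K) ->
  cintegrable leb `[0, +oo[ (fun y => h y * f y).
Proof.
move=> fi mh hK.
apply: (@cintegrable_le _ _ _ leb _ _ (fun y => K * cabs (f y))) => //.
- apply: cmeasurableM; first exact: cmeasurableS.
  exact: (cintegrable_measurable fi).
- by apply: integrableZlR => //; exact: cintegrable_cabs.
- move=> y; rewrite /= in_itv/= andbT => y0.
  by rewrite cabsM ler_wpM2r ?cabs_ge0// hK.
Qed.

Lemma cabs_cexp_line_le1 z (y : R) : 0 <= Re z -> 0 <= y ->
  cabs (cexp (- (z * y%:C))) <= 1.
Proof.
by move=> z0 y0; apply: cabs_cexp_le1; rewrite ReN ReMr oppr_le0 mulr_ge0.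
Qed.

Lemma exp_density0 D n : exp_density D 0 n (fun=> 0) (fun=> 0).
Proof.
split.
- by split => x; exact: cvg_cst.
- exact: cintegrable0.
- move=> z _; rewrite horner0 (_ : (fun y : R => _) = fun=> 0) ?cint0 ?mulr0//.
  by apply/funext => y; rewrite mulr0.
- move=> z u _; rewrite horner0 mulr0 subr0.
  rewrite (_ : (fun y : R => _) = fun=> 0) ?cint0 ?mulr0//.
  by apply/funext => y; rewrite mulr0.
- by move=> u; rewrite size_poly0.
- by move=> k; under eq_fun do rewrite coef0; exact: cmeasurable_cst.
- by exists 0 => u k _; rewrite coef0 cabs0.
Qed.

Lemma exp_densityD D N1 N2 n f1 f2 Q1 Q2 c :
  exp_density D N1 n f1 Q1 -> exp_density D N2 n f2 Q2 ->
  exp_density D (c *: N1 + N2) n (fun y => c * f1 y + f2 y)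
    (fun u => c *: Q1 u + Q2 u).
Proof.
move=> [[cr1 ci1] i1 l1 s1 z1 m1 [K1 b1]] [[cr2 ci2] i2 l2 s2 z2 m2 [K2 b2]].
have E z : (fun y : R => cexp (- (z * y%:C)) * (c * f1 y + f2 y)) =
    fun y => c * (cexp (- (z * y%:C)) * f1 y) + cexp (- (z * y%:C)) * f2 y.
  by apply/funext => y; rewrite mulrDr mulrCA.
split.
- split.
    rewrite (_ : (fun y => _) = fun y => (Re c * Re (f1 y) - Im c * Im (f1 y)) + Re (f2 y)).
      move=> x; apply: cvgD; last exact: cr2.
      by apply: cvgB; apply: cvgM; (exact: cvg_cst || exact: cr1 || exact: ci1).
    by apply/funext => y; rewrite ReD ReM.
  rewrite (_ : (fun y => _) = fun y => (Re c * Im (f1 y) + Im c * Re (f1 y)) + Im (f2 y)).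
    move=> x; apply: cvgD; last exact: ci2.
    by apply: cvgD; apply: cvgM; (exact: cvg_cst || exact: cr1 || exact: ci1).
  by apply/funext => y; rewrite ImD ImM.
- by apply: cintegrableD => //; exact: cintegrableZ.
- move=> z z0; rewrite E.
  have b y : 0 <= y -> cabs (cexp (- (z * y%:C))) <= 1 by exact: cabs_cexp_line_le1.
  have ii1 := cintegrable_mul_bounded i1 (cmeasurable_cexp_line setT z) b.
  have ii2 := cintegrable_mul_bounded i2 (cmeasurable_cexp_line setT z) b.
  rewrite cintD//; last exact: cintegrableZ.
  by rewrite cintZ// hornerD hornerZ -l1// -l2// mulrDr mulrCA.
- move=> z u u0; rewrite E.
  have ii1 := cintegrable_seg_mul z u cr1 ci1.
  have ii2 := cintegrable_seg_mul z u cr2 ci2.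
  rewrite cintD//; last exact: cintegrableZ.
  rewrite cintZ// mulrDr mulrCA s1// s2//.
  by rewrite !hornerD !hornerZ; ring.
- move=> u; apply: leq_trans (size_polyD _ _) _; rewrite geq_max z2 andbT.
  exact: leq_trans (size_scale_leq _ _) (z1 _).
- move=> k; rewrite (_ : (fun u => _) = fun u => c * (Q1 u)`_k + (Q2 u)`_k).
    by apply: cmeasurableD => //; apply: cmeasurableM => //; exact: cmeasurable_cst.
  by apply/funext => u; rewrite coefD coefZ.
- exists (cabs c * K1 + K2) => u k u0; rewrite coefD coefZ.
  apply: le_trans (ler_cabsD _ _) _; rewrite cabsM lerD ?b2//.
  by rewrite ler_wpM2l ?cabs_ge0 ?b1.
Qed.

Lemma size_prod_XsubC_exp E (sigma : C) j : E != 0 ->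
  size (E * ('X - sigma%:P) ^+ j) = (size E + j)%N.
Proof.
move=> E0; rewrite size_mul ?expf_neq0 ?polyXsubC_eq0// size_exp_XsubC.
by rewrite addnS.
Qed.

(** Here [E / D] is a single fraction, the transform of a Gamma density, and the overshoot
    polynomial is read off the finite sum in [cint_expmonom_seg]. *)
Lemma exp_density1 D E sigma j : Re sigma < 0 -> D = E * ('X - sigma%:P) ^+ j.+1 ->
  exp_density D E (size D).-1 (expmonom j (- sigma))
    (fun u => \sum_(q < j.+1) expmonom q (- sigma) u *: (E * ('X - sigma%:P) ^+ q)).
Proof.
move=> s0 DE.
have E0z z : (fun y : R => cexp (- (z * y%:C)) * expmonom j (- sigma) y) =
    expmonom j (z - sigma).
  apply/funext => y; rewrite /expmonom mulrCA -cexpD; congr (_ * cexp _).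
  by ring.
have Dz z : D.[z] = E.[z] * (z - sigma) ^+ j.+1.
  by rewrite DE hornerM horner_exp hornerXsubC.
have k0 : 0 < Re (- sigma) by rewrite ReN oppr_gt0.
split.
- exact: continuous_expmonom.
- exact: cintegrable_expmonom.
- move=> z z0; rewrite E0z Dz -mulrA cint_expmonom ?mulr1//.
  by rewrite ReD ReN subr_gt0 (lt_le_trans s0).
- move=> z u u0; rewrite E0z Dz -mulrA cint_expmonom_seg// mulrBr mulr1.
  congr (_ - _); rewrite horner_sum !mulr_sumr; apply: eq_bigr => q _.
  rewrite hornerZ hornerM horner_exp hornerXsubC /expmonom.
  have -> : cexp (- ((z - sigma) * u%:C)) =
      cexp (- (z * u%:C)) * cexp (- (- sigma * u%:C)).
    by rewrite -cexpD; congr cexp; ring.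
  rewrite exprMn !rmorphM fmorphV rmorphXn rmorph_nat.
  by move: (cexp _) (cexp _) => e e'; ring.
- move=> u; have [->|E0] := eqVneq E 0.
    rewrite big1 ?size_poly0// => q _; by rewrite mul0r scaler0.
  rewrite DE size_prod_XsubC_exp// addnS /=.
  apply: leq_trans (size_sum _ _ _) _; apply/bigmax_leqP => q _.
  apply: leq_trans (size_scale_leq _ _) _; rewrite size_prod_XsubC_exp//.
  by rewrite leq_add2l -ltnS.
- move=> k; rewrite (_ : (fun u => _) = fun u =>
      \sum_(q < j.+1) expmonom q (- sigma) u * (E * ('X - sigma%:P) ^+ q)`_k).
    apply: cmeasurable_sum => q _; apply: cmeasurableM; last exact: cmeasurable_cst.
    exact: cmeasurable_expmonom.
  by apply/funext => u; rewrite coef_sum; apply: eq_bigr => q _; rewrite coefZ.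
- pose B (p : {poly C}) := \sum_(i < size p) cabs p`_i.
  exists (\sum_(q < j.+1) (Re (- sigma) / 2) ^- q * B (E * ('X - sigma%:P) ^+ q)).
  move=> u k u0; rewrite coef_sum; apply: le_trans (ler_cabs_sum _ _ _) _.
  apply: ler_sum => q _; rewrite coefZ cabsM ler_pM ?cabs_ge0 ?cabs_coef_le//.
  apply: le_trans (cabs_expmonom_le _ k0 u0) _.
  apply: ler_piMr; first by rewrite invr_ge0 exprn_ge0// divr_ge0// ltW.
  by rewrite expR_le1 oppr_le0 mulr_ge0// divr_ge0// ltW.
Qed.

Lemma exp_density_exists rs N : (forall z, z \in rs -> Re z < 0) ->
  (size N <= size rs)%N ->
  exists f Q, exp_density (\prod_(z <- rs) ('X - z%:P)) N (size rs) f Q.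
Proof.
move=> rs0 /pfrac_spanP.
elim=> [|c sigma j E M srs DE _ [f [Q IH]]].
  by exists (fun=> 0), (fun=> 0); exact: exp_density0.
have := exp_density1 (rs0 _ srs) DE; rewrite size_prod_XsubC /= => h.
by do 2 eexists; exact: exp_densityD h IH.
Qed.

End ExponentialDensity.

(** * Identifying a law through its Laplace transform *)

Section DensityOfLaw.
Context {R : realType} d {T : measurableType d} (P : probability T R).
Local Notation C := R[i].
Local Notation leb := (@lebesgue_measure R).
Variables (X : T -> R) (f : R -> C).
Hypotheses (mX : measurable_fun setT X) (X0 : forall t, 0 <= X t).
Hypothesis fi : cintegrable leb `[0, +oo[ f.
Hypothesis lapX : forall z, 0 <= Re z ->
  cint P setT (fun t => cexp (- (z * (X t)%:C))) =
  cint leb `[0, +oo[ (fun y => cexp (- (z * y%:C)) * f y).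

(** Functions on which the law of [X] and the density [f] agree, even after an exponential tilt. The
    class stands in for the uniqueness theorem of Laplace transforms: it contains 1 and is stable
    under differences, exponential factors and bounded limits, which suffices to reach
    truncations. *)
Definition density_tests (h : R -> C) : Prop :=
  [/\ cmeasurable setT h, (exists K : R, forall y, 0 <= y -> cabs (h y) <= K) &
      forall z, 0 <= Re z ->
        cint P setT (fun t => cexp (- (z * (X t)%:C)) * h (X t)) =
        cint leb `[0, +oo[ (fun y => (cexp (- (z * y%:C)) * h y) * f y)].

Lemma density_tests1 : density_tests (fun=> 1).
Proof.
split; first exact: cmeasurable_cst.
  by exists 1 => y _; rewrite cabs1.
move=> z z0; under [X in cint P _ X]eq_fun do rewrite mulr1.
by rewrite lapX//; apply: eq_cint => y _; rewrite mulr1.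
Qed.

Lemma density_tests_int (h : R -> C) z : 0 <= Re z -> cmeasurable setT h ->
  (exists K : R, forall y, 0 <= y -> cabs (h y) <= K) ->
  cintegrable P setT (fun t => cexp (- (z * (X t)%:C)) * h (X t)) /\
  cintegrable leb `[0, +oo[ (fun y => (cexp (- (z * y%:C)) * h y) * f y).
Proof.
move=> z0 mh [K hK].
have me : cmeasurable setT (fun y : R => cexp (- (z * y%:C)) * h y).
  by apply: cmeasurableM => //; exact: cmeasurable_cexp_line.
have b y : 0 <= y -> cabs (cexp (- (z * y%:C)) * h y) <= K.
  move=> y0; rewrite cabsM -[leRHS]mul1r ler_pM ?cabs_ge0 ?hK//.
  exact: cabs_cexp_line_le1.
split; last exact: cintegrable_mul_bounded b.
apply: (@cintegrable_bounded _ _ _ _ _ _ K) => //.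
  exact: (cmeasurable_comp me mX).
by move=> t _; exact: b.
Qed.

Lemma density_testsB (g h : R -> C) : density_tests g -> density_tests h ->
  density_tests (fun y => g y - h y).
Proof.
move=> [mg [K gK] eg] [mh [L hL] eh]; split.
- by apply: cmeasurableD => //; exact: cmeasurableN.
- exists (K + L) => y y0; apply: le_trans (ler_cabsB _ _) _.
  by rewrite lerD ?gK ?hL.
- move=> z z0.
  have [ig1 ig2] := density_tests_int z0 mg (ex_intro _ K gK).
  have [ih1 ih2] := density_tests_int z0 mh (ex_intro _ L hL).
  rewrite (_ : (fun t => _) = fun t => cexp (- (z * (X t)%:C)) * g (X t)
     - cexp (- (z * (X t)%:C)) * h (X t)); last by apply/funext => t; rewrite mulrBr.
  rewrite [RHS](_ : _ = cint leb `[0, +oo[ (fun y => (cexp (- (z * y%:C)) * g y) * f y -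
     (cexp (- (z * y%:C)) * h y) * f y)); last first.
    by apply: eq_cint => y _; rewrite mulrBr mulrBl.
  by rewrite !cintB// eg// eh.
Qed.

Lemma density_tests_cexp (h : R -> C) z : 0 <= Re z -> density_tests h ->
  density_tests (fun y => cexp (- (z * y%:C)) * h y).
Proof.
move=> z0 [mh [K hK] eh]; split.
- by apply: cmeasurableM => //; exact: cmeasurable_cexp_line.
- exists K => y y0; rewrite cabsM -[leRHS]mul1r ler_pM ?cabs_ge0 ?hK//.
  exact: cabs_cexp_line_le1.
- move=> s s0; have sz0 : 0 <= Re (s + z) by rewrite ReD addr_ge0.
  have E y : cexp (- (s * y)) * cexp (- (z * y)) = cexp (- ((s + z) * y)).
    by rewrite -cexpD mulrDl opprD.
  rewrite (_ : (fun t => _) = fun t => cexp (- ((s + z) * (X t)%:C)) * h (X t)).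
    by rewrite eh//; apply: eq_cint => y _; rewrite mulrA E.
  by apply/funext => t; rewrite mulrA E.
Qed.

Lemma density_tests_pow (h : R -> C) (c : R) k : 0 <= c -> density_tests h ->
  density_tests (fun y => ((1 - expR (- (c * y))) ^+ k)%:C * h y).
Proof.
move=> c0 th; elim: k => [|k IH].
  by under eq_fun do rewrite expr0 mul1r.
have c0' : 0 <= Re c%:C by [].
have := density_testsB IH (density_tests_cexp c0' IH).
congr density_tests; apply/funext => y.
rewrite -rmorphM -rmorphN cexp_real exprS rmorphM rmorphB rmorph1 mulrA.
by rewrite -[X in X - _]mul1r -mulrA -mulrBl mulrA.
Qed.

Lemma density_tests_lim (u : nat -> R -> C) (h : R -> C) (K : R) :
  (forall n, density_tests (u n)) -> cmeasurable setT h ->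
  (forall n y, 0 <= y -> cabs (u n y) <= K) ->
  (forall y, 0 <= y -> ccvg \oo (u ^~ y) (h y)) -> density_tests h.
Proof.
move=> tu mh uK uh.
have hK y : 0 <= y -> cabs (h y) <= K.
  move=> y0; have cu : cabs (u n y) @[n --> \oo] --> cabs (h y).
    by apply: ccvg_cabs; exact: uh.
  have cK : (fun=> K) @ \oo --> K by exact: cvg_cst.
  by apply: (ler_cvg_to cu cK); near=> n; exact: uK.
split => //; first by exists K.
move=> z z0.
have mu n : cmeasurable setT (u n) by have [] := tu n.
have me : cmeasurable setT (fun y : R => cexp (- (z * y%:C))).
  exact: cmeasurable_cexp_line.
have b y : 0 <= y -> cabs (cexp (- (z * y%:C))) <= 1 by exact: cabs_cexp_line_le1.
have c1 : ccvg \oo (fun n => cint P setT (fun t => cexp (- (z * (X t)%:C)) * u n (X t)))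
    (cint P setT (fun t => cexp (- (z * (X t)%:C)) * h (X t))).
  apply: (@cint_dct_bounded _ _ _ _ _ _ _ K) => //.
  - by move=> n; exact: (@cmeasurable_comp _ _ _ _ _ X (fun y => cexp (- (z * y%:C)) * u n y) setT
      (cmeasurableM me (mu n)) mX).
  - by move=> t _; apply: ccvgM; [exact: ccvg_cst|exact: uh].
  - by move=> n t _; rewrite cabsM -[leRHS]mul1r ler_pM ?cabs_ge0 ?uK ?b.
have c2 : ccvg \oo (fun n => cint leb `[0, +oo[ (fun y => (cexp (- (z * y%:C)) * u n y) * f y))
    (cint leb `[0, +oo[ (fun y => (cexp (- (z * y%:C)) * h y) * f y)).
  apply: (@cint_dct _ _ _ leb _ (fun n y => (cexp (- (z * y%:C)) * u n y) * f y) _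
    (fun y => K * cabs (f y))) => //.
  - move=> n; apply: cmeasurableM; last exact: (cintegrable_measurable fi).
    exact: (cmeasurableS _ (cmeasurableM me (mu n))).
  - apply: aeW => y; rewrite /= in_itv/= andbT => y0.
    apply: ccvgM; last exact: ccvg_cst.
    by apply: ccvgM; [exact: ccvg_cst|exact: uh].
  - apply: cmeasurableM; last exact: (cintegrable_measurable fi).
    exact: (cmeasurableS _ (cmeasurableM me mh)).
  - by apply: integrableZlR => //; exact: cintegrable_cabs.
  - apply: aeW => y n; rewrite /= in_itv/= andbT => y0.
    rewrite cabsM ler_wpM2r ?cabs_ge0// cabsM -[leRHS]mul1r ler_pM ?cabs_ge0 ?uK//.
    exact: b.
apply: (ccvg_unique c1); move: c2; congr ccvg; apply/funext => n.
by have [_ _ ->] := tu n.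
Unshelve. all: by end_near. Qed.

End DensityOfLaw.

(** * Approximating indicators by powers of 1 - e^(-n y) *)

Section IndicatorApproximation.
Context {R : realType}.
Local Notation C := R[i].

Lemma bernoulli_le (t : R) k : 0 <= t -> t <= 1 -> 1 - k%:R * t <= (1 - t) ^+ k.
Proof.
move=> t0 t1; elim: k => [|k IH]; first by rewrite mul0r subr0 expr0.
rewrite exprS; apply: (@le_trans _ _ ((1 - t) * (1 - k%:R * t))); last first.
  by rewrite ler_wpM2l// subr_ge0.
rewrite -natr1; have : 0 <= k%:R * t * t by rewrite !mulr_ge0.
nra.
Qed.

Lemma expR_natr_decr (x : R) : 0 < x -> expR (- (n%:R * x)) @[n --> \oo] --> (0 : R).
Proof.
move=> x0; under eq_fun do rewrite -mulrN mulrC expRM_natr.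
by apply: cvg_expr; rewrite ger0_norm ?expR_ge0// expR_lt1 oppr_lt0.
Qed.

Definition cutoff_exponent (u : R) (n : nat) : nat := (Num.truncn (n%:R * expR (n%:R * u))).+1.

(* With [t := expR (- n y)] and [k] about [n * expR (n u)], the number [k * t]
   tends to infinity for [y <= u] and to 0 for [u < y]. *)
Lemma cutoff_cvg (u y : R) : 0 <= u -> 0 <= y ->
  (1 - expR (- (n%:R * y))) ^+ cutoff_exponent u n @[n --> \oo] -->
    (if u < y then 1 else 0 : R).
Proof.
move=> u0 y0.
have t1 n : expR (- (n%:R * y)) <= 1 by rewrite expR_le1 oppr_le0 mulr_ge0.
have t0 n : 0 <= expR (- (n%:R * y)) by exact: expR_ge0.
have p0 n : 0 <= 1 - expR (- (n%:R * y)) by rewrite subr_ge0.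
have k1 n : n%:R * expR (n%:R * u) <= (cutoff_exponent u n)%:R.
  by rewrite ltW// /cutoff_exponent truncnS_gt.
have k2 n : (cutoff_exponent u n)%:R <= n%:R * expR (n%:R * u) + 1.
  by rewrite /cutoff_exponent -natr1 lerD2r truncn_le mulr_ge0// expR_ge0.
have [yu|uy] := leP y u.
  (* Here (1 - t)^k is at most e^(-k t), and k t is at least n. *)
  apply: (squeeze_cvgr (f := fun=> 0) (h := fun n => expR (- (n%:R * 1)))).
  - apply: nearW => n; rewrite exprn_ge0//=.
    apply: (@le_trans _ _ (expR (- expR (- (n%:R * y))) ^+ cutoff_exponent u n)).
      by rewrite lerXn2r ?nnegrE ?expR_ge0// (le_trans _ (expR_ge1Dx _))// addrC.
    rewrite -expRM_natr ler_expR mulNr lerN2 mulr1.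
    apply: (@le_trans _ _ (expR (- (n%:R * y)) * (n%:R * expR (n%:R * u)))).
      rewrite mulrCA -expRD ler_peMr// -expR0 ler_expR addrC -mulrBr.
      by rewrite mulr_ge0// subr_ge0.
    by rewrite ler_wpM2l.
  - exact: cvg_cst.
  - exact: expR_natr_decr.
(* With [h] half the gap, k t is at most n e^(-2 n h) + t, and n e^(-n h) is at most 1 / h;
   Bernoulli's inequality does the rest. *)
pose h := (y - u) / 2; have h0 : 0 < h by rewrite divr_gt0// subr_gt0.
apply: (squeeze_cvgr (h := fun=> 1)
  (f := fun n => 1 - (h^-1 * expR (- (n%:R * h)) + expR (- (n%:R * y))))).
- apply: nearW => n; apply/andP; split; last by rewrite exprn_ile1// gerBl.
  apply: le_trans (bernoulli_le _ (t0 n) (t1 n)).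
  rewrite lerB//; apply: (@le_trans _ _ ((n%:R * expR (n%:R * u) + 1) * expR (- (n%:R * y)))).
    by rewrite ler_wpM2r.
  rewrite mulrDl mul1r lerD2r -mulrA -expRD.
  have -> : n%:R * u + - (n%:R * y) = - (n%:R * h) + - (n%:R * h) by rewrite /h; field.
  rewrite expRD mulrA ler_wpM2r ?expR_ge0// -ler_pdivlMr ?expR_gt0// expRN invrK.
  rewrite ler_pdivlMl//; apply: le_trans (expR_ge1Dx _).
  by rewrite mulrC lerDr.
- have hn := expR_natr_decr h0.
  have hy := expR_natr_decr (le_lt_trans u0 uy).
  rewrite [X in _ --> X](_ : 1 = 1 - (h^-1 * 0 + 0)); last by rewrite mulr0 addr0 subr0.
  apply: cvgB; first exact: cvg_cst.
  by apply: cvgD => //; apply: cvgM => //; exact: cvg_cst.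
- exact: cvg_cst.
Qed.

End IndicatorApproximation.

(** * Overshoot and undershoot of a variable with rational transform *)

Section Overshoot.
Context {R : realType} d {T : measurableType d} (P : probability T R).
Local Notation C := R[i].
Local Notation leb := (@lebesgue_measure R).

Section Tests.
Variables (X : T -> R) (f : R -> C).
Hypotheses (mX : measurable_fun setT X) (X0 : forall t, 0 <= X t).
Hypothesis fi : cintegrable leb `[0, +oo[ f.
Hypothesis lapX : forall z, 0 <= Re z ->
  cint P setT (fun t => cexp (- (z * (X t)%:C))) =
  cint leb `[0, +oo[ (fun y => cexp (- (z * y%:C)) * f y).

Lemma cmeasurable_lt_cst (u : R) (c1 c2 : C) :
  cmeasurable setT (fun y : R => if u < y then c1 else c2).
Proof.
apply: cmeasurable_ifT; [exact: measurable_fun_ltr|exact: cmeasurable_cst|].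
exact: cmeasurable_cst.
Qed.

Lemma density_tests_gt (u : R) : 0 <= u ->
  density_tests P X f (fun y => if u < y then 1 else 0).
Proof.
move=> u0; apply: (@density_tests_lim _ _ _ _ _ _ mX X0 fi
  (fun n y => ((1 - expR (- (n%:R * y))) ^+ cutoff_exponent u n)%:C * 1) _ 1).
- move=> n; apply: density_tests_pow => //.
  exact: density_tests1.
- exact: cmeasurable_lt_cst.
- move=> n y y0; rewrite mulr1 cabs_real normrX.
  have t1 : expR (- (n%:R * y)) <= 1 by rewrite expR_le1 oppr_le0 mulr_ge0.
  rewrite exprn_ile1// ger0_norm ?subr_ge0// gerBl; exact: expR_ge0.
- move=> y y0; under [X in ccvg _ X]eq_fun do rewrite mulr1.
  have -> : (if u < y then 1 else 0 : C) = (if u < y then 1 else 0 : R)%:C by case: ifP.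
  by apply: ccvg_real; exact: cutoff_cvg.
Qed.

Lemma density_tests_le (u : R) : 0 <= u ->
  density_tests P X f (fun y => if y <= u then 1 else 0).
Proof.
move=> u0.
have := density_testsB mX X0 fi (density_tests1 lapX) (density_tests_gt u0).
congr density_tests; apply/funext => y.
by case: leP => _; rewrite ?subr0 ?subrr.
Qed.

Lemma sum_geometric_expR (q : R) n : q != 1 ->
  \sum_(0 <= k < n) q ^+ k = (1 - q ^+ n) / (1 - q).
Proof.
move=> q1; have q10 : 1 - q != 0 by rewrite subr_eq0 eq_sym.
by apply: (mulIf q10); rewrite divfK// big_mkord mulrC -opprB mulNr -subrX1 opprB.
Qed.

(** The exponential e^(sigma y) is the geometric series of ratio 1 - e^(-sigma y), whose partial
    sums are differences of known tests; the cut at [u] keeps them below e^(sigma u). Undershoots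
    require such growing exponentials, because of e^(-s (u - y)). *)
Lemma density_tests_le_expR (u sigma : R) : 0 <= u -> 0 <= sigma ->
  density_tests P X f (fun y => if y <= u then (expR (sigma * y))%:C else 0).
Proof.
move=> u0 s0.
have q0 y : 0 <= y -> 0 <= 1 - expR (- (sigma * y)).
  by move=> y0; rewrite subr_ge0 expR_le1 oppr_le0 mulr_ge0.
have q1 y : 1 - (1 - expR (- (sigma * y))) = expR (- (sigma * y)) by rewrite opprB addrC subrK.
have qlt y : 1 - expR (- (sigma * y)) < 1 by rewrite gtrBl expR_gt0.
have sumE y n : \sum_(0 <= k < n) (1 - expR (- (sigma * y))) ^+ k =
   (1 - (1 - expR (- (sigma * y))) ^+ n) * expR (sigma * y).
  by rewrite sum_geometric_expR ?lt_eqF// q1 expRN invrK.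
apply: (@density_tests_lim _ _ _ _ _ _ mX X0 fi
  (fun n y => \sum_(0 <= k < n) ((1 - expR (- (sigma * y))) ^+ k)%:C *
     (if y <= u then 1 else 0)) _ (expR (sigma * u))).
- elim=> [|n IH].
    have := density_testsB mX X0 fi (density_tests1 lapX) (density_tests1 lapX).
    congr density_tests; apply/funext => y; by rewrite subrr big_nil.
  have h0 : density_tests P X f (fun=> 0).
    have := density_testsB mX X0 fi (density_tests1 lapX) (density_tests1 lapX).
    by under [X in density_tests _ _ _ X]eq_fun do rewrite subrr.
  have hn := density_tests_pow mX X0 fi n s0 (density_tests_le u0).
  have := density_testsB mX X0 fi IH (density_testsB mX X0 fi h0 hn).
  congr density_tests; apply/funext => y.
  by rewrite sub0r opprK big_nat_recr.
- have -> : (fun y => if y <= u then (expR (sigma * y))%:C else 0) =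
    fun y => (if u < y then 0 else 1) * (expR (sigma * y))%:C :> C.
    by apply/funext => y; case: leP; rewrite ?mul1r ?mul0r.
  apply: cmeasurableM; first exact: cmeasurable_lt_cst.
  apply: cmeasurable_real; apply: measurableT_comp; first exact: measurable_expR.
  exact: measurable_funM.
- move=> n y y0 /=; case: (leP y u) => yu; last first.
    by rewrite big1 ?cabs0 ?expR_ge0// => k _; rewrite mulr0.
  under eq_bigr do rewrite mulr1.
  rewrite -rmorph_sum cabs_real sumE ger0_norm; last first.
    by rewrite mulr_ge0 ?expR_ge0// subr_ge0 exprn_ile1 ?q0// ltW.
  apply: (@le_trans _ _ (expR (sigma * y))).
    by rewrite ler_piMl ?expR_ge0// gerBl exprn_ge0// q0.
  by rewrite ler_expR ler_wpM2l.
- move=> y y0 /=; case: (leP y u) => yu; last first.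
    rewrite (_ : (fun n => _) = fun=> 0); first exact: ccvg_cst.
    by apply/funext => n; rewrite big1// => k _; rewrite mulr0.
  rewrite (_ : (fun n => _) =
    fun n => ((1 - (1 - expR (- (sigma * y))) ^+ n) * expR (sigma * y))%:C); last first.
    by apply/funext => n; rewrite -sumE rmorph_sum; apply: eq_bigr => k _; rewrite mulr1.
  apply: ccvg_real; rewrite [X in _ --> X](_ : _ = (1 - 0) * expR (sigma * y)); last first.
    by rewrite subr0 mul1r.
  apply: cvgM; last exact: cvg_cst.
  apply: cvgB; first exact: cvg_cst.
  by apply: cvg_expr; rewrite ger0_norm ?q0.
Qed.

End Tests.

(** What later arguments use about [X], with the density eliminated. [op_root] reflects that the
    transform over [0, u] is entire: the numerator N(z) - e^(-zu) Q_u(z) must vanish with [D]. *)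
Record overshoot_poly (X : T -> R) (D N : {poly C}) (n : nat) (Q : R -> {poly C}) : Prop :=
  OvershootPoly {
  op_size : forall u, (size (Q u) <= n)%N;
  op_meas : forall k, cmeasurable setT (fun u => (Q u)`_k);
  op_bnd : exists K : R, forall (u : R) k, 0 <= u -> cabs (Q u)`_k <= K;
  op_gt : forall (u : R) (s : C), 0 <= u -> 0 <= Re s ->
    D.[s] * cint P setT (fun t => if u < X t then cexp (- (s * (X t - u)%:C)) else 0)
      = (Q u).[s];
  op_le : forall (u : R) (s : C), 0 <= u -> 0 <= Re s ->
    D.[- s] * cint P setT (fun t => if X t <= u then cexp (- (s * (u - X t)%:C)) else 0)
      = cexp (- (s * u%:C)) * N.[- s] - (Q u).[- s];
  op_root : forall (u : R) (z : C), 0 <= u -> root D z ->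
    (Q u).[z] = N.[z] * cexp (z * u%:C);
  op_0 : Q 0 = N }.

Lemma poly_eq_horner (p q : {poly C}) : (forall z, p.[z] = q.[z]) -> p = q.
Proof.
move=> h; apply/eqP; rewrite -subr_eq0; apply/negPn/negP => pq0.
have h2 : size (map (fun i : nat => i%:R : C) (iota 0 (size (p - q)))) = size (p - q).
  by rewrite size_map size_iota.
suff : (size (p - q)%R < size (p - q)%R)%N by rewrite ltnn.
rewrite -{1}h2; apply: max_poly_roots => //.
  by apply/allP => z _; rewrite /root hornerD hornerN h subrr.
rewrite map_inj_uniq ?iota_uniq// => i j /eqP; rewrite eqr_nat => /eqP.
by [].
Qed.

Lemma overshoot_poly_exists (X : {RV P >-> R}) (rs : seq C) (N : {poly C}) :
  (forall z, z \in rs -> Re z < 0) -> (size N <= size rs)%N ->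
  {ae P, forall t, 0 <= X t} ->
  (forall s, 0 <= Re s -> LST P X s = N.[s] / (\prod_(z <- rs) ('X - z%:P)).[s]) ->
  exists Q, overshoot_poly X (\prod_(z <- rs) ('X - z%:P)) N (size rs) Q.
Proof.
move=> rs0 sN X0 lst; set D := \prod_(z <- rs) _.
have D0 s : 0 <= Re s -> D.[s] != 0.
  move=> s0; rewrite -[_ == 0]/(root D s) root_prod_XsubC.
  by apply/negP => /rs0; rewrite ltNge s0.
have [f [Q [cf fi fl fs sQ mQ bQ]]] := exp_density_exists rs0 sN.
have mX : measurable_fun setT X by exact: measurable_funPT.
(* [X] is nonnegative only almost everywhere, while the tests need a variable nonnegative at every
   point. *)
pose Y t := Num.max (X t) 0.
have mY : measurable_fun setT Y by exact: measurable_maxr.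
have Y0 t : 0 <= Y t by rewrite /Y le_max lexx orbT.
have XY : {ae P, forall t, X t = Y t}.
  by apply: filterS X0 => t Xt; rewrite /Y; apply/esym/max_l.
have lapY z : 0 <= Re z -> cint P setT (fun t => cexp (- (z * (Y t)%:C))) =
    cint leb `[0, +oo[ (fun y => cexp (- (z * y%:C)) * f y).
  move=> z0; have <- : LST P X z = cint P setT (fun t => cexp (- (z * (Y t)%:C))).
    apply: ae_eq_cint => //.
    - exact: (cmeasurable_comp (cmeasurable_cexp_line setT z) mX).
    - exact: (cmeasurable_comp (cmeasurable_cexp_line setT z) mY).
    - by apply: filterS XY => t <-.
  apply: (mulfI (D0 _ z0)); rewrite fl// lst// mulrC divfK//; exact: D0.
have tgt u u0 := density_tests_gt mY Y0 fi lapY (u := u) u0.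
have tle u sg u0 s0 := density_tests_le_expR mY Y0 fi lapY (u := u) (sigma := sg) u0 s0.
have mif (b : R -> bool) (g : R -> C) : measurable_fun setT b -> cmeasurable setT g ->
    cmeasurable setT (fun t => if b (X t) then g (X t) else 0) /\
    cmeasurable setT (fun t => if b (Y t) then g (Y t) else 0).
  move=> mb mg.
  have h : cmeasurable setT (fun y => if b y then g y else 0).
    by apply: cmeasurable_ifT => //; exact: cmeasurable_cst.
  by split; [exact: (cmeasurable_comp h mX)|exact: (cmeasurable_comp h mY)].
exists Q; split => //.
- move=> u s u0 s0.
  have mg : cmeasurable setT (fun y : R => cexp (- (s * (y - u)%:C))).
    apply: cmeasurable_cexp; apply: cmeasurableN; apply: cmeasurableM.
      exact: cmeasurable_cst.
    by apply: cmeasurable_real; exact: measurable_funB.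
  have [m1 m2] := mif (fun y => u < y) _ (measurable_fun_ltr (@measurable_cst _ _ _ _ _ u) (@measurable_id _ _ _)) mg.
  rewrite (_ : cint P setT _ =
      cint P setT (fun t => if u < Y t then cexp (- (s * (Y t - u)%:C)) else 0)); last first.
    by apply: ae_eq_cint => //; apply: filterS XY => t <-.
  have [_ _ /(_ s s0) e] := tgt u u0.
  have E t : (if u < Y t then cexp (- (s * (Y t - u)%:C)) else 0) =
      cexp (s * u%:C) * (cexp (- (s * (Y t)%:C)) * (if u < Y t then 1 else 0)).
    case: ifP => _; rewrite ?mulr0// mulr1 -cexpD; congr cexp.
    by rewrite rmorphB; ring.
  under [X in cint _ _ X]eq_fun do rewrite E.
  have b1 : exists K : R, forall y, 0 <= y -> cabs (if u < y then 1 else 0 : C) <= K.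
    by exists 1 => y _; case: ifP; rewrite ?cabs1 ?cabs0.
  have [i1 i2] := density_tests_int P mY Y0 fi s0 (cmeasurable_lt_cst u 1 0) b1.
  rewrite cintZ// e mulrCA.
  have E2 y : cexp (- (s * y%:C)) * (if u < y then 1 else 0) * f y =
     (if u < y then cexp (- (s * y%:C)) * f y else 0).
    by case: ifP; rewrite ?mulr1 ?mulr0 ?mul0r.
  under [X in cint leb _ X]eq_fun do rewrite E2.
  rewrite cint_seg_tail//; last first.
    apply: (cintegrable_mul_bounded fi (cmeasurable_cexp_line setT s) (K := 1)) => y y0.
    exact: cabs_cexp_line_le1.
  rewrite mulrBr fl// fs// opprB addrC subrK mulrA -cexpD subrr cexp0 mul1r.
  by [].
- move=> u s u0 s0.
  have mg : cmeasurable setT (fun y : R => cexp (- (s * (u - y)%:C))).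
    apply: cmeasurable_cexp; apply: cmeasurableN; apply: cmeasurableM.
      exact: cmeasurable_cst.
    by apply: cmeasurable_real; exact: measurable_funB.
  have [m1 m2] := mif (fun y => y <= u) _ (measurable_fun_ler (@measurable_id _ _ _) (@measurable_cst _ _ _ _ _ u)) mg.
  rewrite (_ : cint P setT _ =
      cint P setT (fun t => if Y t <= u then cexp (- (s * (u - Y t)%:C)) else 0)); last first.
    by apply: ae_eq_cint => //; apply: filterS XY => t <-.
  (* The exponent [s] is split: the growing real part goes into the test function, the oscillating
     imaginary part into the tilt, whose parameter has real part 0. *)
  have w0 : 0 <= Re (- ('i * (Im s)%:C) : C) by rewrite ReN ReMr /= mul0r oppr0.
  have [mh bh /(_ _ w0) e] := tle u (Re s) u0 s0.
  have sE : s = (Re s)%:C + 'i * (Im s)%:C by rewrite -complexE.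
  have E y : (if y <= u then cexp (- (s * (u - y)%:C)) else 0) =
      cexp (- (s * u%:C)) * (cexp (- (- ('i * (Im s)%:C) * y%:C)) *
         (if y <= u then (expR (Re s * y))%:C else 0)).
    case: ifP => _; rewrite ?mulr0// -cexp_real -!cexpD; congr cexp.
    by move: (Re s) (Im s) sE => x v ->; rewrite rmorphB rmorphM; ring.
  under [X in cint _ _ X]eq_fun do rewrite E.
  have [i1 i2] := density_tests_int P mY Y0 fi w0 mh bh.
  rewrite cintZ// e mulrCA.
  have E2 : cint leb `[0, +oo[ (fun y => cexp (- (- ('i * (Im s)%:C) * y%:C)) *
         (if y <= u then (expR (Re s * y))%:C else 0) * f y) =
     cint leb `[0, u] (fun y => cexp (- (- s * y%:C)) * f y).
    rewrite cint_mkcond [RHS]cint_mkcond; apply: eq_cint => y _.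
    rewrite mem_set_seg mem_set_ray; case: (0 <= y) => //=.
    case: leP => _; rewrite ?mulr0 ?mul0r//; congr (_ * _).
    rewrite -cexp_real -cexpD; congr cexp.
    by move: (Re s) (Im s) sE => x v ->; rewrite rmorphM; ring.
  rewrite E2 fs// mulrBr; congr (_ - _).
  by rewrite mulrA -cexpD mulNr opprK addNr cexp0 mul1r.
- move=> u z u0 /eqP Dz; have := fs z u u0; rewrite Dz mul0r => /esym/eqP.
  rewrite subr_eq0 => /eqP ->; rewrite mulrAC -cexpD addNr cexp0 mul1r.
  by [].
- apply: poly_eq_horner => z; have := fs z 0 (lexx 0).
  rewrite (_ : cint _ _ _ = 0); last first.
    by apply: complex_eq => /=; rewrite set_itv1 Rintegral_set1.
  by rewrite !mulr0 oppr0 cexp0 mul1r => /esym/eqP; rewrite subr_eq0 => /eqP.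
Qed.

End Overshoot.

(** * The functional equation and the defect at a pole of the transform of B *)

(* [U] has the functional equation obtained by summing the one-step recursion,
   with source [psi] and polynomial remainder [Cp]; [s_defect] measures by how
   much the equation at the pole [z] of the transform of [B] fails. *)
Section TransformSolution.
Context {R : realType}.
Local Notation C := R[i].
Variables (DY NY : {poly C}) (N : nat) (a p r : R) (nu : probability R R).

Record transform_solution (psi U : C -> C) (Cp : {poly C}) : Prop := TransformSolution {
  ts_size : (size Cp <= N)%N;
  ts_eq : forall s : C, 0 <= Re s ->
    DY.[s] * (U s - psi s) = (r * p)%:C * NY.[s] * U (a%:C * s) + Cp.[s];
  ts_bnd : exists2 K : R, 0 <= K & forall s : C, 0 <= Re s -> cabs (U s) <= K;
  ts_cont : forall s : C, 0 < Re s -> ccontinuous_at U s;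
  ts_meas : forall z : C, Re z < 0 ->
    cmeasurable (`]-oo, 0[ : set R) (fun y : R => U (z * y%:C)) }.

Definition s_defect (U : C -> C) (Cp : {poly C}) (z : C) : C :=
  Cp.[z] - (r * (1 - p))%:C * NY.[z] * cint nu `]-oo, 0[ (fun y => U (z * y%:C)).

Lemma eq_transform_solution psi1 psi2 U1 U2 C1 C2 :
  psi2 =1 psi1 -> U2 =1 U1 -> C2 = C1 ->
  transform_solution psi1 U1 C1 -> transform_solution psi2 U2 C2.
Proof. by move=> /funext-> /funext-> ->. Qed.

Lemma transform_solution0 : transform_solution (fun=> 0) (fun=> 0) 0.
Proof.
split; first by rewrite size_poly0.
- by move=> s _; rewrite subrr !mulr0 horner0 addr0.
- by exists 0 => // s _; rewrite cabs0.
- by move=> s _ e e0; exists 1 => // z _; rewrite subrr cabs0.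
- by move=> z _; exact: cmeasurable_cst.
Qed.

Lemma transform_solutionD psi1 psi2 U1 U2 C1 C2 :
  transform_solution psi1 U1 C1 -> transform_solution psi2 U2 C2 ->
  transform_solution (fun s => psi1 s + psi2 s) (fun s => U1 s + U2 s) (C1 + C2).
Proof.
move=> [n1 e1 [K1 k1 b1] c1 m1] [n2 e2 [K2 k2 b2] c2 m2]; split.
- by apply: leq_trans (size_polyD _ _) _; rewrite geq_max n1.
- move=> s s0; rewrite hornerD opprD addrACA mulrDr e1// e2//; ring.
- exists (K1 + K2); first exact: addr_ge0.
  by move=> s s0; apply: le_trans (ler_cabsD _ _) _; rewrite lerD ?b1 ?b2.
- move=> s s0; apply/ccontinuous_atP; apply: continuousD;
    apply/ccontinuous_atP; [exact: c1|exact: c2].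
- by move=> z z0; apply: cmeasurableD; [exact: m1|exact: m2].
Qed.

Lemma transform_solutionZ c psi U Cp : transform_solution psi U Cp ->
  transform_solution (fun s => c * psi s) (fun s => c * U s) (c *: Cp).
Proof.
move=> [n1 e1 [K1 k1 b1] c1 m1]; split.
- exact: leq_trans (size_scale_leq _ _) n1.
- move=> s s0; rewrite hornerZ -mulrBr mulrCA e1//; ring.
- exists (cabs c * K1); first by rewrite mulr_ge0 ?cabs_ge0.
  by move=> s s0; rewrite cabsM ler_wpM2l ?cabs_ge0 ?b1.
- move=> s s0; apply/ccontinuous_atP; apply: continuousM; first exact: cst_continuous.
  by apply/ccontinuous_atP; exact: c1.
- by move=> z z0; apply: cmeasurableM; [exact: cmeasurable_cst|exact: m1].
Qed.

Lemma transform_solution_sum (I : Type) (rs : seq I) (c : I -> C)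
    (psi U : I -> C -> C) (Cp : I -> {poly C}) :
  (forall i, transform_solution (psi i) (U i) (Cp i)) ->
  transform_solution (fun s => \sum_(i <- rs) c i * psi i s)
    (fun s => \sum_(i <- rs) c i * U i s) (\sum_(i <- rs) c i *: Cp i).
Proof.
move=> h; elim: rs => [|i rs IH].
  by apply: eq_transform_solution transform_solution0 => [s|s|]; rewrite big_nil.
by apply: eq_transform_solution (transform_solutionD (transform_solutionZ (c i) (h i)) IH)
  => [s|s|]; rewrite big_cons.
Qed.

Lemma transform_solution_cintegrable psi U Cp z : transform_solution psi U Cp -> Re z < 0 ->
  cintegrable nu (`]-oo, 0[%classic : set R) (fun y => U (z * y%:C)).
Proof.
move=> [_ _ [K K0 bK] _ mU] z0; apply: (@cintegrable_bounded _ _ _ _ _ _ K) => //.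
  exact: mU.
by move=> y /=; rewrite in_itv /= => y0; apply: bK; rewrite ReMr mulr_le0// ltW.
Qed.

Lemma s_defectD psi1 psi2 U1 U2 C1 C2 z : Re z < 0 ->
  transform_solution psi1 U1 C1 -> transform_solution psi2 U2 C2 ->
  s_defect (fun s => U1 s + U2 s) (C1 + C2) z = s_defect U1 C1 z + s_defect U2 C2 z.
Proof.
move=> z0 /transform_solution_cintegrable-/(_ _ z0) i1.
move=> /transform_solution_cintegrable-/(_ _ z0) i2.
by rewrite /s_defect hornerD cintD//; ring.
Qed.

Lemma s_defectZ c psi U Cp z : Re z < 0 -> transform_solution psi U Cp ->
  s_defect (fun s => c * U s) (c *: Cp) z = c * s_defect U Cp z.
Proof.
move=> z0 /transform_solution_cintegrable-/(_ _ z0) i1.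
by rewrite /s_defect hornerZ cintZ//; ring.
Qed.

Lemma s_defect_sum (I : Type) (rs : seq I) (c : I -> C)
    (psi U : I -> C -> C) (Cp : I -> {poly C}) z : Re z < 0 ->
  (forall i, transform_solution (psi i) (U i) (Cp i)) ->
  s_defect (fun s => \sum_(i <- rs) c i * U i s) (\sum_(i <- rs) c i *: Cp i) z =
  \sum_(i <- rs) c i * s_defect (U i) (Cp i) z.
Proof.
move=> z0 h; elim: rs => [|i rs IH].
  rewrite !big_nil /s_defect horner0 (_ : (fun y => _) = fun=> 0) ?cint0 ?mulr0 ?subr0//.
  by apply/funext => y; rewrite big_nil.
rewrite !big_cons -IH -(s_defectZ _ z0 (h i)).
rewrite -(s_defectD z0 (transform_solutionZ (c i) (h i)) (transform_solution_sum rs c h)).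
by congr s_defect; apply/funext => s; rewrite big_cons.
Qed.

End TransformSolution.

(** * Integrating out one copy of A and one copy of B *)

Section OneStep.
Context {R : realType} d {T : measurableType d} (P : probability T R).
Local Notation C := R[i].

Lemma horner_compN (p : {poly C}) s : (p \Po (- 'X)).[s] = p.[- s].
Proof. by rewrite horner_comp hornerN hornerX. Qed.

Lemma size_compN (p : {poly C}) : size (p \Po (- 'X)) = size p.
Proof.
by rewrite size_comp_poly2// size_polyN size_polyX.
Qed.

Lemma coef_compN (p : {poly C}) k : (p \Po (- 'X))`_k = (-1) ^+ k * p`_k.
Proof.
have -> : p \Po (- 'X) = \poly_(i < size p) ((-1) ^+ i * p`_i).
  apply: poly_eq_horner => z; rewrite horner_compN horner_poly horner_coef.
  by apply: eq_bigr => i _; rewrite (exprNn z) mulrCA mulrA.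
by rewrite coef_poly; case: ltnP => // pk; rewrite nth_default// mulr0.
Qed.

Definition expected_poly (n : nat) (F : T -> {poly C}) : {poly C} :=
  \poly_(k < n) cint P setT (fun t => (F t)`_k).

Lemma horner_expected_poly n (F : T -> {poly C}) (K : R) s :
  (forall t, (size (F t) <= n)%N) -> (forall k, cmeasurable setT (fun t => (F t)`_k)) ->
  (forall t k, cabs (F t)`_k <= K) ->
  (expected_poly n F).[s] = cint P setT (fun t => (F t).[s]).
Proof.
move=> sF mF bF; rewrite horner_poly.
have iF k : cintegrable P setT (fun t => (F t)`_k).
  by apply: (@cintegrable_bounded _ _ _ _ _ _ K).
transitivity (cint P setT (fun t => \sum_(k < n) s ^+ k * (F t)`_k)).
  rewrite cint_sum//; last by move=> k; exact: cintegrableZ.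
  by apply: eq_bigr => k _; rewrite cintZ// mulrC.
apply: eq_cint => t _; rewrite (horner_coef_wide _ (sF t)).
by apply: eq_bigr => k _; rewrite mulrC.
Qed.

Lemma cabs_coef_expected_poly n (F : T -> {poly C}) (K : R) k : 0 <= K ->
  (forall k, cmeasurable setT (fun t => (F t)`_k)) ->
  (forall t k, cabs (F t)`_k <= K) -> cabs (expected_poly n F)`_k <= K.
Proof.
move=> K0 mF bF; rewrite coef_poly; case: ifP => _; last by rewrite cabs0.
by apply: cabs_cint_bounded.
Qed.

Lemma cintegrable_poly n (F : T -> {poly C}) (K : R) s :
  (forall t, (size (F t) <= n)%N) -> (forall k, cmeasurable setT (fun t => (F t)`_k)) ->
  (forall t k, cabs (F t)`_k <= K) ->
  cintegrable P setT (fun t => (F t).[s]).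
Proof.
move=> sF mF bF.
rewrite (_ : (fun t => _) = fun t => \sum_(k < n) s ^+ k * (F t)`_k); last first.
  by apply/funext => t; rewrite (horner_coef_wide _ (sF t)); apply: eq_bigr => k _; rewrite mulrC.
apply: cintegrable_sum => // k; apply: cintegrableZ => //.
exact: (@cintegrable_bounded _ _ _ _ _ _ K).
Qed.

Lemma cabs_coefM_le (f g : {poly C}) (K : R) k : (forall j, cabs g`_j <= K) ->
  cabs (f * g)`_k <= (\sum_(i < size f) cabs f`_i) * K.
Proof.
move=> gK; have K0 : 0 <= K by apply: le_trans (gK 0%N); exact: cabs_ge0.
rewrite -{1}[f]coefK poly_def mulr_suml coef_sum mulr_suml.
apply: le_trans (ler_cabs_sum _ _ _) _; apply: ler_sum => i _.
rewrite -scalerAl coefZ cabsM ler_wpM2l ?cabs_ge0// coefXnM.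
by case: ifP => _; rewrite ?cabs0.
Qed.

Section Reflection.
Variables (A : T -> R) (DA NA : {poly C}) (m : nat) (QA : R -> {poly C}).
Hypotheses (opA : overshoot_poly P A DA NA m QA) (mA : measurable_fun setT A).
Hypothesis (A0 : {ae P, forall t, 0 <= A t}).
Hypotheses (sDA : size DA = m.+1) (DA0 : DA.[0] != 0).

(** For x > 0 the first summand is D_A(-s) P(A > x), the mass sent to 0, and the second corrects the
    transform of x - A for the truncation at A <= x. For x <= 0 all the mass is at 0. *)
Definition reflection_poly (x : R) : {poly C} :=
  if 0 < x then ((QA x).[0] / DA.[0]) *: (DA \Po (- 'X)) - ((QA x) \Po (- 'X))
  else DA \Po (- 'X).

Lemma size_reflection_poly x : (size (reflection_poly x) <= m.+1)%N.
Proof.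
rewrite /reflection_poly; case: ifP => _; last by rewrite size_compN sDA.
apply: leq_trans (size_polyD _ _) _; rewrite geq_max size_polyN size_compN.
rewrite (leq_trans (op_size opA x))// andbT (leq_trans (size_scale_leq _ _))//.
by rewrite size_compN sDA.
Qed.

Lemma cint_reflection x s : 0 <= Re s ->
  DA.[- s] * cint P setT (fun t => cexp (- (s * (Num.max (x - A t) 0)%:C))) =
  (if 0 < x then cexp (- (s * x%:C)) * NA.[- s] else 0) + (reflection_poly x).[s].
Proof.
move=> s0; rewrite /reflection_poly.
have mmax : cmeasurable setT (fun t => cexp (- (s * (Num.max (x - A t) 0)%:C))).
  apply: cmeasurable_cexp; apply: cmeasurableN; apply: cmeasurableM.
    exact: cmeasurable_cst.
  apply: cmeasurable_real; apply: measurable_maxr => //.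
  exact: measurable_funB.
case: ltP => x0; last first.
  rewrite horner_compN add0r -[RHS]mulr1; congr (_ * _).
  rewrite -[RHS](cint_cst P); apply: ae_eq_cint => //.
  apply: filterS A0 => t At _; rewrite max_r ?mulr0 ?oppr0 ?cexp0//.
  by rewrite subr_le0 (le_trans x0).
have mle : cmeasurable setT (fun t => if A t <= x then
    cexp (- (s * (x - A t)%:C)) else 0).
  apply: cmeasurable_ifT; [exact: measurable_fun_ler| |exact: cmeasurable_cst].
  apply: cmeasurable_cexp; apply: cmeasurableN; apply: cmeasurableM.
    exact: cmeasurable_cst.
  by apply: cmeasurable_real; exact: measurable_funB.
have mgt : cmeasurable setT (fun t => if x < A t then
    cexp (- (0 * (A t - x)%:C)) else 0 : C).
  apply: cmeasurable_ifT; [exact: measurable_fun_ltr| |exact: cmeasurable_cst].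
  by under eq_fun do rewrite mul0r oppr0 cexp0; exact: cmeasurable_cst.
rewrite (_ : (fun t => _) = fun t =>
   (if A t <= x then cexp (- (s * (x - A t)%:C)) else 0) +
   (if x < A t then cexp (- (0 * (A t - x)%:C)) else 0)); last first.
  apply/funext => t; case: leP => xA; rewrite ?addr0 ?add0r.
    by rewrite max_l// subr_ge0.
  by rewrite mul0r max_r ?mulr0// subr_le0 ltW.
rewrite cintD//; last 2 first.
- apply: (@cintegrable_bounded _ _ _ _ _ _ 1) => // t _; case: ifP => xA; rewrite ?cabs0//.
  by apply: cabs_cexp_le1; rewrite ReN ReMr oppr_le0 mulr_ge0// subr_ge0.
- apply: (@cintegrable_bounded _ _ _ _ _ _ 1) => // t _; case: ifP => xA; rewrite ?cabs0//.
  by rewrite mul0r oppr0 cexp0 cabs1.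
rewrite mulrDr (op_le opA)//; last exact: ltW.
have z0 : 0 <= Re (0 : C) by [].
have := op_gt opA (ltW x0) z0 => e.
rewrite hornerD hornerN hornerZ !horner_compN -e.
by field.
Qed.

Lemma reflection_poly_bounded : exists2 K : R, 0 <= K &
  forall x k, cabs (reflection_poly x)`_k <= K.
Proof.
have [K bK] := op_bnd opA.
have K0 : 0 <= K by apply: le_trans (bK 0 0%N (lexx 0)); exact: cabs_ge0.
pose B := \sum_(i < size (DA \Po (- 'X))) cabs (DA \Po (- 'X))`_i.
have B0 : 0 <= B by apply: sumr_ge0 => i _; exact: cabs_ge0.
have coefN (p : {poly C}) k : cabs (p \Po (- 'X))`_k <= cabs p`_k.
  by rewrite coef_compN cabsM cabsX cabsN cabs1 expr1n mul1r.
exists (K / cabs DA.[0] * B + K + B).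
  by rewrite !addr_ge0// mulr_ge0// divr_ge0// cabs_ge0.
move=> x k; rewrite /reflection_poly; case: ltP => x0; last first.
  apply: le_trans (cabs_coef_le _ _) _; rewrite -/B lerDr addr_ge0//.
  by rewrite mulr_ge0// divr_ge0// cabs_ge0.
apply: (@le_trans _ _ (K / cabs DA.[0] * B + K)); last by rewrite lerDl.
rewrite coefB coefZ; apply: le_trans (ler_cabsB _ _) _; apply: lerD; last first.
  by apply: le_trans (coefN _ _) _; exact/bK/ltW.
rewrite !cabsM cabsV ler_pM ?mulr_ge0 ?invr_ge0 ?cabs_ge0 ?cabs_coef_le//.
rewrite ler_wpM2r ?invr_ge0 ?cabs_ge0//.
by rewrite horner_coef0; exact/bK/ltW.
Qed.

Lemma cmeasurable_reflection_poly k : cmeasurable setT (fun x => (reflection_poly x)`_k).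
Proof.
rewrite (_ : (fun x => _) = fun x => if 0 < x then
    (QA x)`_0%N / DA.[0] * (DA \Po (- 'X))`_k - (-1) ^+ k * (QA x)`_k
    else (DA \Po (- 'X))`_k); last first.
  apply/funext => x; rewrite /reflection_poly; case: ifP => // _.
  by rewrite coefB coefZ (coef_compN (QA x)) horner_coef0.
have mQ j := op_meas opA j.
apply: cmeasurable_ifT; [exact: measurable_fun_ltr| |exact: cmeasurable_cst].
apply: cmeasurableD.
  apply: cmeasurableM; last exact: cmeasurable_cst.
  by apply: cmeasurableM => //; exact: cmeasurable_cst.
by apply: cmeasurableN; apply: cmeasurableM => //; exact: cmeasurable_cst.
Qed.

End Reflection.

(** For x > 0 the sum is almost surely positive and the exponential factors; for x <= 0 the sum is
    the overshoot of [B] over the level -x. *)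
Lemma cint_shift (B : T -> R) (DB NB : {poly C}) l QB :
  overshoot_poly P B DB NB l QB -> measurable_fun setT B ->
  {ae P, forall t, 0 <= B t} ->
  (forall s, 0 <= Re s -> DB.[s] * LST P B s = NB.[s]) ->
  forall x s, 0 <= Re s ->
  DB.[s] * cint P setT (fun t => if 0 < x + B t then cexp (- (s * (x + B t)%:C)) else 0) =
  if 0 < x then cexp (- (s * x%:C)) * NB.[s] else (QB (- x)).[s].
Proof.
move=> opB mB B0 lB x s s0; case: ltP => x0; last first.
  have x0' : 0 <= - x by rewrite oppr_ge0.
  rewrite -(op_gt opB x0' s0); congr (_ * _); apply: eq_cint => t _.
  by rewrite -(subr_gt0 (- x)) !opprK (addrC (B t)).

rewrite -lB// mulrCA; congr (_ * _).
have mxB : cmeasurable setT (fun t => cexp (- (s * (x + B t)%:C))).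
  apply: cmeasurable_cexp; apply: cmeasurableN; apply: cmeasurableM.
    exact: cmeasurable_cst.
  by apply: cmeasurable_real; exact: measurable_funD.
have mBs : cmeasurable setT (fun t => cexp (- (s * (B t)%:C))).
  apply: cmeasurable_cexp; apply: cmeasurableN; apply: cmeasurableM.
    exact: cmeasurable_cst.
  exact: cmeasurable_real.
(* Discarding the null event B < 0 makes the integrand bounded everywhere. *)
pose g t := if 0 <= B t then cexp (- (s * (B t)%:C)) else 0.
have mg : cmeasurable setT g.
  by apply: cmeasurable_ifT => //; exact: measurable_fun_ler.
have ig : cintegrable P setT g.
  apply: (@cintegrable_bounded _ _ _ _ _ _ 1) => // t _; rewrite /g; case: ifP => xA; rewrite ?cabs0//.
  by apply: cabs_cexp_le1; rewrite ReN ReMr oppr_le0 mulr_ge0.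
have -> : LST P B s = cint P setT g.
  by apply: ae_eq_cint => //; apply: filterS B0 => t Bt _; rewrite /g Bt.
rewrite -cintZ//; apply: ae_eq_cint => //.
- by apply: cmeasurable_ifT => //; apply: measurable_fun_ltr => //; exact: measurable_funD.
- by apply: cmeasurableM => //; exact: cmeasurable_cst.
apply: filterS B0 => t Bt _; rewrite /g Bt ltr_pwDl// -cexpD; congr cexp.
by rewrite rmorphD; ring.
Qed.

End OneStep.

(** * Integrals against the law of V conditioned to be negative *)

Section ConditionalLaw.
Context {R : realType} d {T : measurableType d} (P : probability T R).
Local Notation C := R[i].

Lemma cint_indic (E : set T) (c : C) : measurable E ->
  cint P setT (fun t => if t \in E then c else 0) = c * (fine (P E))%:C.
Proof.
move=> mE; rewrite -cint_mkcond; apply: complex_eq; rewrite /cint [LHS]/=.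
  by rewrite ReMr Rintegral_cst.
by rewrite ImMr Rintegral_cst.
Qed.

(** Change of variables: on the negative half-line the law of [X] is [c] times [Q]. It serves with
    [c] equal to 1 - p and [Q] the law of V^-. *)
Lemma cint_negative_part (X : T -> R) (Q : probability R R) (c : R) (g : R -> C) (K : R) :
  measurable_fun setT X -> 0 <= c ->
  (forall E, measurable E -> P (X @^-1` E `&` [set t | X t < 0]) = (c%:E * Q E)%E) ->
  cmeasurable setT g -> (forall x, cabs (g x) <= K) ->
  cint P setT (fun t => if X t < 0 then g (X t) else 0) = c%:C * cint Q `]-oo, 0[ g.
Proof.
move=> mX c0 XQ mg gK.
pose X' : {mfun T >-> R} := MeasurableFun.Pack
  (MeasurableFun.Class (isMeasurableFun.Build _ _ _ _ _ mX)).
pose D : set R := `]-oo, 0[%classic.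
have mD : measurable D by exact: measurable_itv.
have H (h : R -> R) : measurable_fun setT h -> (forall x, `|h x| <= K) ->
    \int[P]_x (if X x < 0 then h (X x) else 0) = c * \int[Q]_(x in D) h x.
  move=> mh hK.
  have ihQ : Q.-integrable D (EFin \o h).
    apply: (le_integrable (g := cst K%:E) mD).
    - by apply/measurable_EFinP; exact: measurable_funTS.
    - by move=> x _; rewrite /= lee_fin (le_trans (hK _))// ler_norm.
    - exact: finite_measure_integrable_cst.
  have ih : P.-integrable (X' @^-1` D) ((EFin \o h) \o X').
    have mX'D : measurable (X' @^-1` D) by exact: measurable_preimage_fun.
    apply: (le_integrable (g := cst K%:E) mX'D).
    - by apply/measurable_EFinP; apply: measurable_funTS; exact: measurableT_comp.
    - by move=> x _; rewrite /= lee_fin (le_trans (hK _))// ler_norm.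
    - exact: finite_measure_integrable_cst.
  have hm : measurable_fun setT (EFin \o h) by exact/measurable_EFinP.
  have e := integral_pushforward mX hm ih mD.
  rewrite (_ : \int[P]_x _ = \int[P]_(x in X' @^-1` D) h (X x)); last first.
    rewrite [RHS]Rintegral_mkcond; apply: eq_Rintegral => t _.
    rewrite /patch; case: ifPn => Xt; first by rewrite ifT// inE /= /D /= in_itv.
    rewrite ifF//; apply/negbTE/negP; rewrite inE /= /D /= in_itv /= => h0.
    by rewrite h0 in Xt.
  rewrite /Rintegral -[X in fine X = _]e.
  rewrite [X in fine X = _](eq_measure_integral (mscale (NngNum c0) Q)); last first.
    move=> E mE ED.
    transitivity (P (X @^-1` E `&` [set t | X t < 0])); last exact: XQ.
    rewrite /= /pushforward; congr (P _).
    apply/seteqP; split => t /=; last by case.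
    by move=> Et; split => //; have := ED _ Et; rewrite /D /= in_itv.
  have mhD : measurable_fun D (EFin \o h) by exact: measurable_funTS.
  rewrite integralE !ge0_integral_mscale//; last 2 first.
  - exact: measurable_funeneg.
  - exact: measurable_funepos.
  rewrite -muleBr//; last first.
    by rewrite fin_num_adde_defl// fin_numN; exact: (integrable_neg_fin_num mD ihQ).
  by rewrite -integralE fineM//; exact: integrable_fin_num.
have [mr mi] := mg; apply: complex_eq.
  rewrite ReMl /= -H//; last by move=> x; apply: le_trans (gK x); exact: ler_Re_cabs.
  by apply: eq_Rintegral => t _; case: ifP.
rewrite ImMl /= -H//; last by move=> x; apply: le_trans (gK x); exact: ler_Im_cabs.
by apply: eq_Rintegral => t _; case: ifP.
Qed.

End ConditionalLaw.

(** * One step of the recursion *)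

Section Dynamics.
Context {R : realType} d {T : measurableType d} (P : probability T R).
Local Notation C := R[i].
Variables (V A B : nat -> {RV P >-> R}).
Hypotheses (Vid : identically_distributed V) (Aid : identically_distributed A)
  (Bid : identically_distributed B).
Hypothesis indep : mutually_independent (joint_family V A B).
Hypotheses (A_ge0 : {ae P, forall x, 0 <= A 0%N x})
  (B_ge0 : {ae P, forall x, 0 <= B 0%N x}).
Variables (a p : R).
Hypotheses (a_gt0 : 0 < a) (p_gt0 : 0 < p) (p_lt1 : p < 1).
Hypotheses (V_a : P [set x | V 0%N x = a] = p%:E)
  (V_neg : P [set x | V 0%N x < 0] = (1 - p)%:E).
Variable nu : probability R R.
Hypothesis nuE : forall E, measurable E ->
  P (V 0%N @^-1` E `&` [set t | V 0%N t < 0]) = ((1 - p)%:E * nu E)%E.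
Variables (DA NA DB NB : {poly C}) (m l : nat) (QA QB : R -> {poly C}).
Hypotheses (opA : overshoot_poly P (A 0%N) DA NA m QA)
  (opB : overshoot_poly P (B 0%N) DB NB l QB).
Hypotheses (sDA : size DA = m.+1) (sDB : size DB = l.+1) (sNA : (size NA <= m)%N).
Hypotheses (DA0 : DA.[0] != 0).
Hypotheses (lstA : forall s, 0 <= Re s -> DA.[s] * LST P (A 0%N) s = NA.[s])
  (lstB : forall s, 0 <= Re s -> DB.[s] * LST P (B 0%N) s = NB.[s]).

Let DY := DB * (DA \Po (- 'X)).
Let NY := NB * (NA \Po (- 'X)).

(** Indices of the innovations from time [n] on, those from which the state at time [n] is
    independent. *)
Definition later (n : nat) (i : nat + nat + nat) : bool :=
  match i with inl (inl k) => (n <= k)%N | inl (inr k) => (n <= k)%N | inr k => (n <= k)%N end.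

Lemma indep_fromW (I : eqType) (X : I -> {RV P >-> R}) (Y : T -> R) (S S' : pred I) :
  (forall i, S' i -> S i) -> indep_from X Y S -> indep_from X Y S'.
Proof.
move=> SS' [mY hY]; split=> // F J E mF uJ /allP J' mE.
by apply: hY => //; apply/allP => i /J' /SS'.
Qed.

Local Notation X := (joint_family V A B).

Definition lindley (W : T -> R) (n : nat) (t : T) : R :=
  Num.max (V n t * W t + B n t - A n t) 0.

Let later_V n : later n (inl (inl n) : nat + nat + nat). Proof. exact: leqnn. Qed.

Lemma indep_from_mulV W n : indep_from X W (later n) ->
  indep_from X (fun t => V n t * W t)
    (predI (later n) (predC1 (inl (inl n) : nat + nat + nat))).
Proof.
move=> iW.
have mpsi : measurable_fun setT (fun z : R * R => z.2 * z.1) by exact: measurable_funM.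
exact: (indep_from_step mpsi iW (later_V n)).
Qed.

Lemma indep_from_addB W n : indep_from X W (later n) ->
  indep_from X (fun t => V n t * W t + B n t)
    (predI (predI (later n) (predC1 (inl (inl n) : nat + nat + nat)))
       (predC1 (inr n : nat + nat + nat))).
Proof.
move=> iW.
have mpsi : measurable_fun setT (fun z : R * R => z.1 + z.2) by exact: measurable_funD.
apply: (indep_from_step mpsi (indep_from_mulV iW) (i := inr n)).
by rewrite /= leqnn.
Qed.

Lemma indep_from_lindley W n : indep_from X W (later n) ->
  indep_from X (lindley W n) (later n.+1).
Proof.
move=> iW.
have mpsi : measurable_fun setT (fun z : R * R => Num.max (z.1 - z.2) 0).
  by apply: measurable_maxr => //; exact: measurable_funB.
have := indep_from_step mpsi (indep_from_addB iW) (i := inl (inr n)).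
rewrite /= leqnn => /(_ isT); apply: indep_fromW.
by case=> [[k|k]|k] /= nk; rewrite (ltnW nk) /= ?andbT; apply/eqP => -[kn];
  rewrite kn ltnn in nk.
Qed.

Section Step.
Variables (W : T -> R) (n : nat).
Hypotheses (iW : indep_from X W (later n)) (W0 : forall t, 0 <= W t).

Let Z (s : C) : C := cint P setT (fun t => cexp (- (s * (W t)%:C))).
Let mW : measurable_fun setT W. Proof. by case: iW. Qed.
Let mV k : measurable_fun setT (V k). Proof. exact: measurable_funPT. Qed.

Let mexp d' (T' : measurableType d') (h : T' -> R) (s : C) : measurable_fun setT h ->
  cmeasurable setT (fun t => cexp (- (s * (h t)%:C))).
Proof.
move=> mh; apply: cmeasurable_cexp; apply: cmeasurableN; apply: cmeasurableM.
  exact: cmeasurable_cst.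
exact: cmeasurable_real.
Qed.

Let bexp (s : C) (x : R) : 0 <= Re s -> 0 <= x -> cabs (cexp (- (s * x%:C))) <= 1.
Proof. exact: cabs_cexp_line_le1. Qed.

Lemma law_V k E : measurable E -> P (V k @^-1` E) = P (V 0%N @^-1` E).
Proof. exact: Vid. Qed.

Lemma V_n_dichotomy : {ae P, forall t, V n t = a \/ V n t < 0}.
Proof.
have ma : measurable ([set a] : set R) by [].
have mneg : measurable (`]-oo, 0[%classic : set R) by [].
have e1 : V 0%N @^-1` [set a] = [set x | V 0%N x = a] by [].
have e2 : V 0%N @^-1` `]-oo, 0[%classic = [set x | V 0%N x < 0].
  by apply/seteqP; split => t /=; rewrite in_itv.
have h : P (V n @^-1` ([set a] `|` `]-oo, 0[%classic)) = 1%E.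
  rewrite law_V; last exact: measurableU.
  rewrite preimage_setU measureU; last 3 first.
  - exact: measurable_preimage_fun.
  - exact: measurable_preimage_fun.
  - apply/seteqP; split => t //= [->]; rewrite in_itv /= => a0.
    by have := lt_trans a_gt0 a0; rewrite ltxx.
  by rewrite e1 e2 [X in (X + _)%E]V_a [X in (_ + X)%E]V_neg -EFinD addrC subrK.
suff : P.-negligible (~` [set t | V n t = a \/ V n t < 0]) by [].
exists (~` (V n @^-1` ([set a] `|` `]-oo, 0[%classic))); split.
- apply: measurableC; apply: measurable_preimage_fun => //; exact: measurableU.
- rewrite probability_setC; last first.
    by apply: measurable_preimage_fun => //; exact: measurableU.
  by rewrite h subee.
- move=> t /= ht [Vt|Vt]; apply: ht; [by left|right].
  by move: Vt; rewrite /= in_itv.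
Qed.

(** [A n] is integrated out first, conditionally on [V n * W + B n], and its law may be taken at
    time 0. *)
Lemma step_A s : 0 <= Re s ->
  DA.[- s] * cint P setT (fun t => cexp (- (s * (lindley W n t)%:C))) =
  cint P setT (fun t =>
    (if 0 < V n t * W t + B n t
     then cexp (- (s * (V n t * W t + B n t)%:C)) * NA.[- s] else 0)
    + (reflection_poly DA QA (V n t * W t + B n t)).[s]).
Proof.
move=> s0.
pose f (z : R * R) := cexp (- (s * (Num.max (z.1 - z.2) 0)%:C)).
have mf : cmeasurable setT f.
  by apply: mexp; apply: measurable_maxr => //; exact: measurable_funB.
have bf z : cabs (f z) <= 1 by apply: bexp => //; rewrite le_max lexx orbT.
have Si : predI (predI (later n) (predC1 (inl (inl n) : nat + nat + nat)))
       (predC1 (inr n : nat + nat + nat)) (inl (inr n)) by rewrite /= leqnn.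
have e := cint_indep_from (indep_from_addB iW) Si mf bf.
have [mX2 _] := indep_from_addB iW.
rewrite [X in _ * X](_ : _ = cint P setT (fun t => cint P setT
    (fun t' => f (V n t * W t + B n t, A n t')))); last exact: e.
rewrite -cintZ//; last first.
  apply: (@cintegrable_bounded _ _ _ _ _ _ 1) => //.
    pose g (z : T * T) := f (V n z.1 * W z.1 + B n z.1, A n z.2).
    have mg : cmeasurable setT g.
      apply: (cmeasurable_comp mf); apply/measurable_fun_pair.
        exact: measurableT_comp mX2 _.
      exact: measurableT_comp (measurable_funPT (A n)) _.
    by apply: (cmeasurable_fubini P P mg (K := 1)) => z; exact: bf.
  move=> t _; apply: cabs_cint_bounded => //.
  by apply: (cmeasurable_comp mf); apply/measurable_fun_pair.
apply: eq_cint => t _.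
rewrite -(cint_reflection opA)//; congr (_ * _).
have mfx : cmeasurable setT (fun y : R => f (V n t * W t + B n t, y)).
  exact: (cmeasurable_comp mf (pair1_measurable _)).
exact: (cint_comp_eq_law (f := fun y => f (V n t * W t + B n t, y)) (K := 1) _ _ (Aid n)).
Qed.

Lemma step_B s : 0 <= Re s ->
  DB.[s] * cint P setT (fun t => if 0 < V n t * W t + B n t
     then cexp (- (s * (V n t * W t + B n t)%:C)) else 0) =
  cint P setT (fun t => if 0 < V n t * W t
    then cexp (- (s * (V n t * W t)%:C)) * NB.[s] else (QB (- (V n t * W t))).[s]).
Proof.
move=> s0.
pose f (z : R * R) : C := if 0 < z.1 + z.2 then cexp (- (s * (z.1 + z.2)%:C)) else 0.
have mf : cmeasurable setT f.
  apply: cmeasurable_ifT; last exact: cmeasurable_cst.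
    by apply: measurable_fun_ltr => //; exact: measurable_funD.
  by apply: mexp; exact: measurable_funD.
have bf z : cabs (f z) <= 1.
  by rewrite /f; case: ltP => z0; rewrite ?cabs0//; apply: bexp => //; exact: ltW.
have Si : predI (later n) (predC1 (inl (inl n) : nat + nat + nat)) (inr n).
  by rewrite /= leqnn.
have e := cint_indep_from (indep_from_mulV iW) Si mf bf.
have [mX1 _] := indep_from_mulV iW.
rewrite [X in _ * X](_ : _ = cint P setT (fun t => cint P setT
    (fun t' => f (V n t * W t, B n t')))); last exact: e.
rewrite -cintZ//; last first.
  apply: (@cintegrable_bounded _ _ _ _ _ _ 1) => //.
    pose g (z : T * T) := f (V n z.1 * W z.1, B n z.2).
    have mg : cmeasurable setT g.
      apply: (cmeasurable_comp mf); apply/measurable_fun_pair.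
        exact: measurableT_comp mX1 _.
      exact: measurableT_comp (measurable_funPT (B n)) _.
    by apply: (cmeasurable_fubini P P mg (K := 1)) => z; exact: bf.
  move=> t _; apply: cabs_cint_bounded => //.
  by apply: (cmeasurable_comp mf); apply/measurable_fun_pair.
apply: eq_cint => t _.
rewrite -(cint_shift opB)//; congr (_ * _).
have mfx : cmeasurable setT (fun y : R => f (V n t * W t, y)).
  exact: (cmeasurable_comp mf (pair1_measurable _)).
exact: (cint_comp_eq_law (f := fun y => f (V n t * W t, y)) (K := 1) _ _ (Bid n)).
Qed.

Definition negative_poly (t : T) : {poly C} :=
  if V n t < 0 then QB (- (V n t * W t)) else 0.

Lemma step_V_a s : 0 <= Re s ->
  cint P setT (fun t => if V n t == a then cexp (- (s * (a * W t)%:C)) else 0) =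
  p%:C * Z (a%:C * s).
Proof.
move=> s0.
(* The maximum changes nothing at the values of [W] and makes [f] bounded on the whole plane, as
   [cint_indep_from] demands. *)
pose f (z : R * R) : C := if z.2 == a then cexp (- (s * (a * Num.max z.1 0)%:C)) else 0.
have mf : cmeasurable setT f.
  apply: cmeasurable_ifT; last exact: cmeasurable_cst.
    exact: measurable_fun_eqr.
  by apply: mexp; apply: measurable_funM => //; exact: measurable_maxr.
have bf z : cabs (f z) <= 1.
  rewrite /f; case: ifP => z0; rewrite ?cabs0//; apply: bexp => //.
  by apply: mulr_ge0; [exact: ltW|rewrite le_max lexx orbT].
have e := cint_indep_from iW (later_V n) mf bf.
transitivity (cint P setT (fun t => f (W t, V n t))).
  by apply: eq_cint => t _; rewrite /f /= (max_l (W0 t)).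
rewrite [LHS]e.
transitivity (cint P setT (fun t => p%:C * cexp (- (a%:C * s * (W t)%:C)))).
  apply: eq_cint => t _.
  transitivity (cint P setT (fun t' => if t' \in V n @^-1` [set a]
      then cexp (- (a%:C * s * (W t)%:C)) else 0)).
    apply: eq_cint => t' _; rewrite /f /= (max_l (W0 t)).
    rewrite (_ : (t' \in V n @^-1` [set a]) = (V n t' == a)).
      by case: ifP => // _; congr cexp; rewrite rmorphM; ring.
    by apply/idP/eqP; rewrite inE.
  rewrite cint_indic; last exact: measurable_preimage_fun.
  by rewrite law_V// [X in fine X]V_a mulrC.
rewrite cintZ//.
apply: (@cintegrable_bounded _ _ _ _ _ _ 1) => //; first exact: mexp.
by move=> t _; apply: bexp => //; rewrite ReMl mulr_ge0// ltW.
Qed.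

(** With Re s <= 0 and V < 0 the exponent is bounded. Conditioning on V replaces [s] by s y with y <
    0, which is the origin of the rays in the equations at the s_j. *)
Lemma step_V_neg s : Re s <= 0 ->
  cint P setT (fun t => if V n t < 0 then cexp (- (s * (V n t * W t)%:C)) else 0) =
  (1 - p)%:C * cint nu `]-oo, 0[ (fun y => Z (s * y%:C)).
Proof.
move=> s0.
pose f (z : R * R) : C := cexp (- (s * (Num.min z.2 0 * Num.max z.1 0)%:C)).
have mf : cmeasurable setT f.
  by apply: mexp; apply: measurable_funM; [exact: measurable_minr|exact: measurable_maxr].
have bf z : cabs (f z) <= 1.
  apply: cabs_cexp_le1; rewrite ReN ReMr oppr_le0.
  apply: mulr_le0 => //; apply: mulr_le0_ge0.
    by rewrite ge_min lexx orbT.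
  by rewrite le_max lexx orbT.
pose f0 (z : R * R) : C := if z.2 < 0 then f z else 0.
have mf0 : cmeasurable setT f0.
  by apply: cmeasurable_ifT; [exact: measurable_fun_ltr| |exact: cmeasurable_cst].
have bf0 z : cabs (f0 z) <= 1 by rewrite /f0; case: ifP => _; rewrite ?cabs0.
have e := cint_indep_from iW (later_V n) mf0 bf0.
transitivity (cint P setT (fun t => f0 (W t, V n t))).
  apply: eq_cint => t _; rewrite /f0 /f /= (max_l (W0 t)); case: ifP => // Vt.
  by rewrite min_l// ltW.
rewrite [LHS]e.
pose g (z : T * T) := f0 (W z.1, V n z.2).
have mg : cmeasurable setT g.
  apply: (cmeasurable_comp mf0); apply/measurable_fun_pair.
    exact: measurableT_comp mW _.
  exact: measurableT_comp (mV n) _.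
rewrite [LHS](cint_fubini P P mg (K := 1)); last by move=> z; exact: bf0.
pose k (v : R) := cint P setT (fun t => f (W t, v)).
have mk : cmeasurable setT k.
  have mfW : cmeasurable setT (fun z : R * T => f (W z.2, z.1)).
    apply: (cmeasurable_comp mf); apply/measurable_fun_pair => //.
    exact: measurableT_comp mW _.
  by apply: (cmeasurable_fubini nu P mfW (K := 1)) => z; exact: bf.
have bk v : cabs (k v) <= 1.
  apply: cabs_cint_bounded => //; apply: (cmeasurable_comp mf).
  exact/measurable_fun_pair.
pose k0 (v : R) := if v < 0 then k v else 0.
have mk0 : cmeasurable setT k0.
  by apply: cmeasurable_ifT; [exact: measurable_fun_ltr| |exact: cmeasurable_cst].
have bk0 v : cabs (k0 v) <= 1 by rewrite /k0; case: ifP => _; rewrite ?cabs0.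
transitivity (cint P setT (k0 \o V n)).
  apply: eq_cint => t _; rewrite /k0 /g /f0 /=; case: ifP => // _.
  exact: cint0.
rewrite (cint_comp_eq_law (mV n) (mV 0%N) (Vid n) mk0 bk0).
have p10 : 0 <= 1 - p by rewrite subr_ge0 ltW.
rewrite [LHS](cint_negative_part (mV 0%N) p10 nuE mk bk); congr (_ * _).
apply: eq_cint => y; rewrite /= in_itv /= => y0; apply: eq_cint => t _.
by rewrite /f /= (max_l (W0 t)) (min_l (ltW y0)) rmorphM mulrA.
Qed.

End Step.

(** * A chain driven by the innovations from time [k0] on, and its generating function *)

Section Chain.
Variables (W : nat -> T -> R) (k0 : nat).
Hypotheses (iW0 : indep_from X (W 0%N) (later k0)) (W00 : forall t, 0 <= W 0%N t).
Hypothesis WS : forall n, W n.+1 = lindley (W n) (k0 + n).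

Lemma chain_ge0 n t : 0 <= W n t.
Proof. by case: n => [|n]; [exact: W00|rewrite WS le_max lexx orbT]. Qed.

Lemma chain_indep n : indep_from X (W n) (later (k0 + n)).
Proof.
elim: n => [|n IH]; first by rewrite addn0.
by rewrite WS addnS; exact: indep_from_lindley.
Qed.

Let Z (n : nat) (s : C) : C := cint P setT (fun t => cexp (- (s * (W n t)%:C))).
Let Y (n : nat) (t : T) : R := V (k0 + n) t * W n t.
Let mW n : measurable_fun setT (W n). Proof. by case: (chain_indep n). Qed.
Let mY n : measurable_fun setT (Y n).
Proof. by apply: measurable_funM => //; exact: measurable_funPT. Qed.
Let mYB n : measurable_fun setT (fun t => Y n t + B (k0 + n) t).
Proof. by apply: measurable_funD => //; exact: measurable_funPT. Qed.

Let FA n (t : T) := reflection_poly DA QA (Y n t + B (k0 + n) t).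
Let FB n (t : T) := negative_poly (W n) (k0 + n) t.

(** The reflection of A leaves the first expectation, which D_B then multiplies; the overshoot of B
    on V < 0 leaves the second, multiplied by the factor N_A(-s) already produced by A. *)
Definition chain_poly n : {poly C} :=
  DB * expected_poly P m.+1 (FA n) + (NA \Po (- 'X)) * expected_poly P l (FB n).

Lemma cabs_chain_transform n s : 0 <= Re s -> cabs (Z n s) <= 1.
Proof.
move=> s0; apply: cabs_cint_bounded => //.
  exact: (cmeasurable_comp (cmeasurable_cexp_line setT s) (mW n)).
by move=> t _; apply: cabs_cexp_line_le1 => //; exact: chain_ge0.
Qed.

Let sFA n t : (size (FA n t) <= m.+1)%N.
Proof. exact: size_reflection_poly opA sDA _. Qed.
Let mFA n k : cmeasurable setT (fun t => (FA n t)`_k).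
Proof. exact: (cmeasurable_comp (cmeasurable_reflection_poly opA k) (mYB n)). Qed.
Let sFB n t : (size (FB n t) <= l)%N.
Proof.
by rewrite /FB /negative_poly; case: ifP; rewrite ?size_poly0// (op_size opB).
Qed.
Let mFB n k : cmeasurable setT (fun t => (FB n t)`_k).
Proof.
rewrite (_ : (fun t => _) = fun t => if V (k0 + n) t < 0 then (QB (- Y n t))`_k else 0).
  apply: cmeasurable_ifT; last exact: cmeasurable_cst.
    by apply: measurable_fun_ltr => //; exact: measurable_funPT.
  by apply: (cmeasurable_comp (op_meas opB k)); exact: measurable_funN.
by apply/funext => t; rewrite /FB /negative_poly; case: ifP; rewrite ?coef0.
Qed.
Let bFB : exists2 K : R, 0 <= K & forall n t k, cabs (FB n t)`_k <= K.
Proof.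
have [K bK] := op_bnd opB.
have K0 : 0 <= K by apply: le_trans (bK 0 0%N (lexx 0)); exact: cabs_ge0.
exists K => // n t k; rewrite /FB /negative_poly; case: ltP => Vt.
  by apply: bK; rewrite oppr_ge0 mulr_le0_ge0 ?chain_ge0// ltW.
by rewrite coef0 cabs0.
Qed.

Lemma size_chain_poly n : (size (chain_poly n) <= (m + l).+1)%N.
Proof.
apply: leq_trans (size_polyD _ _) _; rewrite geq_max; apply/andP; split.
  apply: leq_trans (size_polyMleq _ _) _; rewrite sDB addSn /= addnC.
  by rewrite -addSn leq_add2r size_poly.
apply: leq_trans (size_polyMleq _ _) _; rewrite size_compN.
apply: leq_trans (leq_pred _) _; apply: leqW.
by rewrite leq_add// size_poly.
Qed.

(** The bound is uniform in [n], so that the series defining [chain_remainder] converges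
    coefficientwise. *)
Lemma chain_poly_bounded : exists2 K : R, 0 <= K &
  forall n k, cabs (chain_poly n)`_k <= K.
Proof.
have [KA KA0 bA] := reflection_poly_bounded opA.
have [KB KB0 bB] := bFB.
exists ((\sum_(i < size DB) cabs DB`_i) * KA +
  (\sum_(i < size (NA \Po (- 'X))) cabs (NA \Po (- 'X))`_i) * KB).
  by rewrite addr_ge0// mulr_ge0// sumr_ge0// => i _; exact: cabs_ge0.
move=> n k; rewrite coefD; apply: le_trans (ler_cabsD _ _) _; apply: lerD.
  apply: cabs_coefM_le => j; apply: (cabs_coef_expected_poly P _ (K := KA)) => // t i; exact: bA.
apply: cabs_coefM_le => j; apply: (cabs_coef_expected_poly P _ (K := KB)) => // t i; exact: bB.
Qed.

(** A is integrated out after multiplication by D_A(-s), then B after multiplication by D_B(s);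
    splitting on V, the event V = a gives the transform at a s and V < 0 a polynomial. *)
Lemma chain_step n s : 0 <= Re s ->
  DY.[s] * Z n.+1 s = p%:C * NY.[s] * Z n (a%:C * s) + (chain_poly n).[s].
Proof.
move=> s0.
have [KA KA0 bA] := reflection_poly_bounded opA.
have [KB KB0 bB] := bFB.
have mexp (h : T -> R) : measurable_fun setT h ->
    cmeasurable setT (fun t => cexp (- (s * (h t)%:C))).
  by move=> mh; exact: (cmeasurable_comp (cmeasurable_cexp_line setT s) mh).
have eA : cint P setT (fun t => (FA n t).[s]) = (expected_poly P m.+1 (FA n)).[s].
  by rewrite (horner_expected_poly P (K := KA)) // => t k; exact: bA.
have eB : cint P setT (fun t => (FB n t).[s]) = (expected_poly P l (FB n)).[s].
  by rewrite (horner_expected_poly P (K := KB)) // => t k; exact: bB.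
have iA : cintegrable P setT (fun t => (FA n t).[s]).
  by apply: (cintegrable_poly P (K := KA)) (mFA n) _ => // t k; exact: bA.
have iB : cintegrable P setT (fun t => (FB n t).[s]).
  by apply: (cintegrable_poly P (K := KB)) (mFB n) _ => // t k; exact: bB.
pose G2 t : C := if 0 < Y n t + B (k0 + n) t
  then cexp (- (s * (Y n t + B (k0 + n) t)%:C)) else 0.
have iG2 : cintegrable P setT G2.
  apply: (@cintegrable_bounded _ _ _ _ _ _ 1) => //.
    apply: cmeasurable_ifT; [exact: measurable_fun_ltr|exact: mexp|exact: cmeasurable_cst].
  move=> t _; rewrite /G2; case: ltP => t0; rewrite ?cabs0//.
  by apply: cabs_cexp_line_le1 => //; exact: ltW.
pose G1 t : C := if V (k0 + n) t == a then cexp (- (s * (a * W n t)%:C)) else 0.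
have mG1 : cmeasurable setT G1.
  apply: cmeasurable_ifT; last exact: cmeasurable_cst.
    by apply: measurable_fun_eqr => //; exact: measurable_funPT.
  by apply: mexp; exact: measurable_funM.
have iG1 : cintegrable P setT G1.
  apply: (@cintegrable_bounded _ _ _ _ _ _ 1) => // t _; rewrite /G1; case: ifP; rewrite ?cabs0// => _.
  by apply: cabs_cexp_line_le1 => //; rewrite mulr_ge0 ?chain_ge0// ltW.
have hA : DA.[- s] * Z n.+1 s = NA.[- s] * cint P setT G2 + (expected_poly P m.+1 (FA n)).[s].
  rewrite /Z WS (step_A (chain_indep n))// -eA -cintZ// -cintD//; last exact: cintegrableZ.
  by apply: eq_cint => t _; rewrite /G2 /FA /Y; case: ifP => _; rewrite ?mulr0// mulrC.
have hB : DB.[s] * cint P setT G2 = p%:C * NB.[s] * Z n (a%:C * s) +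
    (expected_poly P l (FB n)).[s].
  have -> : p%:C * NB.[s] * Z n (a%:C * s) = NB.[s] * cint P setT G1.
    by rewrite (step_V_a (chain_indep n) (chain_ge0 n))// mulrCA mulrA.
  rewrite -eB -(cintZ _ _ iG1)// -cintD//; last exact: cintegrableZ.
  rewrite /G2 (step_B (chain_indep n))//.
  have mQBY : cmeasurable setT (fun t => (QB (- Y n t)).[s]).
    rewrite (_ : (fun t => _) = fun t => \sum_(k < l) (QB (- Y n t))`_k * s ^+ k).
      apply: cmeasurable_sum => k _; apply: cmeasurableM; last exact: cmeasurable_cst.
      by apply: (cmeasurable_comp (op_meas opB k)); exact: measurable_funN.
    by apply/funext => t; rewrite (horner_coef_wide _ (op_size opB _)).
  apply: ae_eq_cint => //.
  - apply: cmeasurable_ifT; [|  |exact: mQBY].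
      by apply: measurable_fun_ltr => //; exact: (mY n).
    by apply: cmeasurableM; [exact: mexp (mY n)|exact: cmeasurable_cst].
  - apply: cmeasurableD; last exact: (cintegrable_measurable iB).
    by apply: cmeasurableM => //; exact: cmeasurable_cst.
  - apply: filterS (V_n_dichotomy (k0 + n)) => t Vt _.
    rewrite /G1 /FB /negative_poly; case: Vt => Vt.
      rewrite Vt eqxx (lt_gtF a_gt0) horner0 addr0 [RHS]mulrC; case: ltP => // aW.
      (* When V = a and the state is 0, the product is not positive and the overshoot branch
         applies; [op_0] shows that both branches agree there. *)
      have W0' : W n t = 0.
        by apply/eqP; rewrite eq_le chain_ge0 andbT -(pmulr_rle0 _ a_gt0).
      by rewrite W0' mulr0 oppr0 (op_0 opB) mulr0 oppr0 cexp0 mul1r.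
    rewrite Vt (lt_eqF (lt_trans Vt a_gt0)).
    rewrite mulr0 add0r ifF//; apply/negbTE; rewrite -leNgt.
    by rewrite mulr_le0_ge0 ?chain_ge0// ltW.
rewrite /DY /NY !hornerM !horner_compN /chain_poly hornerD !hornerM horner_compN.
by rewrite -[LHS]mulrA hA mulrDr mulrCA hB; ring.
Qed.

Let lst0 (U : T -> R) : LST P U 0 = 1.
Proof.
rewrite /LST (_ : (fun t => _) = fun=> 1) ?cint_cst//.
by apply/funext => t; rewrite mul0r oppr0 cexp0.
Qed.

Lemma DY0_NY0 : NY.[0] = DY.[0].
Proof.
rewrite /NY /DY !hornerM !horner_compN oppr0 -lstA// -lstB//.
by rewrite !lst0 !mulr1.
Qed.

(** At 0 every transform is 1 and [NY] and [DY] agree; the constant a_0 has its source here. *)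
Lemma chain_poly0 n : (chain_poly n).[0] = (1 - p)%:C * DY.[0].
Proof.
have z0 : 0 <= Re (0 : C) by [].
have := chain_step n z0; rewrite mulr0.
have Z1 k : Z k 0 = 1 by exact: lst0.
rewrite !Z1 !mulr1 DY0_NY0 => e.
by rewrite rmorphB rmorph1 mulrBl mul1r {1}e addrC addKr.
Qed.

(** At a zero of [DB] the reflection part drops out, and [op_root] turns the overshoot polynomial
    into N_B(z) times an exponential of V W. *)
Lemma chain_poly_root n z : Re z < 0 -> root DB z ->
  (chain_poly n).[z] =
  (1 - p)%:C * NY.[z] * cint nu `]-oo, 0[ (fun y => Z n (z * y%:C)).
Proof.
move=> z0 rz; have [KB KB0 bB] := bFB.
rewrite /chain_poly hornerD !hornerM (eqP rz) mul0r add0r.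
rewrite (horner_expected_poly P (K := KB))//.
transitivity ((NA \Po (- 'X)).[z] * (NB.[z] * cint P setT
    (fun t => if V (k0 + n) t < 0 then cexp (- (z * (V (k0 + n) t * W n t)%:C)) else 0))).
  congr (_ * _); rewrite -cintZ//; last first.
    apply: (@cintegrable_bounded _ _ _ _ _ _ 1) => //.
      apply: cmeasurable_ifT; last exact: cmeasurable_cst.
        by apply: measurable_fun_ltr => //; exact: measurable_funPT.
      exact: (cmeasurable_comp (cmeasurable_cexp_line setT z) (mY n)).
    move=> t _; case: ltP => Vt; rewrite ?cabs0//.
    apply: cabs_cexp_le1; rewrite ReN ReMr oppr_le0 mulr_le0 ?(ltW z0)//.
    by rewrite mulr_le0_ge0 ?chain_ge0// ltW.
  apply: eq_cint => t _; rewrite /FB /negative_poly; case: ltP => Vt.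
    rewrite (op_root opB)//; last by rewrite oppr_ge0 mulr_le0_ge0 ?chain_ge0// ltW.
    by rewrite rmorphN mulrN.
  by rewrite horner0 mulr0.
rewrite (step_V_neg (chain_indep n) (chain_ge0 n)) ?ltW// -/(Z n); ring.
Qed.

Variable r : R.
Hypotheses (r_gt0 : 0 < r) (r_lt1 : r < 1).

Let r0 : 0 <= r. Proof. exact: ltW. Qed.

Definition chain_transform (s : C) : C := csum (fun i => (r ^+ i)%:C * LST P (W i) s).

(** The power is [i.+1] because [chain_poly i] enters the equation for the state at time i + 1. *)
Definition chain_remainder : {poly C} :=
  \poly_(k < (m + l).+1) csum (fun i => (r ^+ i.+1)%:C * (chain_poly i)`_k).

Lemma has_csum_chain_transform s : 0 <= Re s ->
  has_csum (fun i => (r ^+ i)%:C * Z i s) (chain_transform s).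
Proof.
move=> s0; apply: geometric_bound_csum.
by apply: (@geometric_boundW _ _ 1) => // i; exact: cabs_chain_transform.
Qed.

Lemma has_csum_chain_remainder s :
  has_csum (fun i => (r ^+ i.+1)%:C * (chain_poly i).[s]) chain_remainder.[s].
Proof.
have [K K0 bK] := chain_poly_bounded.
rewrite horner_poly (_ : (fun i => _) = fun i => \sum_(k < (m + l).+1)
    s ^+ k * ((r ^+ i.+1)%:C * (chain_poly i)`_k)); last first.
  apply/funext => i; rewrite (horner_coef_wide _ (size_chain_poly i)) mulr_sumr.
  by apply: eq_bigr => k _; rewrite mulrA mulrC.
rewrite (eq_bigr (fun k : 'I_(m + l).+1 => s ^+ k *
    csum (fun i => (r ^+ i.+1)%:C * (chain_poly i)`_k))); last first.
  by move=> k _; rewrite mulrC.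
apply: has_csum_sum => k _; apply: has_csumZ; apply: geometric_bound_csum.
exists (r * K), r; split => // i.
rewrite cabsM cabs_real ger0_norm ?exprn_ge0// exprS -!mulrA ler_wpM2l//.
by rewrite [leRHS]mulrC ler_wpM2l ?exprn_ge0.
Qed.

(** [chain_step] at time i, multiplied by r^(i + 1) and summed over i. *)
Lemma chain_transform_eq s : 0 <= Re s ->
  DY.[s] * (chain_transform s - Z 0 s) =
  (r * p)%:C * NY.[s] * chain_transform (a%:C * s) + chain_remainder.[s].
Proof.
move=> s0; have as0 : 0 <= Re (a%:C * s) by rewrite ReMl mulr_ge0// ltW.
have h1 := (has_csum_shift _ _).1 (has_csum_chain_transform s0).
rewrite expr0 mul1r in h1.
have {}h1 := has_csumZ (c := DY.[s]) h1.
have h2 := has_csumD (has_csumZ (c := (r * p)%:C * NY.[s]) (has_csum_chain_transform as0))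
  (has_csum_chain_remainder (s := s)).
apply: has_csum_unique h1 _; move: h2; congr has_csum; apply/funext => i.
by rewrite [RHS]mulrCA chain_step// exprS !rmorphM /=; ring.
Qed.

Lemma cabs_chain_transform_le s : 0 <= Re s -> cabs (chain_transform s) <= (1 - r)^-1.
Proof.
move=> s0; rewrite -[leRHS]mul1r; apply: cabs_csum_le => // i.
rewrite cabsM cabs_real ger0_norm ?exprn_ge0// mulrC ler_wpM2r ?exprn_ge0//.
exact: cabs_chain_transform.
Qed.

Lemma chain_transform_cvg (z : nat -> C) s : (forall n, 0 <= Re (z n)) -> 0 <= Re s ->
  ccvg \oo z s -> ccvg \oo (fun n => chain_transform (z n)) (chain_transform s).
Proof.
move=> z0 s0 zs.
apply: (ccvg_csum (K := 1) r0 r_lt1) => //.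
- move=> n i; rewrite cabsM cabs_real ger0_norm ?exprn_ge0// mulrC.
  by rewrite ler_wpM2r ?exprn_ge0//; exact: cabs_chain_transform.
- move=> i; apply: ccvgM; first exact: ccvg_cst.
  apply: (@cint_dct_bounded _ _ _ _ _ _ _ 1) => //.
  + by move=> n; exact: (cmeasurable_comp (cmeasurable_cexp_line setT _) (mW i)).
  + move=> t _; apply: ccvg_cexp; apply: ccvgN; apply: ccvgM => //; exact: ccvg_cst.
  + by move=> n t _; apply: cabs_cexp_line_le1 => //; exact: chain_ge0.
Qed.

(** A failure of continuity would give a sequence converging to [s], contradicting dominated
    convergence; the radius is also kept below Re s so that the sequence stays in the right
    half-plane. *)
Lemma chain_transform_continuous s : 0 < Re s -> ccontinuous_at chain_transform s.
Proof.
move=> s0; apply: contrapT => /existsNP[e] /not_implyP[e0 he].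
have {}he (n : nat) : exists z, cabs (z - s) < Num.min (Re s) (n.+1%:R)^-1 /\
    e <= cabs (chain_transform z - chain_transform s).
  apply: contrapT => hn; apply: he; exists (Num.min (Re s) (n.+1%:R)^-1).
    by rewrite lt_min s0 invr_gt0 ltr0n.
  move=> z zs; rewrite ltNge; apply/negP => ez; apply: hn; by exists z.
have [z hz] := choice he.
have z0 n : 0 <= Re (z n).
  have [] := hz n; rewrite lt_min => /andP[h _] _.
  have := le_lt_trans (ler_Re_cabs _) h; rewrite ReD ReN ltr_norml => /andP[h1 _].
  by apply: ltW; lra.
have zs : ccvg \oo z s.
  apply/ccvg_distP => eps eps0; have /cvgrPdist_lt/(_ _ eps0) := @cvg_harmonic R.
  apply: filterS => n /=; rewrite sub0r normrN ger0_norm ?invr_ge0//.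
  by apply: lt_trans; have [] := hz n; rewrite lt_min => /andP[].
have := chain_transform_cvg z0 (ltW s0) zs => /ccvg_distP/(_ _ e0)[N _ /(_ N (leqnn N))] /=.
by have [_] := hz N; rewrite leNgt => /negP.
Qed.

Lemma cmeasurable_chain_ray i z : Re z < 0 ->
  cmeasurable (`]-oo, 0[%classic : set R) (fun y : R => Z i (z * y%:C)).
Proof.
move=> z0.
(* Clipping the ray parameter at 0 makes the integrand bounded for all reals, so that the Fubini
   lemma gives measurability. *)
pose f (u : R * T) := cexp (- (z * (Num.min u.1 0 * W i u.2)%:C)).
have mf : cmeasurable setT f.
  apply: (cmeasurable_comp (cmeasurable_cexp_line setT z)).
  apply: measurable_funM; first exact: measurable_minr.
  exact: measurableT_comp.
have bf u : cabs (f u) <= 1.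
  apply: cabs_cexp_le1; rewrite ReN ReMr oppr_le0 mulr_le0 ?(ltW z0)//.
  by apply: mulr_le0_ge0; [rewrite ge_min lexx orbT|exact: chain_ge0].
have [mr mi] := cmeasurableS (`]-oo, 0[%classic : set R) (cmeasurable_fubini nu P mf bf).
have E y : y \in (`]-oo, 0[%classic : set R) ->
    cint P setT (fun t => f (y, t)) = Z i (z * y%:C).
  rewrite inE /= in_itv /= => y0; apply: eq_cint => t _.
  by rewrite /f /= (min_l (ltW y0)) rmorphM mulrA.
split.
  by apply: eq_measurable_fun mr => y hy; rewrite E.
by apply: eq_measurable_fun mi => y hy; rewrite E.
Qed.

Lemma chain_transform_ray z : Re z < 0 ->
  cmeasurable (`]-oo, 0[%classic : set R) (fun y : R => chain_transform (z * y%:C)) /\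
  has_csum (fun i => (r ^+ i)%:C * cint nu `]-oo, 0[ (fun y => Z i (z * y%:C)))
    (cint nu `]-oo, 0[ (fun y => chain_transform (z * y%:C))).
Proof.
move=> z0.
have ray (y : R) : (`]-oo, 0[%classic : set R) y -> 0 <= Re (z * y%:C).
  by rewrite /= in_itv /= => y0; rewrite ReMr mulr_le0// ltW.
have mD : measurable (`]-oo, 0[%classic : set R) by exact: measurable_itv.
have mZ i : cmeasurable (`]-oo, 0[%classic : set R) (fun y : R => (r ^+ i)%:C * Z i (z * y%:C)).
  by apply: cmeasurableM; [exact: cmeasurable_cst|exact: cmeasurable_chain_ray].
have hU (y : R) : (`]-oo, 0[%classic : set R) y ->
    has_csum (fun i => (r ^+ i)%:C * Z i (z * y%:C)) (chain_transform (z * y%:C)).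
  by move=> /ray; exact: has_csum_chain_transform.
split.
  apply: (cmeasurable_cvg (u := fun n (y : R) =>
    \sum_(0 <= i < n) (r ^+ i)%:C * Z i (z * y%:C))).
    by move=> n; exact: cmeasurable_sum.
  by move=> y /hU/has_csumP.
have -> : (fun i => (r ^+ i)%:C * cint nu `]-oo, 0[ (fun y => Z i (z * y%:C))) =
   (fun i => cint nu `]-oo, 0[ (fun y => (r ^+ i)%:C * Z i (z * y%:C))).
  apply/funext => i; rewrite cintZ//.
  apply: (@cintegrable_bounded _ _ _ _ _ _ 1) => //; first exact: cmeasurable_chain_ray.
  by move=> y /ray; exact: cabs_chain_transform.
apply: (@cint_has_csum _ _ _ nu _ _ _ 1 r) => // i y /ray y0.
rewrite cabsM cabs_real ger0_norm ?exprn_ge0// mulrC ler_wpM2r ?exprn_ge0//.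
exact: cabs_chain_transform.
Qed.

Lemma chain_solution :
  transform_solution DY NY (m + l).+1 a p r (Z 0%N) chain_transform chain_remainder.
Proof.
split.
- exact: size_poly.
- exact: chain_transform_eq.
- exists (1 - r)^-1; first by rewrite invr_ge0 subr_ge0 ltW.
  exact: cabs_chain_transform_le.
- exact: chain_transform_continuous.
- by move=> z z0; have [] := chain_transform_ray z0.
Qed.

Lemma chain_s_defect z : Re z < 0 -> root DB z ->
  s_defect NY p r nu chain_transform chain_remainder z = 0.
Proof.
move=> z0 rz; apply/eqP; rewrite subr_eq0; apply/eqP.
apply: has_csum_unique (@has_csum_chain_remainder z) _.
have [_ h] := chain_transform_ray z0.
have := has_csumZ (c := (r * (1 - p))%:C * NY.[z]) h; congr has_csum.
by apply/funext => i; rewrite chain_poly_root// exprS !rmorphM; ring.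
Qed.

Lemma chain_remainder0 :
  chain_remainder.[0] = (r / (1 - r) * (1 - p))%:C * DY.[0].
Proof.
apply: has_csum_unique (@has_csum_chain_remainder 0) _.
under eq_fun do rewrite chain_poly0 mulrA.
have r1 : `|r| < 1 by rewrite ger0_norm.
have h := @cvg_geometric_series R r r r1.
have hr : has_csum (fun i => (r ^+ i.+1)%:C) (r / (1 - r))%:C.
  apply/has_csumP; rewrite (_ : (fun n => _) = fun n => (series (geometric r r) n)%:C).
    exact: (ccvg_real h).
  by apply/funext => n; rewrite /series /= rmorph_sum; apply: eq_bigr => i _; rewrite /geometric /= exprS.
have := has_csumZ (c := (1 - p)%:C * DY.[0]) hr; congr has_csum.
  by apply/funext => i; rewrite mulrC mulrA.
by rewrite rmorphM; ring.
Qed.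

End Chain.

(** * Solutions without source that separate the poles s_j *)

Section Dual.
Variable r : R.
Hypotheses (r_gt0 : 0 < r) (r_lt1 : r < 1).

(* Starting the recursion from [(B_0 - u)^+] instead of [w] makes the source term
   [D_Y(s) E e^{-s W_0}] a polynomial. *)
Fixpoint dual_chain (u : R) (n : nat) : T -> R :=
  if n is k.+1 then lindley (dual_chain u k) (1 + k)
  else fun t => Num.max (B 0%N t - u) 0.

Lemma dual_chain_indep u : indep_from X (dual_chain u 0) (later 1).
Proof.
apply: (@indep_fromW _ _ _ (predC1 (inr 0%N : nat + nat + nat))).
  by move=> [[k|k]|k] //=; case: k.
have mpsi : measurable_fun setT (fun b : R => Num.max (b - u) 0).
  by apply: measurable_maxr => //; exact: measurable_funB.
exact: (indep_from_comp1 indep (inr 0%N : nat + nat + nat) mpsi).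
Qed.

(** The coefficient of [DB] is the probability of B_0 <= u, the atom at 0 of (B_0 - u)^+. *)
Definition dual_start_poly (u : R) : {poly C} :=
  QB u + (1 - (QB u).[0] / DB.[0]) *: DB.

Hypothesis DB0 : DB.[0] != 0.

Lemma dual_start_transform u s : 0 <= u -> 0 <= Re s ->
  DB.[s] * cint P setT (fun t => cexp (- (s * (dual_chain u 0 t)%:C))) =
  (dual_start_poly u).[s].
Proof.
move=> u0 s0.
have mB : measurable_fun setT (B 0%N) by exact: measurable_funPT.
have i1 z : 0 <= Re z -> cintegrable P setT
    (fun t => if u < B 0%N t then cexp (- (z * (B 0%N t - u)%:C)) else 0).
  move=> z0; apply: (@cintegrable_bounded _ _ _ _ _ _ 1) => //.
    apply: cmeasurable_ifT; [exact: measurable_fun_ltr| |exact: cmeasurable_cst].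
    apply: (cmeasurable_comp (cmeasurable_cexp_line setT z)); exact: measurable_funB.
  move=> t _; case: ltP => ut; rewrite ?cabs0//.
  by apply: cabs_cexp_line_le1 => //; rewrite subr_ge0 ltW.
have i2 : cintegrable P setT (fun t => if u < B 0%N t then 0 else 1 : C).
  apply: (@cintegrable_bounded _ _ _ _ _ _ 1) => //.
    by apply: cmeasurable_ifT; [exact: measurable_fun_ltr|exact: cmeasurable_cst..].
  by move=> t _; case: ifP; rewrite ?cabs0 ?cabs1.
have z0 : 0 <= Re (0 : C) by [].
have e0 : cint P setT (fun t => if u < B 0%N t then 0 else 1 : C) =
    1 - (QB u).[0] / DB.[0].
  rewrite -(op_gt opB u0 z0) mulrAC divff// mul1r.
  apply: (@addrI _ (cint P setT
    (fun t => if u < B 0%N t then cexp (- (0 * (B 0%N t - u)%:C)) else 0))).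
  rewrite -cintD//; last exact: i1.
  rewrite addrC subrK (_ : (fun t => _) = fun=> 1) ?cint_cst//.
  by apply/funext => t; case: ifP; rewrite ?mul0r ?oppr0 ?cexp0 ?addr0 ?add0r.
rewrite /dual_start_poly hornerD hornerZ -e0 -(op_gt opB u0 s0) [X in _ + X]mulrC -mulrDr.
congr (_ * _); rewrite -cintD//; last exact: i1.
apply: eq_cint => t _ /=; case: ltP => ut.
  by rewrite addr0 max_l// subr_ge0 ltW.
by rewrite add0r max_r ?subr_le0// mulr0 oppr0 cexp0.
Qed.

Definition dual_transform u := chain_transform (dual_chain u) r.

Definition dual_remainder u : {poly C} :=
  chain_remainder (dual_chain u) 1 r + (DA \Po (- 'X)) * dual_start_poly u.

Let dual_chain_start_ge0 u t : 0 <= dual_chain u 0 t.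
Proof. by rewrite /= le_max lexx orbT. Qed.

Lemma dual_solution u : 0 <= u ->
  transform_solution DY NY (m + l).+1 a p r (fun=> 0) (dual_transform u) (dual_remainder u).
Proof.
move=> u0.
have [h1 h2 h3 h4 h5] := chain_solution (dual_chain_indep u) (dual_chain_start_ge0 u)
  (fun n => erefl) r_gt0 r_lt1.
split => //.
- apply: leq_trans (size_polyD _ _) _; rewrite geq_max h1/=.
  apply: leq_trans (size_polyMleq _ _) _; rewrite size_compN sDA addSn /= -addnS leq_add2l.
  apply: leq_trans (size_polyD _ _) _; rewrite geq_max (leq_trans (op_size opB u))//=.
  by apply: leq_trans (size_scale_leq _ _) _; rewrite sDB.
- move=> s s0; rewrite /dual_remainder hornerD addrA -h2//.
  have -> : ((DA \Po (- 'X)) * dual_start_poly u).[s] =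
      DY.[s] * cint P setT (fun t => cexp (- (s * (dual_chain u 0 t)%:C))).
    by rewrite hornerM -dual_start_transform// /DY hornerM mulrCA mulrA.
  by rewrite -mulrDr subrK subr0.
Qed.

Lemma dual_remainder0 u : 0 <= u ->
  (dual_remainder u).[0] = (r / (1 - r) * (1 - p) + 1)%:C * DY.[0].
Proof.
move=> u0; rewrite /dual_remainder hornerD.
rewrite (chain_remainder0 (dual_chain_indep u) (dual_chain_start_ge0 u) (fun n => erefl) r_gt0 r_lt1).
have -> : ((DA \Po (- 'X)) * dual_start_poly u).[0] = DY.[0].
  rewrite hornerM /dual_start_poly [in LHS]hornerD hornerZ mulrBl mul1r divfK//.
  by rewrite addrCA subrr addr0 /DY hornerM mulrC.
by rewrite rmorphD rmorph1 mulrDl mul1r.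
Qed.

(** The chain itself has no defect, so only the start polynomial contributes, and at a zero of [DB]
    it is N_B(z) e^(zu). *)
Lemma dual_s_defect u z : 0 <= u -> Re z < 0 -> root DB z ->
  s_defect NY p r nu (dual_transform u) (dual_remainder u) z =
  DA.[- z] * NB.[z] * cexp (z * u%:C).
Proof.
move=> u0 z0 rz.
have := chain_s_defect (dual_chain_indep u) (dual_chain_start_ge0 u) (fun n => erefl)
  r_gt0 r_lt1 z0 rz.
rewrite /s_defect /dual_remainder hornerD addrAC => ->.
rewrite add0r hornerM horner_compN /dual_start_poly hornerD hornerZ (eqP rz) mulr0 addr0.
by rewrite (op_root opB u0 rz) mulrA.
Qed.

Variable s_ : 'I_l -> C.
Hypotheses (s_neg : forall j, Re (s_ j) < 0) (s_inj : injective s_).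
Hypotheses (s_root : forall j, root DB (s_ j)).
Hypotheses (NBs : forall j, NB.[s_ j] != 0) (DAs : forall j, DA.[- s_ j] != 0).

(** Put x_i = e^(s_i tau). At level u = q tau the defect at s_i is D_A(-s_i) N_B(s_i) x_i^q, while
    the remainder at 0 does not depend on u. Weighting the levels by the coefficients of a
    polynomial f thus gives a defect proportional to f(x_i) and a value at 0 proportional to f(1);
    Lagrange polynomials with an additional zero at 1 achieve the claim. *)
Lemma dual_basis : exists (v : 'I_l -> C -> C) (D : 'I_l -> {poly C}),
  [/\ forall j, transform_solution DY NY (m + l).+1 a p r (fun=> 0) (v j) (D j),
      forall j, (D j).[0] = 0 &
      forall i j, s_defect NY p r nu (v j) (D j) (s_ i) = (i == j)%:R].
Proof.
pose M : R := \sum_j `|Im (s_ j)|.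
have M0 : 0 <= M by apply: sumr_ge0.
(* With this scale the imaginary part of (s_i - s_j) tau is below 2 in absolute value, hence in the
   range where e^z = 1 forces z = 0; this keeps the x_i distinct. *)
pose tau : R := (1 + M)^-1.
have t0 : 0 < tau by rewrite invr_gt0 ltr_pwDl.
pose x j := cexp (s_ j * tau%:C).
have cexp1 (z : C) : `|Im z| < 2 -> cexp z = 1 -> z = 0.
  move=> zI z1; have z0 : Re z = 0.
    apply: expR_inj; rewrite expR0 -cabs_cexp z1 cabs1//.
  apply: complex_eq => //.
  have : cos `|Im z| = 1.
    have c1 : expR (Re z) * cos (Im z) = 1 by rewrite -Re_cexp z1.
    rewrite z0 expR0 mul1r in c1.
    by case: (ger0P (Im z)) => _; rewrite ?cosN c1.
  rewrite -cos0 => /cos_inj h; apply/eqP; rewrite -normr_eq0; apply/eqP; apply: h.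
    by rewrite in_itv /= normr_ge0 (le_trans (ltW zI))// pi_ge2.
  by rewrite in_itv /= lexx pi_ge0.
have IM j : `|Im (s_ j)| <= M by rewrite /M (bigD1 j)//= lerDl sumr_ge0.
have x1 j : x j != 1.
  apply/eqP => /(congr1 cabs); rewrite cabs_cexp cabs1 ReMr -expR0 => /expR_inj/eqP.
  by rewrite mulf_eq0 (gt_eqF t0) (lt_eqF (s_neg j)).
have xinj : injective x.
  move=> i j xij; apply: s_inj; apply/eqP; rewrite -subr_eq0.
  have : cexp ((s_ i - s_ j) * tau%:C) = 1.
    rewrite mulrBl cexpD cexpN -/(x i) xij divff// cexp_neq0//.
  move=> /cexp1-/(_ _)/eqP; rewrite mulf_eq0 => h.
  have tc : (tau%:C == 0 :> C) = false by rewrite fmorph_eq0 gt_eqF.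
  move: h; rewrite tc orbF; apply.
  rewrite ImMr normrM (gtr0_norm t0) ltr_pdivrMr ?ltr_pwDl// ImD ImN.
  apply: le_lt_trans (ler_normB _ _) _.
  apply: le_lt_trans (lerD (IM i) (IM j)) _.
  by lra.
(* The factor X - 1 kills the value at 0. It is compatible with the other nodes, since Re s_j < 0
   gives x_j != 1. *)
pose f j : {poly C} := ('X - 1%:P) * \prod_(i < l | i != j) ('X - (x i)%:P).
have sf j : (size (f j) <= l.+1)%N.
  apply: leq_trans (size_polyMleq _ _) _; rewrite size_XsubC add2n /= ltnS.
  rewrite -big_filter size_prod_XsubC size_filter.
  have := count_predC (pred1 j) (index_enum 'I_l).
  rewrite count_uniq_mem ?index_enum_uniq// mem_index_enum add1n => ->.
  by rewrite -[index_enum _]enumT size_enum_ord.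
have f1 j : (f j).[1] = 0 by rewrite hornerM hornerXsubC subrr mul0r.
have fij i j : i != j -> (f j).[x i] = 0.
  by move=> ij; rewrite hornerM (bigD1 i)//= !hornerM !hornerXsubC subrr mul0r mulr0.
have fii i : (f i).[x i] != 0.
  rewrite hornerM hornerXsubC mulf_neq0 ?subr_eq0// horner_prod prodf_seq_neq0.
  apply/allP => j _; apply/implyP => ji; rewrite hornerXsubC subr_eq0.
  by apply: contraNneq ji => /xinj->.
pose k j := ((f j).[x j] * (DA.[- s_ j] * NB.[s_ j]))^-1.
pose u (q : 'I_l.+1) := tau *+ q.
have u0 q : 0 <= u q by rewrite /u mulrn_wge0// ltW.
have hsol q := dual_solution (u0 q).
exists (fun j s => \sum_(q < l.+1) (k j * (f j)`_q) * dual_transform (u q) s),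
  (fun j => \sum_(q < l.+1) (k j * (f j)`_q) *: dual_remainder (u q)).
split.
- move=> j; apply: eq_transform_solution (transform_solution_sum _ _ hsol) => // s.
  by rewrite big1// => q _; rewrite mulr0.
- move=> j; rewrite horner_sum.
  rewrite (eq_bigr (fun q : 'I_l.+1 => (k j * ((r / (1 - r) * (1 - p) + 1)%:C * DY.[0])) *
      ((f j)`_q * 1 ^+ q))); last first.
    by move=> q _; rewrite hornerZ dual_remainder0// expr1n; ring.
  by rewrite -mulr_sumr -horner_coef_wide// f1 mulr0.
- move=> i j; rewrite (s_defect_sum nu _ _ (s_neg i) hsol).
  rewrite (eq_bigr (fun q : 'I_l.+1 => (k j * (DA.[- s_ i] * NB.[s_ i])) *
      ((f j)`_q * x i ^+ q))); last first.
    move=> q _; rewrite dual_s_defect//.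
    have -> : cexp (s_ i * (u q)%:C) = x i ^+ q by rewrite /x -cexpMn /u rmorphMn mulrnAr.
    by ring.
  rewrite -mulr_sumr -horner_coef_wide//; have [->|ij] := eqVneq i j.
    by rewrite /k -mulrA [_ * (f j).[_]]mulrC mulVf// !mulf_neq0.
  by rewrite fij// mulr0.
Qed.

End Dual.

Lemma reflected_solution (w r : R) : 0 <= w -> 0 < r -> r < 1 -> exists Cp : {poly C},
  [/\ transform_solution DY NY (m + l).+1 a p r (fun s => cexp (- (s * w%:C)))
        (U_W P V A B w r) Cp,
      forall z, Re z < 0 -> root DB z -> s_defect NY p r nu (U_W P V A B w r) Cp z = 0 &
      Cp.[0] = (r / (1 - r) * (1 - p))%:C * DY.[0]].
Proof.
move=> w0 r0 r1; pose W : nat -> T -> R := reflected V A B w.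
have iW : indep_from X (W 0%N) (later 0) by exact: indep_from_cst.
have W0 t : 0 <= W 0%N t by [].
have WS n : W n.+1 = lindley (W n) (0 + n) by [].
exists (chain_remainder W 0 r); split.
- apply: eq_transform_solution (chain_solution iW W0 WS r0 r1) => // s.
  exact: esym (cint_cst P (cexp (- (s * w%:C)))).
- by move=> z z0 rz; exact: (chain_s_defect iW W0 WS r0 r1 z0 rz).
- exact: (chain_remainder0 iW W0 WS r0 r1).
Qed.
End Dynamics.

(** * Counting zeros in the right half-plane by continuation *)

Section RootCount.
Context {R : realType}.
Local Notation C := R[i].

Definition poly_of_roots (rs : seq C) : {poly C} := \prod_(z <- rs) ('X - z%:P).

Lemma poly_of_roots_cons z rs : poly_of_roots (z :: rs) = ('X - z%:P) * poly_of_roots rs.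
Proof. by rewrite /poly_of_roots big_cons. Qed.

Lemma size_poly_of_roots rs : size (poly_of_roots rs) = (size rs).+1.
Proof. exact: size_prod_XsubC. Qed.

(** The value at [z] of a monic polynomial is the product of the distances to its roots, hence at
    least the power of the smallest one. *)
Lemma nearest_root (z : C) rs : (0 < size rs)%N ->
  exists2 y, y \in rs & cabs (z - y) ^+ size rs <= cabs (poly_of_roots rs).[z].
Proof.
elim: rs => [//|x [|x' rs] IH _].
  exists x; first exact: mem_head.
  by rewrite expr1 /poly_of_roots big_seq1 hornerXsubC.
have [//|y yrs hy] := IH _.
rewrite poly_of_roots_cons hornerM cabsM hornerXsubC.
have [xy|xy] := leP (cabs (z - x)) (cabs (z - y)).
  exists x; rewrite ?mem_head//.
  rewrite -[size (x :: _)]/((size (x' :: rs)).+1) exprS ler_wpM2l ?cabs_ge0// (le_trans _ hy)//.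
  by rewrite lerXn2r// nnegrE cabs_ge0.
exists y; first by rewrite inE yrs orbT.
rewrite -[size (x :: _)]/((size (x' :: rs)).+1) exprS.
by apply: ler_pM; rewrite ?exprn_ge0 ?cabs_ge0// ltW.
Qed.

Lemma coef_XsubC_mul (z : C) (q : {poly C}) j : q`_j = (('X - z%:P) * q)`_j.+1 + z * q`_j.+1.
Proof. by rewrite mulrBl coefB coefXM mul_polyC coefZ /= subrK. Qed.

(* Continuity of the roots, by deflation: the root of the perturbed polynomial
   nearest to a root of the limit converges to it, and dividing both
   polynomials by their factors keeps the coefficients convergent. *)
Lemma count_roots_near T (F : set_system T) {FF : Filter F} (rs_ : T -> seq C) (rs : seq C) :
  (forall t, size (rs_ t) = size rs) ->
  (forall j, ccvg F (fun t => (poly_of_roots (rs_ t))`_j) (poly_of_roots rs)`_j) ->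
  (forall z, z \in rs -> Re z != 0) ->
  \forall t \near F, count (fun z : C => 0 < Re z) (rs_ t) = count (fun z : C => 0 < Re z) rs.
Proof.
elim: rs rs_ => [|z rs IH] rs_ srs crs nrs.
  by apply: nearW => t; have /size0nil -> := srs t.
have h t : exists y, y \in rs_ t /\
    cabs (z - y) ^+ (size rs).+1 <= cabs (poly_of_roots (rs_ t)).[z].
  have [|y y1 y2] := @nearest_root z (rs_ t); first by rewrite srs.
  by exists y; split => //; move: y2; rewrite srs.
have [y hy] := choice h.
have szp t : size (poly_of_roots (rs_ t)) = (size rs).+2.
  by rewrite size_poly_of_roots srs.
have cz : ccvg F (fun t => (poly_of_roots (rs_ t)).[z]) 0.
  rewrite (_ : 0 = (poly_of_roots (z :: rs)).[z]); last first.
    by rewrite poly_of_roots_cons hornerM hornerXsubC subrr mul0r.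
  rewrite (_ : (fun t => _) = fun t => \sum_(j < (size rs).+2) (poly_of_roots (rs_ t))`_j * z ^+ j).
    rewrite horner_coef size_poly_of_roots; apply: ccvg_sum => j _.
    by apply: ccvgM; [exact: crs|exact: ccvg_cst].
  by apply/funext => t; rewrite horner_coef szp.
have yz : ccvg F y z.
  apply/ccvg_distP => e e0; move/ccvg_distP : cz => /(_ _ (exprn_gt0 (size rs).+1 e0)).
  apply: filterS => t; rewrite subr0 => ht; rewrite cabs_distC.
  have := le_lt_trans (hy t).2 ht.
  by rewrite ltr_pXn2r ?nnegrE ?cabs_ge0 ?(ltW e0).
pose rs' t := rem (y t) (rs_ t).
have pr t : perm_eq (rs_ t) (y t :: rs' t) by exact: perm_to_rem (hy t).1.
have pE t : poly_of_roots (rs_ t) = ('X - (y t)%:P) * poly_of_roots (rs' t).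
  by rewrite -poly_of_roots_cons /poly_of_roots (perm_big _ (pr t)).
have srs' t : size (rs' t) = size rs.
  by apply: succn_inj; rewrite -[RHS](srs t) (perm_size (pr t)).
(* The coefficients of the deflated polynomial are recovered from the top down by q_j = p_(j+1) + y
   q_(j+1); [k] measures how far [j] is below the vanishing coefficients. *)
have cq k j : (size rs < j + k)%N ->
    ccvg F (fun t => (poly_of_roots (rs' t))`_j) (poly_of_roots rs)`_j.
  elim: k j => [|k IHk] j jk.
    rewrite addn0 in jk; rewrite nth_default ?size_poly_of_roots//.
    rewrite (_ : (fun t => _) = fun=> 0); first exact: ccvg_cst.
    by apply/funext => t; rewrite nth_default// size_poly_of_roots srs'.
  rewrite (coef_XsubC_mul z) -poly_of_roots_cons.
  rewrite (_ : (fun t => _) = fun t =>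
    (poly_of_roots (rs_ t))`_j.+1 + y t * (poly_of_roots (rs' t))`_j.+1); last first.
    by apply/funext => t; rewrite pE -coef_XsubC_mul.
  apply: ccvgD; first exact: crs.
  by apply: ccvgM => //; apply: IHk; rewrite addSnnS.
have := IH rs' srs' (fun j => cq (size rs).+1 j (leq_addl _ _)) _.
have nrs' x : x \in rs -> Re x != 0 by move=> xrs; apply: nrs; rewrite inE xrs orbT.
move=> /(_ nrs') IHn.
have nz : Re z != 0 by apply: nrs; rewrite mem_head.
have nzp : 0 < `|Re z| by rewrite normr_gt0.
move/ccvg_distP : yz => /(_ _ nzp) yz.
near=> t.
rewrite (permP (pr t)) /=; congr (nat_of_bool _ + _)%N; last by near: t.
have : cabs (y t - z) < `|Re z| by near: t.
move=> /(le_lt_trans (ler_Re_cabs _)); rewrite ReD ReN ltr_norml.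
case: (ltrgt0P (Re z)) nz => // z0 _; rewrite ?(gtr0_norm z0) ?(ltr0_norm z0) => /andP[h1 h2].
  by apply/idP; lra.
by apply/negbTE; rewrite -leNgt; lra.
Unshelve. all: by end_near. Qed.

(* No root of [D - x N] crosses the imaginary axis for [0 <= x <= c], so the number of
   roots in the right half-plane does not change. *)
Lemma rhp_zeros_perturb (D N : {poly C}) (k : C) (rs : seq C) (c : R) :
  k != 0 -> D = k *: poly_of_roots rs -> (size N <= size rs)%N ->
  (forall z, z \in rs -> Re z != 0) ->
  (forall s, Re s = 0 -> cabs N.[s] <= cabs D.[s]) -> 0 <= c -> c < 1 ->
  exists delta : 'I_(count (fun z : C => 0 < Re z) rs) -> C,
    rhp_zeros (D - c%:C *: N) delta.
Proof.
move=> k0 DE sN nrs ND c0 c1.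
have sD : size D = (size rs).+1 by rewrite DE size_scale// size_poly_of_roots.
pose q (x : R) := D - x%:C *: N.
have sq x : (size (x%:C *: N) < size D)%N.
  by rewrite sD ltnS; exact: leq_trans (size_scale_leq _ _) sN.
have lq x : lead_coef (q x) = k.
  rewrite /q lead_coefDl ?size_polyN ?sq// DE lead_coefZ.
  by rewrite (monicP (monic_prod_XsubC _ _ _)) mulr1.
have hq x : {r : seq C | q x = k *: poly_of_roots r}.
  by have [r ->] := closed_field_poly_normal (q x); exists r; rewrite lq.
pose r x := sval (hq x).
have rE x : q x = k *: poly_of_roots (r x) by rewrite /r; case: (hq x).
have szr x : size (r x) = size rs.
  apply: succn_inj; rewrite -size_poly_of_roots -(size_scale _ k0) -rE.
  by rewrite /q size_polyDl ?size_polyN ?sq.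
(* A zero on the axis would give |D| = x |N| with x < 1 and |N| <= |D|, so both vanish there; but no
   root of [D] lies on the axis. *)
have axis x y : 0 <= x -> x <= c -> y \in r x -> Re y != 0.
  move=> x0 xc yr; apply/eqP => y0.
  have : (q x).[y] = 0.
    by rewrite rE hornerZ /poly_of_roots (big_rem y)//= hornerM hornerXsubC subrr mul0r mulr0.
  rewrite /q hornerD hornerN hornerZ => /eqP; rewrite subr_eq0 => /eqP e.
  have := ND y y0; rewrite e cabsM cabs_real ger0_norm// => h.
  have Ny : N.[y] = 0.
    apply/eqP; rewrite -cabs_eq0 eq_le cabs_ge0 andbT leNgt; apply/negP => Ny.
    have : cabs N.[y] < cabs N.[y]; last by rewrite ltxx.
    by apply: le_lt_trans h _; rewrite gtr_pMl// (le_lt_trans xc).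
  have D0 : D.[y] = 0 by rewrite e Ny mulr0.
  have : y \in rs.
    rewrite -root_prod_XsubC; move/eqP : D0; rewrite DE hornerZ mulf_eq0 (negbTE k0).
    by [].
  by move=> /nrs; rewrite y0 eqxx.
pose cnt x := count (fun z : C => 0 < Re z) (r x).
have cnt_near x0 : 0 <= x0 -> x0 <= c -> \forall x \near x0, cnt x = cnt x0.
  move=> h0 hc; apply: (count_roots_near (F := nbhs x0)).
  - by move=> x; rewrite !szr.
  - move=> j.
    have E x : (poly_of_roots (r x))`_j = k^-1 * (D`_j - x%:C * N`_j).
      have := congr1 (fun f : {poly C} => f`_j) (rE x).
      by rewrite /q coefB !coefZ => ->; rewrite mulrA mulVf// mul1r.
    rewrite (_ : (fun x => _) = fun x => k^-1 * (D`_j - x%:C * N`_j)); last exact/funext.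
    rewrite E; apply: ccvgM; first exact: ccvg_cst.
    apply: ccvgD; first exact: ccvg_cst.
    apply: ccvgN; apply: ccvgM; last exact: ccvg_cst.
    by apply: ccvg_real; exact: cvg_id.
  - by move=> z; exact: axis.
have cntc : cnt c = count (fun z : C => 0 < Re z) rs.
  have cnt0 : cnt 0 = count (fun z : C => 0 < Re z) rs.
    have /permP : perm_eq (r 0) rs; last exact.
    apply: prod_XsubC_eq; apply: (scalerI k0).
    by rewrite -!/(poly_of_roots _) -rE /q scale0r subr0 DE.
  rewrite -cnt0; apply: contrapT => /eqP cc.
  have cont : {within `[0, c], continuous (fun x => (cnt x)%:R : R)}.
    apply: continuous_in_subspaceT => x; rewrite inE /= in_itv /= => /andP[x0 xc].
    apply: cvg_near_cst; near=> y; congr (_%:R); near: y; exact: cnt_near.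
  (* The count is a continuous function of [x]. If its end values differed it would take a
     half-integer value, which parity excludes after doubling. *)
  have [x _ /(congr1 (fun y => y * 2))] : exists2 x, x \in `[0, c] &
      (cnt x)%:R = (minn (cnt 0) (cnt c))%:R + 2^-1 :> R.
    apply: IVT => //; rewrite ge_min le_max.
    have h2 : 0 < (2^-1 : R) by rewrite invr_gt0.
    have h3 : (2^-1 : R) <= 1 by rewrite invf_le1 ?ler1n.
    have half (i j : nat) : (i < j)%N -> i%:R + 2^-1 <= j%:R :> R.
      move=> ij; apply: (@le_trans _ _ (i%:R + 1)); first by rewrite lerD2l.
      by rewrite natr1 ler_nat.
    have le2 (i : nat) : i%:R <= i%:R + 2^-1 :> R by rewrite lerDl ltW.
    by case: (ltngtP (cnt 0) (cnt c)) cc => // ij _; rewrite le2 (half _ _ ij) ?orbT.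
  rewrite mulrDl mulVf// -!natrM natr1 => /eqP; rewrite eqr_nat => /eqP/(congr1 odd).
  by rewrite /= !oddM !andbF.
have pr : perm_eq (r c) ([seq z <- r c | 0 < Re z] ++ [seq z <- r c | ~~ (0 < Re z)]).
  by rewrite perm_sym perm_filterC.
have sf : size [seq z <- r c | 0 < Re z] = count (fun z : C => 0 < Re z) rs.
  by rewrite size_filter -cntc.
exists (fun i => nth 0 [seq z <- r c | 0 < Re z] i); split.
  move=> i; have : nth 0 [seq z <- r c | 0 < Re z] i \in [seq z <- r c | 0 < Re z].
    by rewrite mem_nth// sf.
  by rewrite mem_filter => /andP[].
exists (k *: poly_of_roots [seq z <- r c | ~~ (0 < Re z)]).
  rewrite -/(q c) rE -scalerAl /poly_of_roots (perm_big _ pr) big_cat /= mulrC.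
  congr (_ *: (_ * _)); rewrite (big_nth 0) sf big_mkord//.
move=> x x0; rewrite rootE hornerZ mulf_eq0 (negbTE k0) /= -rootE /poly_of_roots.
by rewrite root_prod_XsubC mem_filter x0.
Unshelve. all: by end_near. Qed.

End RootCount.

(** * The case a = 1: determination of the remainder *)

Section UnitSlope.
Context {R : realType}.
Local Notation C := R[i].

Lemma ccontinuousD (f g : C -> C) s : ccontinuous_at f s -> ccontinuous_at g s ->
  ccontinuous_at (fun z => f z + g z) s.
Proof.
by move=> cf cg; apply/ccontinuous_atP; apply: continuousD; apply/ccontinuous_atP.
Qed.

Lemma ccontinuousM (f g : C -> C) s : ccontinuous_at f s -> ccontinuous_at g s ->
  ccontinuous_at (fun z => f z * g z) s.
Proof.
by move=> cf cg; apply/ccontinuous_atP; apply: continuousM; apply/ccontinuous_atP.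
Qed.

Lemma ccontinuous_cst (c s : C) : ccontinuous_at (fun=> c) s.
Proof. by move=> e e0; exists 1 => // z _; rewrite subrr cabs0. Qed.

Lemma ccontinuousB (f g : C -> C) s : ccontinuous_at f s -> ccontinuous_at g s ->
  ccontinuous_at (fun z => f z - g z) s.
Proof.
move=> cf cg; rewrite (_ : (fun z => _) = fun z => f z + -1 * g z).
  by apply: ccontinuousD => //; apply: ccontinuousM => //; exact: ccontinuous_cst.
by apply/funext => z; rewrite mulN1r.
Qed.

Lemma ccontinuous_horner (q : {poly C}) s : ccontinuous_at (horner q) s.
Proof.
elim/poly_ind: q => [|q c IH].
  rewrite (_ : horner 0 = fun=> 0); first exact: ccontinuous_cst.
  by apply/funext => z; rewrite horner0.
rewrite (_ : horner _ = fun z => q.[z] * z + c).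
  apply: ccontinuousD; last exact: ccontinuous_cst.
  apply: ccontinuousM => //.
  by move=> e e0; exists e.
by apply/funext => z; rewrite hornerD hornerMX hornerC.
Qed.

Definition rhp_continuous (f : C -> C) : Prop := forall s, 0 < Re s -> ccontinuous_at f s.

Lemma rhp_continuousB f g : rhp_continuous f -> rhp_continuous g ->
  rhp_continuous (fun s => f s - g s).
Proof. by move=> cf cg s s0; apply: ccontinuousB; [exact: cf|exact: cg]. Qed.

Lemma rhp_continuous_hornerM q f : rhp_continuous f -> rhp_continuous (fun s => q.[s] * f s).
Proof. by move=> cf s s0; apply: ccontinuousM; [exact: ccontinuous_horner|exact: cf]. Qed.

Lemma rhp_cancel_XsubC (h : C -> C) z : rhp_continuous h ->
  (forall s, 0 < Re s -> (s - z) * h s = 0) -> forall s, 0 < Re s -> h s = 0.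
Proof.
move=> ch hz.
have h0 s : 0 < Re s -> s != z -> h s = 0.
  move=> s0 sz; have /eqP := hz s s0; rewrite mulf_eq0 subr_eq0 (negbTE sz) /=.
  by move/eqP.
move=> s s0; have [sz|] := eqVneq s z; last exact: h0.
apply/eqP; rewrite -cabs_eq0; apply/negPn/negP => hs.
have {}hs : 0 < cabs (h s) by rewrite lt_neqAle eq_sym hs cabs_ge0.
have [d d0 hd] := ch s s0 _ hs.
have d2 : 0 < d / 2 by rewrite divr_gt0.
have : cabs (h (s + (d / 2)%:C) - h s) < cabs (h s).
  by apply: hd; rewrite addrC addKr cabs_real gtr0_norm//; lra.
rewrite h0 ?sub0r ?cabsN ?ltxx//.
- by rewrite ReD /= addr_gt0.
- by rewrite -sz -subr_eq0 addrC addKr fmorph_eq0 gt_eqF.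
Qed.

(** The finitely many zeros of [Q] are removed one at a time, continuity of [h] filling in the value
    at each of them. *)
Lemma rhp_cancel_poly (Q : {poly C}) (h : C -> C) : Q != 0 -> rhp_continuous h ->
  (forall s, 0 < Re s -> Q.[s] * h s = 0) -> forall s, 0 < Re s -> h s = 0.
Proof.
move=> Q0 ch; have [rs ->] := closed_field_poly_normal Q.
have lQ : lead_coef Q != 0 by rewrite lead_coef_eq0.
elim: rs => [|z rs IH] h0.
  move=> s s0; have /eqP := h0 s s0.
  by rewrite big_nil hornerZ hornerC mulr1 mulf_eq0 (negbTE lQ) => /eqP.
apply: IH.
apply: (@rhp_cancel_XsubC _ z); first exact: rhp_continuous_hornerM.
move=> s s0; rewrite -[RHS](h0 s s0) big_cons !hornerZ hornerM hornerXsubC; ring.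
Qed.

(** Each zero is divided out of both sides, and the identity survives at the zero itself by
    continuity of [v]; multiplicities are thereby respected. *)
Lemma rhp_quotient_dvd (ds : seq C) (g Cp : {poly C}) (v : C -> C) :
  (forall z, z \in ds -> 0 < Re z) -> rhp_continuous v ->
  (forall s, 0 < Re s -> g.[s] * (poly_of_roots ds).[s] * v s = Cp.[s]) ->
  exists E : {poly C}, Cp = poly_of_roots ds * E.
Proof.
elim: ds Cp => [|z ds IH] Cp ds0 cv hv.
  by exists Cp; rewrite /poly_of_roots big_nil mul1r.
have z0 : 0 < Re z by apply: ds0; rewrite mem_head.
have rz : root Cp z.
  apply/rootP; rewrite -hv// poly_of_roots_cons !hornerM hornerXsubC subrr.
  by rewrite mul0r mulr0 mul0r.
have [C1 C1E] := factor_theorem _ _ rz.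
have [E CE] : exists E : {poly C}, C1 = poly_of_roots ds * E.
  apply: IH => //; first by move=> x xds; apply: ds0; rewrite inE xds orbT.
  move=> s s0; apply/eqP; rewrite -subr_eq0; apply/eqP.
  apply: (@rhp_cancel_XsubC (fun s => g.[s] * (poly_of_roots ds).[s] * v s - C1.[s]) z) => //.
    apply: rhp_continuousB; last by move=> x _; exact: ccontinuous_horner.
    rewrite (_ : (fun s => _) = fun s => (g * poly_of_roots ds).[s] * v s).
      exact: rhp_continuous_hornerM.
    by apply/funext => x; rewrite hornerM.
  move=> x x0; have := hv x x0; rewrite C1E poly_of_roots_cons !hornerM !hornerXsubC => e.
  by rewrite mulrBr [X in _ - X]mulrC -e; ring.
by exists E; rewrite C1E CE poly_of_roots_cons; ring.
Qed.

Lemma poly_basis_span n (E : 'I_n -> {poly C}) : (forall j, (size (E j) <= n)%N) ->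
  (forall g : 'I_n -> C, \sum_j g j *: E j = 0 -> forall j, g j = 0) ->
  forall F : {poly C}, (size F <= n)%N -> exists g : 'I_n -> C, F = \sum_j g j *: E j.
Proof.
move=> sE iE F sF.
pose M : 'M[C]_n := \matrix_(j, k) (E j)`_k.
have coefM (g : 'rV[C]_n) (k : 'I_n) : (\sum_j g 0 j *: E j)`_k = (g *m M) 0 k.
  by rewrite coef_sum mxE; apply: eq_bigr => j _; rewrite coefZ mxE.
have sum_size (g : 'I_n -> C) : (size (\sum_j g j *: E j)%R <= n)%N.
  apply: leq_trans (size_sum _ _ _) _; apply/bigmax_leqP => j _.
  exact: leq_trans (size_scale_leq _ _) (sE j).
have uM : M \in unitmx.
  rewrite -row_free_unit; apply: inj_row_free => g gM.
  apply/rowP => j; rewrite mxE; apply: (iE (fun j => g 0 j)).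
  apply/polyP => k; rewrite coef0; have [kn|kn] := ltnP k n.
    by rewrite (coefM g (Ordinal kn)) gM mxE.
  by rewrite nth_default// (leq_trans (sum_size _)).
pose f : 'rV[C]_n := \row_k F`_k.
exists (fun j => (f *m invmx M) 0 j).
apply/polyP => k; have [kn|kn] := ltnP k n.
  by rewrite (coefM _ (Ordinal kn)) mulmxKV// mxE.
by rewrite !nth_default// (leq_trans _ kn).
Qed.

Variables (DY NY : {poly C}) (l m : nat) (p r : R) (nu : probability R R).
Local Notation N := (m + l).+1.
Local Notation sol := (transform_solution DY NY N 1 p r).
Local Notation defect := (s_defect NY p r nu).
Let den := DY - (r * p)%:C *: NY.

Lemma unit_slope_quotient psi U Cp s : sol psi U Cp -> 0 <= Re s ->
  den.[s] * U s = DY.[s] * psi s + Cp.[s].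
Proof.
move=> h s0; have := ts_eq h s0; rewrite mul1r mulrBr => /eqP.
rewrite subr_eq => /eqP e.
by rewrite /den hornerD hornerN hornerZ mulrBl e; ring.
Qed.

Variable delta : 'I_m -> C.
Hypothesis delta_zeros : rhp_zeros den delta.
Variables (s_ : 'I_l -> C) (v : 'I_l -> C -> C) (D : 'I_l -> {poly C}).
Hypotheses (s_neg : forall j, Re (s_ j) < 0)
  (v_sol : forall j, sol (fun=> 0) (v j) (D j))
  (D0 : forall j, (D j).[0] = 0)
  (v_defect : forall i j, defect (v j) (D j) (s_ i) = (i == j)%:R).

Let ds := [seq delta i | i <- enum 'I_m].
Let Q := poly_of_roots ds.

Let ds_gt0 z : z \in ds -> 0 < Re z.
Proof. by move=> /mapP[i _ ->]; have [] := delta_zeros. Qed.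

Let Q0 : Q.[0] != 0.
Proof.
rewrite /Q /poly_of_roots horner_prod prodf_seq_neq0; apply/allP => z /ds_gt0 z0.
by rewrite hornerXsubC sub0r oppr_eq0; apply: contraTneq z0 => ->; rewrite ltxx.
Qed.

Let den_neq0 : den != 0.
Proof.
have [_ [g -> hg]] := delta_zeros; rewrite mulf_neq0//.
  by apply: contraNneq (hg 1 _) => [->|]; rewrite ?root0//= ltr01.
by apply/prodf_neq0 => i _; rewrite polyXsubC_eq0.
Qed.

(** Such a remainder vanishes at the zeros of [den] in the right half-plane and at 0, which uses up
    m + 1 factors of a polynomial of degree at most m + l: a space of dimension [l] remains. *)
Let quotient_factor w Cp : rhp_continuous w ->
  (forall s, 0 < Re s -> den.[s] * w s = Cp.[s]) ->
  (size Cp <= N)%N -> Cp.[0] = 0 ->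
  exists2 E : {poly C}, (size E <= l)%N & Cp = Q * ('X * E).
Proof.
move=> cw hw sC C0; have [_ [g gE _]] := delta_zeros.
have QE : den = g * Q by rewrite gE /Q /poly_of_roots big_map big_enum.
have [E1 E1E] : exists E : {poly C}, Cp = Q * E.
  apply: (@rhp_quotient_dvd ds g _ w) => // s s0.
  by rewrite -hw// QE hornerM.
have : root E1 0.
  apply/rootP; apply: (mulfI Q0); rewrite mulr0 -hornerM -E1E//.
move=> /factor_theorem[E]; rewrite subr0 mulrC => EE.
exists E; last by rewrite E1E EE.
have [->|En0] := eqVneq E 0; first by rewrite size_poly0.
move: sC; rewrite E1E EE.
rewrite [Q * _]mulrC size_Mmonic ?mulf_neq0 ?polyX_eq0 ?monic_prod_XsubC//.
rewrite size_poly_of_roots size_map size_enum_ord ['X * _]mulrC size_mulX//= addnS ltnS.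
by rewrite addnC leq_add2l.
Qed.

(** The [l] dual remainders lie in the space of dimension [l] found by [quotient_factor]. They are
    independent: a relation makes the same combination of the [v j] vanish on the right half-plane,
    and its defect at s_i is the coefficient of index i. *)
Lemma dual_remainder_span Cp w : rhp_continuous w ->
  (forall s, 0 < Re s -> den.[s] * w s = Cp.[s]) ->
  (size Cp <= N)%N -> Cp.[0] = 0 -> exists g : 'I_l -> C, Cp = \sum_j g j *: D j.
Proof.
move=> cw hw sC C0.
have DE j : exists E : {poly C}, (size E <= l)%N /\ D j = Q * ('X * E).
  have [E] : exists2 E : {poly C}, (size E <= l)%N & D j = Q * ('X * E).
    apply: (@quotient_factor (v j)).
    - exact: (ts_cont (v_sol j)).
    - by move=> s s0; rewrite (unit_slope_quotient (v_sol j)) ?ltW// mulr0 add0r.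
    - exact: (ts_size (v_sol j)).
    - exact: D0.
  by exists E.
have [E hE] := choice DE.
have [F sF CF] := quotient_factor cw hw sC C0.
have sumE (g : 'I_l -> C) : \sum_j g j *: D j = Q * ('X * \sum_j g j *: E j).
  rewrite mulr_sumr mulr_sumr; apply: eq_bigr => j _.
  by rewrite (hE j).2 -!scalerAr.
have [||g gE] := @poly_basis_span l E _ _ F sF.
- by move=> j; have [] := hE j.
- move=> g g0 i.
  have sg := sumE g; rewrite g0 !mulr0 in sg.
  have hs := transform_solution_sum (index_enum 'I_l) g v_sol.
  have V0 : forall s : C, 0 < Re s -> \sum_j g j * v j s = 0.
    apply: (@rhp_cancel_poly den (fun s => \sum_j g j * v j s)) => //; first exact: (ts_cont hs).
    move=> x x0; rewrite (unit_slope_quotient hs) ?ltW// sg horner0 big1 ?mulr0 ?addr0//.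
    by move=> j _; rewrite mulr0.
  have := s_defect_sum nu (index_enum 'I_l) g (s_neg i) v_sol.
  rewrite [RHS](bigD1 i)//= v_defect eqxx mulr1 [X in _ = _ + X]big1 ?addr0; last first.
    by move=> j ji; rewrite v_defect eq_sym (negbTE ji) mulr0.
  move=> <-; rewrite /s_defect sg horner0.
  rewrite (eq_cint nu (g := fun=> 0)) ?cint0 ?mulr0 ?subr0//.
  by move=> y /=; rewrite in_itv /= => y0; apply: V0; rewrite ReMr nmulr_rgt0.
by exists g; rewrite sumE CF gE.
Qed.

(** The difference of the two functions solves the equation without source, so its remainder is a
    combination of the dual ones and itself the same combination of the [v j]. Both candidates have
    zero defect, so all coefficients vanish. *)
Lemma unit_slope_unique psi U (Cp Bp : {poly C}) u : sol psi U Cp ->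
  (forall j, defect U Cp (s_ j) = 0) -> (size Bp <= N)%N -> Bp.[0] = Cp.[0] ->
  rhp_quotient (fun s => DY.[s] * psi s + Bp.[s]) (fun s => DY.[s] - (r * p)%:C * NY.[s]) u ->
  (forall j, defect u Bp (s_ j) = 0) -> Bp = Cp.
Proof.
move=> hU dU sB B0 [hu cu] du.
have cu' : rhp_continuous u by move=> s s0; apply/ccontinuous_atP; exact: cu.
have cw : rhp_continuous (fun s => u s - U s).
  by apply: rhp_continuousB => //; exact: (ts_cont hU).
have denE s : den.[s] = DY.[s] - (r * p)%:C * NY.[s].
  by rewrite /den hornerD hornerN hornerZ.
(* Away from the zeros of [den] this is the definition of the quotient; at the zeros it follows by
   continuity. *)
have hw s : 0 < Re s -> den.[s] * (u s - U s) = (Bp - Cp).[s].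
  move=> s0; apply/eqP; rewrite -subr_eq0; apply/eqP; move: s s0.
  apply: (@rhp_cancel_poly den (fun s => den.[s] * (u s - U s) - (Bp - Cp).[s])) => //.
    apply: rhp_continuousB; first exact: rhp_continuous_hornerM.
    by move=> x _; exact: ccontinuous_horner.
  move=> s s0; have [->|n0] := eqVneq den.[s] 0; first by rewrite mul0r.
  apply/eqP; rewrite mulf_eq0 (negbTE n0) subr_eq0 /=; apply/eqP.
  rewrite mulrBr (unit_slope_quotient hU (ltW s0)) hu -?denE//.
  by rewrite mulrC divfK// hornerD hornerN; ring.
have sBC : (size (Bp - Cp)%R <= N)%N.
  apply: leq_trans (size_polyD _ _) _; rewrite size_polyN geq_max sB.
  exact: (ts_size hU).
have BC0 : (Bp - Cp).[0] = 0 by rewrite hornerD hornerN B0 subrr.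
have [g gE] := dual_remainder_span cw hw sBC BC0.
have hs := transform_solution_sum (index_enum 'I_l) g v_sol.
have wE s : 0 < Re s -> u s = U s + \sum_j g j * v j s.
  move=> s0; apply/eqP; rewrite -subr_eq0 opprD addrA; apply/eqP; move: s s0.
  apply: (@rhp_cancel_poly den (fun s => u s - U s - \sum_j g j * v j s)) => //.
    by apply: rhp_continuousB => //; exact: (ts_cont hs).
  move=> x x0; rewrite mulrBr hw// (unit_slope_quotient hs) ?ltW// gE.
  by rewrite [X in DY.[x] * X]big1 ?mulr0 ?add0r ?subrr// => j _; rewrite mulr0.
suff g0 j : g j = 0.
  by apply/eqP; rewrite -subr_eq0 gE big1// => j _; rewrite g0 scale0r.
have := s_defect_sum nu (index_enum 'I_l) g (s_neg j) v_sol.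
rewrite [RHS](bigD1 j)//= v_defect eqxx mulr1 [X in _ = _ + X]big1 ?addr0; last first.
  by move=> i ji; rewrite v_defect eq_sym (negbTE ji) mulr0.
move=> <-.
have := s_defectD nu (s_neg j) hU hs; rewrite dU add0r => <-.
rewrite -gE addrC subrK -[RHS](du j) /s_defect; congr (_ - _ * _).
apply: eq_cint => y /=; rewrite in_itv /= => y0.
by rewrite -wE// ReMr nmulr_rgt0.
Qed.

End UnitSlope.

(** * The case a != 1: iteration along the orbit a^h s *)

Section OrbitSeries.
Context {R : realType}.
Local Notation C := R[i].

Lemma poly_of_roots_lower (rs : seq C) (z : C) :
  (forall y, y \in rs -> 2 * cabs y <= cabs z) ->
  (cabs z / 2) ^+ size rs <= cabs (poly_of_roots rs).[z].
Proof.
elim: rs => [|y rs IH] h.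
  by rewrite expr0 /poly_of_roots big_nil hornerC cabs1.
rewrite poly_of_roots_cons hornerM cabsM hornerXsubC exprS.
apply: ler_pM; rewrite ?exprn_ge0 ?divr_ge0 ?cabs_ge0//; last first.
  by apply: IH => x xrs; apply: h; rewrite inE xrs orbT.
have hy : 2 * cabs y <= cabs z by apply: h; rewrite mem_head.
have : cabs z <= cabs (z - y) + cabs y by rewrite -{1}[z](subrK y) ler_cabsD.
lra.
Qed.

Lemma cabs_horner_upper (q : {poly C}) n (z : C) : (size q <= n.+1)%N -> 1 <= cabs z ->
  cabs q.[z] <= (\sum_(i < n.+1) cabs q`_i) * cabs z ^+ n.
Proof.
move=> sq z1; rewrite (horner_coef_wide _ sq) mulr_suml.
apply: le_trans (ler_cabs_sum _ _ _) _; apply: ler_sum => i _.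
rewrite cabsM ler_wpM2l ?cabs_ge0// cabsX.
by apply: ler_weXn2l => //; rewrite -ltnS.
Qed.

Lemma poly_ratio_growth (D q : {poly C}) : D != 0 -> (size q <= size D)%N ->
  exists M K : R, 0 <= K /\ forall z, M <= cabs z -> cabs q.[z] <= K * cabs D.[z].
Proof.
move=> D0 sq; have [rs DE] := closed_field_poly_normal D.
have lD : lead_coef D != 0 by rewrite lead_coef_eq0.
have lD0 : 0 < cabs (lead_coef D) by rewrite cabs_gt0.
have sD : size D = (size rs).+1.
  by rewrite DE size_scale// -/(poly_of_roots rs) size_poly_of_roots.
set S := \sum_(i < (size rs).+1) cabs q`_i.
have S0 : 0 <= S by apply: sumr_ge0 => i _; exact: cabs_ge0.
(* Beyond this radius |z| is at least 1 and at least twice the modulus of each root, so that |z - y|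
   >= |z| / 2. *)
exists (1 + 2 * \sum_(y <- rs) cabs y), (S * (2 ^+ size rs / cabs (lead_coef D))); split.
  by rewrite mulr_ge0// divr_ge0 ?exprn_ge0// ltW.
move=> z zM.
have sy y : y \in rs -> cabs y <= \sum_(y <- rs) cabs y.
  move=> yrs; rewrite (big_rem y)//= lerDl sumr_ge0// => i _; exact: cabs_ge0.
have s0 : 0 <= \sum_(y <- rs) cabs y by apply: sumr_ge0 => i _; exact: cabs_ge0.
have z1 : 1 <= cabs z by lra.
have hz := @poly_of_roots_lower rs z _.
rewrite sD in sq.
apply: le_trans (cabs_horner_upper sq z1) _; rewrite -/S -mulrA ler_wpM2l//.
rewrite -mulrA [X in _ * (_ * cabs X.[_])]DE hornerZ cabsM mulKf ?gt_eqF//.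
have : (cabs z / 2) ^+ size rs <= cabs (poly_of_roots rs).[z].
  by apply: hz => y /sy hy; lra.
by rewrite expr_div_n ler_pdivrMr ?exprn_gt0// mulrC.
Qed.

Lemma eventually_bounded (f : nat -> R) (K : R) :
  (\forall n \near \oo, f n <= K) -> exists2 L, 0 <= L & forall n, f n <= L.
Proof.
move=> [N _ hN]; exists (`|K| + \sum_(i < N) `|f i|).
  by rewrite addr_ge0// sumr_ge0.
move=> n; have [nN|Nn] := ltnP n N.
  rewrite (bigD1 (Ordinal nN))//= addrCA; apply: le_trans (ler_norm _) _.
  by rewrite lerDl addr_ge0// sumr_ge0.
apply: le_trans (hN n Nn) _; apply: le_trans (ler_norm K) _.
by rewrite lerDl sumr_ge0.
Qed.

Variables (D N : {poly C}) (a c : R).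
Hypotheses (sND : (size N < size D)%N) (D0 : D.[0] != 0) (ND0 : N.[0] = D.[0]).
Hypotheses (a_gt0 : 0 < a) (a_neq1 : a != 1) (c_ge0 : 0 <= c) (c_lt1 : c < 1).

Local Notation orbit h s := ((a ^+ h)%:C * s).

(** The factor in front of U(a^h s) after [h] iterations of the functional equation. *)
Definition weight (s : C) (h : nat) : C :=
  (c ^+ h)%:C * \prod_(j < h) (N.[orbit j s] / D.[orbit j s]).

Lemma weightS s h : weight s h.+1 = weight s h * (c%:C * (N.[orbit h s] / D.[orbit h s])).
Proof. by rewrite /weight big_ord_recr /= exprSr rmorphM /=; ring. Qed.

Lemma weight0 s : weight s 0 = 1.
Proof. by rewrite /weight big_ord0 expr0 mulr1. Qed.

Let Dn0 : D != 0.
Proof. by apply: contraNneq D0 => ->; rewrite horner0. Qed.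

Lemma orbit_cvg0 s : a < 1 -> ccvg \oo (fun h => orbit h s) 0.
Proof.
move=> a1; rewrite -[0](mul0r s); apply: ccvgM; last exact: ccvg_cst.
apply: ccvg_real; have := @cvg_geometric R 1 a _.
rewrite ger0_norm ?ltW// => /(_ a1); rewrite /geometric.
by under eq_fun do rewrite mul1r.
Qed.

Lemma orbit_large s M : 1 < a -> s != 0 -> \forall h \near \oo, M <= cabs (orbit h s).
Proof.
move=> a1 s0; have ss : 0 < cabs s by rewrite cabs_gt0.
have e0 : 0 < cabs s / (`|M| + 1) by rewrite divr_gt0// ltr_wpDl.
have ai : `|a^-1| < 1 by rewrite ger0_norm ?invr_ge0 ?ltW// invf_lt1.
have /cvgrPdist_lt/(_ _ e0) := @cvg_geometric R 1 a^-1 ai.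
apply: filterS => h; rewrite /geometric /= sub0r normrN mul1r exprVn.
have ah0 : 0 < a ^+ h by exact: exprn_gt0.
rewrite gtr0_norm ?invr_gt0// => ah.
rewrite cabsM cabs_real gtr0_norm//.
have M1 : 0 < `|M| + 1 by rewrite ltr_wpDl.
move: ah; rewrite ltr_pdivlMr// mulrC ltr_pdivrMr// [cabs s * _]mulrC => ah.
by have := ler_norm M; lra.
Qed.

Lemma ratio_orbit_bounded (q : {poly C}) s : (size q <= size D)%N ->
  exists2 K, 0 <= K & forall h, cabs (q.[orbit h s] / D.[orbit h s]) <= K.
Proof.
move=> sq; have [->|s0] := eqVneq s 0.
  exists (cabs (q.[0] / D.[0])); first exact: cabs_ge0.
  by move=> h; rewrite mulr0.
case: (ltgtP a 1) a_neq1 => // a1 _.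
  have hc : ccvg \oo (fun h => q.[orbit h s] / D.[orbit h s]) (q.[0] / D.[0]).
    by apply: ccvgM; [|apply: ccvgV => //]; apply: ccvg_horner; exact: orbit_cvg0.
  apply: (@eventually_bounded _ (cabs (q.[0] / D.[0]) + 1)).
  move/ccvg_distP : hc => /(_ _ ltr01); apply: filterS => h hh.
  rewrite -[X in cabs X](subrK (q.[0] / D.[0])); apply: le_trans (ler_cabsD _ _) _.
  by rewrite addrC lerD2l ltW.
have [M [K [K0 hK]]] := poly_ratio_growth Dn0 sq.
apply: (@eventually_bounded _ K).
apply: filterS (orbit_large M a1 s0) => h /hK hh.
have [->|Dh] := eqVneq D.[orbit h s] 0; first by rewrite invr0 mulr0 cabs0.
by rewrite cabsM cabsV ler_pdivrMr// cabs_gt0.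
Qed.

(** The ratio of consecutive weights is c N / D along the orbit. For a < 1, or at s = 0, it tends to
    its value at 0, which is c < 1; for a > 1 and s nonzero it tends to 0, as [N / D] vanishes at
    infinity. *)
Lemma weight_geometric s : geometric_bound (weight s).
Proof.
have E h : weight s h.+1 = c%:C * (N.[orbit h s] / D.[orbit h s]) * weight s h.
  by rewrite weightS mulrC.
have lim1 : (forall h, orbit h s = 0) \/ a < 1 ->
    ccvg \oo (fun h => c%:C * (N.[orbit h s] / D.[orbit h s])) c%:C.
  move=> hs; rewrite -[X in ccvg _ _ X]mulr1 -(mulfV D0) -[X in _ * (X / _)]ND0.
  apply: ccvgM; first exact: ccvg_cst.
  have ho : ccvg \oo (fun h => orbit h s) 0.
    case: hs => [hs|]; last exact: orbit_cvg0.
    by under eq_fun do rewrite hs; exact: ccvg_cst.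
  by apply: ccvgM; [|apply: ccvgV => //]; apply: ccvg_horner.
have cc : cabs (c%:C : C) < 1 by rewrite cabs_real ger0_norm.
have [s0|s0] := eqVneq s 0.
  by apply: (geometric_bound_ratio E) cc; apply: lim1; left => h; rewrite s0 mulr0.
case: (ltgtP a 1) a_neq1 => // a1 _.
  by apply: (geometric_bound_ratio E) cc; apply: lim1; right.
apply: (geometric_bound_ratio (x := 0) E); last by rewrite cabs0.
(* Bounding the ratio for [N * 'X] gives decay of order 1 / |s| for [N / D]. *)
have sX : (size (N * 'X)%R <= size D)%N.
  by apply: leq_trans (size_polyMleq _ _) _; rewrite size_polyX addn2.
have [K K0 hK] := ratio_orbit_bounded s sX.
have sc : 0 < cabs s by rewrite cabs_gt0.
apply: (@ccvg0_le _ _ _ _ _ (fun h => c * (K / cabs s) * (a^-1) ^+ h)).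
  apply: nearW => h; rewrite cabsM cabs_real ger0_norm// -mulrA ler_wpM2l//.
  have ah0 : 0 < a ^+ h by exact: exprn_gt0.
  have := hK h; rewrite hornerM hornerX mulrAC cabsM.
  rewrite [X in _ * X <= _]cabsM cabs_real gtr0_norm// => hh.
  rewrite exprVn -mulrA -invfM ler_pdivlMr ?mulr_gt0//.
  by rewrite [cabs s * _]mulrC.
have ai : `|a^-1| < 1 by rewrite ger0_norm ?invr_ge0 ?ltW// invf_lt1.
exact: (@cvg_geometric R _ a^-1 ai).
Qed.

Lemma weight_bounded_csum s (f : nat -> C) (K : R) : 0 <= K ->
  (forall h, cabs (f h) <= K) -> has_csum (fun h => weight s h * f h)
    (csum (fun h => weight s h * f h)).
Proof.
move=> K0 hf; apply: geometric_bound_csum.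
apply: (@geometric_bound_le _ (weight s) _ K) (weight_geometric s) => // h.
by rewrite cabsM mulrC ler_wpM2r ?cabs_ge0.
Qed.

Lemma weight_telescope s (G : nat -> C) (K : R) : (forall h, cabs (G h) <= K) ->
  has_csum (fun h => weight s h * G h - weight s h.+1 * G h.+1) (G 0%N).
Proof.
move=> hG; apply/has_csumP.
have K0 : 0 <= K by apply: le_trans (hG 0%N); exact: cabs_ge0.
have E n : \sum_(0 <= h < n) (weight s h * G h - weight s h.+1 * G h.+1) =
    G 0%N - weight s n * G n.
  elim: n => [|n IH]; first by rewrite big_geq// weight0 mul1r subrr.
  by rewrite big_nat_recr//= IH; ring.
under eq_fun do rewrite E.
rewrite -[X in ccvg _ _ X]subr0; apply: ccvgD; first exact: ccvg_cst.
apply: ccvgN; apply: geometric_bound_cvg0.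
apply: (@geometric_bound_le _ (weight s) _ K) (weight_geometric s) => // h.
by rewrite cabsM mulrC ler_wpM2r ?cabs_ge0.
Qed.

Definition monomial_term (s : C) (k h : nat) : C :=
  weight s h * (orbit h s ^+ k / D.[orbit h s]).

Lemma has_csum_monomial s k : (k < size D)%N ->
  has_csum (monomial_term s k) (csum (monomial_term s k)).
Proof.
move=> kD; have [|K K0 hK] := @ratio_orbit_bounded 'X^k s; first by rewrite size_polyXn.
by apply: (@weight_bounded_csum s (fun h => orbit h s ^+ k / D.[orbit h s]) K K0) => h; have := hK h; rewrite hornerXn.
Qed.

(* Iterating [U = psi + Cp / D + c (N / D) U(a .)] along the orbit of [s]. *)
Lemma orbit_expansion (U psi : C -> C) (Cp : {poly C}) s (K : R) :
  (forall h, cabs (U (orbit h s)) <= K) -> (forall h, D.[orbit h s] != 0) ->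
  (forall h, D.[orbit h s] * (U (orbit h s) - psi (orbit h s)) =
     c%:C * N.[orbit h s] * U (orbit h.+1 s) + Cp.[orbit h s]) ->
  has_csum (fun h => weight s h * (psi (orbit h s) + Cp.[orbit h s] / D.[orbit h s])) (U s).
Proof.
move=> hU hD hE; have := weight_telescope s hU; rewrite expr0 mul1r.
congr has_csum; apply/funext => h.
rewrite weightS -mulrA -mulrBr; congr (_ * _).
have -> : Cp.[orbit h s] =
    D.[orbit h s] * (U (orbit h s) - psi (orbit h s)) - c%:C * N.[orbit h s] * U (orbit h.+1 s).
  by rewrite hE addrC addKr.
by field; exact: hD.
Qed.

Lemma orbit_expansion_split (U psi : C -> C) (Cp : {poly C}) s (K L : R) :
  (size Cp <= size D)%N -> 0 <= L -> (forall h, cabs (psi (orbit h s)) <= L) ->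
  (forall h, cabs (U (orbit h s)) <= K) -> (forall h, D.[orbit h s] != 0) ->
  (forall h, D.[orbit h s] * (U (orbit h s) - psi (orbit h s)) =
     c%:C * N.[orbit h s] * U (orbit h.+1 s) + Cp.[orbit h s]) ->
  U s = csum (fun h => weight s h * psi (orbit h s)) +
    \sum_(k < size D) Cp`_k * csum (monomial_term s k).
Proof.
move=> sC L0 hpsi hU hD hE.
have h1 := orbit_expansion hU hD hE.
have h2 : has_csum (fun h => weight s h * psi (orbit h s) +
    \sum_(k < size D) Cp`_k * monomial_term s k h)
   (csum (fun h => weight s h * psi (orbit h s)) +
    \sum_(k < size D) Cp`_k * csum (monomial_term s k)).
  have hm (k : 'I_(size D)) : has_csum (fun h => Cp`_k * monomial_term s k h)
      (Cp`_k * csum (monomial_term s k)).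
    exact: (has_csumZ (c := Cp`_k) (has_csum_monomial (ltn_ord k))).
  have hs := @has_csum_sum R 'I_(size D) (index_enum _) xpredT _ _ (fun k _ => hm k).
  have hp := @weight_bounded_csum s (fun h => psi (orbit h s)) L L0 hpsi.
  exact: (has_csumD hp hs).
apply: has_csum_unique h1 _; move: h2; congr has_csum; apply/funext => h.
rewrite mulrDr; congr (_ + _); rewrite (horner_coef_wide _ sC) mulr_suml mulr_sumr.
by apply: eq_bigr => k _; rewrite /monomial_term; ring.
Qed.

End OrbitSeries.

(** * Independence of the equations at the zeros -t_i of D_Y *)

Section PoleFunctionals.
Context {R : realType}.
Local Notation C := R[i].
Variables (D N : {poly C}) (a c : R) (n : nat).
Hypotheses (sD : size D = n.+1) (sN : (size N <= n)%N) (D0 : D.[0] != 0) (ND0 : N.[0] = D.[0]).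
Hypotheses (a_gt0 : 0 < a) (a_neq1 : a != 1) (c_ge0 : 0 <= c) (c_lt1 : c < 1).

Let sND : (size N < size D)%N. Proof. by rewrite sD ltnS. Qed.

Local Notation orbit h s := ((a ^+ h)%:C * s).
Local Notation wt := (weight D N a c).

Let term (z : C) (F : C -> C) (h : nat) : C :=
  wt (a%:C * z) h * (F (orbit h (a%:C * z)) / D.[orbit h (a%:C * z)]).

Let summable z F := has_csum (term z F) (csum (term z F)).

(** The relation Cp(z) + c N(z) U(a z) = 0 at a zero [z] of [D], with U(a z) expanded along its
    orbit: this is the part that depends on the remainder. *)
Definition pole_functional (z : C) (F : C -> C) : C := F z + c%:C * N.[z] * csum (term z F).

Let bounded_summable z F (K : R) : 0 <= K ->
  (forall h, cabs (F (orbit h (a%:C * z)) / D.[orbit h (a%:C * z)]) <= K) -> summable z F.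
Proof.
move=> K0 hF; exact: (@weight_bounded_csum _ _ _ _ _ sND D0 ND0 a_gt0 a_neq1 c_ge0 c_lt1
  (a%:C * z) (fun h => F (orbit h (a%:C * z)) / D.[orbit h (a%:C * z)]) K K0 hF).
Qed.

Let summableD z F G x : summable z F -> summable z G ->
  has_csum (term z (fun y => x * F y + G y)) (x * csum (term z F) + csum (term z G)).
Proof.
move=> sF sG; have := has_csumD (has_csumZ (c := x) sF) sG.
by congr has_csum; apply/funext => h; rewrite /term; ring.
Qed.

Lemma pole_functionalD z F G x : summable z F -> summable z G ->
  pole_functional z (fun y => x * F y + G y) = x * pole_functional z F + pole_functional z G.
Proof.
by move=> sF sG; rewrite /pole_functional (has_csumE (summableD (x := x) sF sG)); ring.
Qed.

(** The remainder for which [G] itself solves the equation without source. Its orbit series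
    telescopes to G(a z), so the functionals at zeros of [D] kill it. *)
Let kernel (G : C -> C) (z : C) : C := D.[z] * G z - c%:C * N.[z] * G (a%:C * z).

Let kernel_csum z G (K : R) : (forall h, D.[orbit h (a%:C * z)] != 0) ->
  (forall h, cabs (G (orbit h (a%:C * z))) <= K) ->
  has_csum (term z (kernel G)) (G (a%:C * z)).
Proof.
move=> Dz hG; have := @weight_telescope _ _ _ _ _ sND D0 ND0 a_gt0 a_neq1 c_ge0 c_lt1
  (a%:C * z) (fun h => G (orbit h (a%:C * z))) K hG.
rewrite /= expr0 mul1r; congr has_csum; apply/funext => h.
rewrite /term weightS /kernel -mulrA -mulrBr; congr (_ * _).
rewrite exprS rmorphM -[_%:C * _ * (_ * _)]mulrA.
by field; exact: Dz.
Qed.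

Lemma pole_functional_kernel z G (K : R) : root D z ->
  (forall h, D.[orbit h (a%:C * z)] != 0) ->
  (forall h, cabs (G (orbit h (a%:C * z))) <= K) -> pole_functional z (kernel G) = 0.
Proof.
move=> /rootP rz Dz hG; rewrite /pole_functional (has_csumE (kernel_csum Dz hG)).
by rewrite /kernel rz; ring.
Qed.

(* Along an orbit [ep] decreases geometrically whatever the position of [a] with
   respect to 1. *)
Let ep (z : C) : C := if a < 1 then z else z^-1.
Let b : R := if a < 1 then a else a^-1.

Let b_gt0 : 0 < b. Proof. by rewrite /b; case: ifP; rewrite ?invr_gt0. Qed.

Let b_lt1 : b < 1.
Proof. by rewrite /b; case: (ltgtP a 1) a_neq1 => // a1 _; rewrite invf_lt1. Qed.

Let ep_orbit z h : ep (orbit h z) = (b ^+ h)%:C * ep z.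
Proof.
rewrite /ep /b; case: ifP => // _; have [->|z0] := eqVneq z 0.
  by rewrite mulr0 invr0 mulr0.
by rewrite invfM exprVn fmorphV.
Qed.

Let ep_neq0 z : z != 0 -> ep z != 0.
Proof. by rewrite /ep; case: ifP => // _; rewrite invr_eq0. Qed.

Let E (K : nat) (q : {poly C}) (z : C) : C := ep z ^+ K * q.[z].

Let cabs_ep_orbit z h : cabs (ep (orbit h (a%:C * z))) <= b * cabs (ep z).
Proof.
have -> : orbit h (a%:C * z) = orbit h.+1 z by rewrite exprSr rmorphM /= mulrA.
rewrite ep_orbit cabsM cabs_real gtr0_norm ?exprn_gt0// ler_wpM2r ?cabs_ge0//.
by rewrite exprS ler_piMr ?(ltW b_gt0)// exprn_ile1// ltW.
Qed.

Let E_bound z (q : {poly C}) : (size q <= size D)%N -> exists2 L, 0 <= L & forall K h,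
  cabs (E K q (orbit h (a%:C * z)) / D.[orbit h (a%:C * z)]) <= L * (b * cabs (ep z)) ^+ K.
Proof.
move=> sq.
have [L L0 hL] := @ratio_orbit_bounded _ D a D0 a_gt0 a_neq1 q (a%:C * z) sq.
exists L => // K h; rewrite /E -mulrA cabsM mulrC; apply: ler_pM; rewrite ?cabs_ge0//.
rewrite cabsX; apply: lerXn2r; rewrite ?nnegrE ?cabs_ge0//.
by rewrite mulr_ge0 ?cabs_ge0// ltW.
Qed.

Let E_summable z K (q : {poly C}) : (size q <= size D)%N -> summable z (E K q).
Proof.
move=> /(E_bound z)[L L0 hL]; apply: (@bounded_summable _ _ (L * (b * cabs (ep z)) ^+ K)) => //.
by rewrite mulr_ge0// exprn_ge0// mulr_ge0 ?cabs_ge0// ltW.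
Qed.

(** The series part sees only points of the orbit of a z, where [ep] has lost at least a factor [b];
    for large [K] it is negligible with respect to the value at [z]. *)
Let E_functional_bound z (q : {poly C}) : (size q <= size D)%N ->
  exists2 L, 0 <= L & forall K, cabs (csum (term z (E K q))) <= L * (b * cabs (ep z)) ^+ K.
Proof.
move=> /(E_bound z)[L L0 hL].
have [A [q0 [q00 q01 hw]]] := weight_geometric sND D0 ND0 a_gt0 a_neq1 c_ge0 c_lt1 (a%:C * z).
have A0 : 0 <= A by have := le_trans (cabs_ge0 _) (hw 0%N); rewrite expr0 mulr1.
exists (A * L / (1 - q0)).
  by rewrite divr_ge0 ?subr_ge0 ?(ltW q01)// mulr_ge0.
move=> K.
have X0 : 0 <= (b * cabs (ep z)) ^+ K.
  by rewrite exprn_ge0// mulr_ge0 ?cabs_ge0// ltW.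
have -> : A * L / (1 - q0) * (b * cabs (ep z)) ^+ K =
    A * L * (b * cabs (ep z)) ^+ K / (1 - q0) by ring.
apply: cabs_csum_le => // h; rewrite /term cabsM.
rewrite [leRHS](_ : _ = (A * q0 ^+ h) * (L * (b * cabs (ep z)) ^+ K)); last by ring.
by apply: ler_pM; rewrite ?cabs_ge0.
Qed.

(* Raising the power of [ep] by one costs a function killed by the functionals. *)
Let E_step K (q : {poly C}) : (size q <= n.+1)%N -> q.[0] = 0 ->
  exists (g : C) (G : C -> C) (q' : {poly C}),
  [/\ (size q' <= n.+1)%N, q'.[0] = 0,
      forall z, exists L : R, forall h, cabs (G (orbit h (a%:C * z))) <= L &
      forall z, z != 0 -> E K.+1 q z = g * kernel G z + E K q' z].
Proof.
move=> sq q0; rewrite /E /kernel.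
have an_ge0 h : 0 <= a ^+ h by rewrite exprn_ge0// ltW.
case: (ltgtP a 1) (a_neq1) => // a1 _.
  pose DK := D - (c * a ^+ K.+1)%:C *: N.
  have Dn : D`_n != 0.
    have -> : D`_n = lead_coef D by rewrite lead_coefE sD.
    by rewrite lead_coef_eq0 -size_poly_eq0 sD.
  have DKn : DK`_n = D`_n by rewrite coefB coefZ [N`_n]nth_default// mulr0 subr0.
  have sDK : (size DK <= n.+1)%N.
    apply: leq_trans (size_polyD _ _) _; rewrite geq_max sD leqnn size_polyN.
    by apply: leq_trans (size_scale_leq _ _) _; exact: leqW.
  (* This choice cancels the coefficient of degree [n], so that multiplication by X keeps the degree
     at most [n]. *)
  pose g := q`_n / D`_n.
  exists g, (fun z => z ^+ K.+1), ('X * (q - g *: DK)); split.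
  - apply: leq_trans (size_polyMleq _ _) _; rewrite size_polyX add2n /= ltnS.
    apply/leq_sizeP => j; rewrite leq_eqVlt => /orP[/eqP <-|nj].
      by rewrite coefB coefZ DKn /g divfK// subrr.
    by rewrite coefB coefZ !nth_default ?mulr0 ?subrr// (leq_trans _ nj).
  - by rewrite hornerM hornerX mul0r.
  - move=> z; exists (cabs z ^+ K.+1) => h; rewrite cabsX.
    apply: lerXn2r; rewrite ?nnegrE ?cabs_ge0// !cabsM !cabs_real.
    rewrite !ger0_norm ?(ltW a_gt0)// mulrA -exprSr ler_piMl ?cabs_ge0//.
    by rewrite exprn_ile1// ltW.
  - move=> z z0; rewrite /ep a1 hornerM hornerX hornerD hornerN hornerZ /DK.
    rewrite hornerD hornerN hornerZ exprMn -rmorphXn rmorphM /= !exprS; ring.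
have [p qE] : exists p : {poly C}, q = p * 'X.
  have /factor_theorem[p] : root q 0 by apply/rootP; rewrite q0.
  by rewrite subr0; exists p.
pose bK := (a^-1) ^+ K.
have bK1 : bK <= 1 by rewrite exprn_ile1 ?invr_ge0 ?invf_le1// ltW.
pose DK := D - (c * bK)%:C *: N.
have bK0 : 0 <= bK by rewrite exprn_ge0// invr_ge0 ltW.
have DK0 : DK.[0] != 0.
  rewrite /DK hornerD hornerN hornerZ ND0 -[X in X - _]mul1r -mulrBl mulf_neq0//.
  rewrite subr_eq0; apply/eqP => /(congr1 (@complex.Re R)) /= e.
  have : c * bK < 1; last by rewrite -e ltxx.
  by apply: le_lt_trans c_lt1; rewrite ler_piMr.
have sDK : (size DK <= n.+1)%N.
  apply: leq_trans (size_polyD _ _) _; rewrite geq_max sD leqnn size_polyN.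
  by apply: leq_trans (size_scale_leq _ _) _; exact: leqW.
(* One negative power of [z] is absorbed by q = p X, and this choice makes the new polynomial vanish
   at 0. *)
pose g := p.[0] / DK.[0].
have sp : (size p <= n)%N.
  have [->|p0] := eqVneq p 0; first by rewrite size_poly0.
  by move: sq; rewrite qE size_mulX.
exists g, (fun z => z^-1 ^+ K), (p - g *: DK); split.
- apply: leq_trans (size_polyD _ _) _; rewrite geq_max (leqW sp) size_polyN.
  exact: leq_trans (size_scale_leq _ _) sDK.
- by rewrite hornerD hornerN hornerZ /g divfK// subrr.
- move=> z; exists (cabs z^-1 ^+ K) => h; rewrite cabsX.
  apply: lerXn2r; rewrite ?nnegrE ?cabs_ge0//.
  have -> : (orbit h (a%:C * z))^-1 = ((a^-1) ^+ h.+1)%:C * z^-1.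
    by rewrite mulrA -rmorphM -exprSr /= exprVn fmorphV invfM.
  rewrite cabsM cabs_real ger0_norm ?exprn_ge0 ?invr_ge0 ?(ltW a_gt0)//.
  by rewrite ler_piMl ?cabs_ge0// exprn_ile1 ?invr_ge0 ?invf_le1// ltW.
- move=> z z0; rewrite /ep ltNge (ltW a1) /= qE hornerMX hornerD hornerN hornerZ /DK.
  rewrite hornerD hornerN hornerZ invfM exprMn /bK -[(a%:C)^-1]fmorphV -rmorphXn rmorphM /=.
  by rewrite exprSr -mulrA [z^-1 * _]mulrCA mulVf// mulr1; ring.
Qed.

Variables (m : nat) (z_ : 'I_m -> C).
Hypotheses (mn : (m <= n)%N) (z_inj : injective z_) (z_neq0 : forall i, z_ i != 0)
  (z_root : forall i, root D (z_ i))
  (z_reg : forall i h, D.[orbit h (a%:C * z_ i)] != 0).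

Lemma pole_functional_horner i (q : {poly C}) : (size q <= n.+1)%N ->
  pole_functional (z_ i) (horner q) =
  \sum_(k < n.+1) q`_k * pole_functional (z_ i) (fun z => z ^+ k).
Proof.
move=> sq.
have hk (k : 'I_n.+1) : summable (z_ i) (fun z => z ^+ k).
  have := @E_summable (z_ i) 0 'X^k; rewrite size_polyXn sD => /(_ (ltn_ord k)).
  by rewrite /E (_ : (fun z => _) = fun z => z ^+ k)//; apply/funext => z; rewrite expr0 mul1r hornerXn.
have hs := @has_csum_sum R 'I_n.+1 (index_enum _) xpredT _ _
  (fun k _ => has_csumZ (c := q`_k) (hk k)).
rewrite /pole_functional.
have -> : csum (term (z_ i) (horner q)) =
    \sum_(k < n.+1) q`_k * csum (term (z_ i) (fun z => z ^+ k)).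
  apply: has_csumE; move: hs; congr has_csum; apply/funext => h.
  rewrite /term (horner_coef_wide _ sq) mulr_suml mulr_sumr.
  by apply: eq_bigr => k _; ring.
rewrite (horner_coef_wide _ sq) mulr_sumr -big_split /=.
by apply: eq_bigr => k _; ring.
Qed.

(** A relation on polynomials of degree at most [n] vanishing at 0 extends, by [E_step], to their
    products with all powers of [ep]. Testing it on ep^K q, with q vanishing at all poles but one,
    and letting [K] grow isolates the value at that pole. *)
Lemma pole_functional_free (la : 'I_m -> C) :
  (forall k : 'I_n, \sum_i la i * pole_functional (z_ i) (fun z => z ^+ k.+1) = 0) ->
  forall i, la i = 0.
Proof.
move=> hla.
have az0 i h : orbit h (a%:C * z_ i) != 0.
  by rewrite !mulf_neq0// fmorph_eq0 ?expf_neq0// gt_eqF.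
have LE K : forall q : {poly C}, (size q <= n.+1)%N -> q.[0] = 0 ->
    \sum_i la i * pole_functional (z_ i) (E K q) = 0.
  elim: K => [|K IH] q sq q0.
    rewrite (eq_bigr (fun i => la i * \sum_(k < n.+1) q`_k *
        pole_functional (z_ i) (fun z => z ^+ k))); last first.
      move=> i _; rewrite -pole_functional_horner//; congr (_ * pole_functional _ _).
      by apply/funext => z; rewrite /E expr0 mul1r.
    under eq_bigr do rewrite mulr_sumr.
    rewrite exchange_big big_ord_recl /= big1; last first.
      by move=> i _; rewrite -horner_coef0 q0 mul0r mulr0.
    rewrite add0r big1// => k _; rewrite (eq_bigr (fun i => q`_k.+1 *
      (la i * pole_functional (z_ i) (fun z => z ^+ k.+1)))).
      by rewrite -mulr_sumr hla mulr0.
    by move=> i _; rewrite mulrCA.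
  have [g [G [q' [sq' q'0 hG hE]]]] := E_step K sq q0.
  rewrite -[RHS](IH q' sq' q'0); apply: eq_bigr => i _; congr (_ * _).
  have [L hL] := hG (z_ i).
  have sk : summable (z_ i) (kernel G).
    by rewrite /summable (has_csumE (kernel_csum (z_reg i) hL)); exact: (kernel_csum (z_reg i) hL).
  have sE : summable (z_ i) (E K q') by apply: E_summable; rewrite sD.
  have := pole_functionalD g sk sE.
  rewrite (pole_functional_kernel (z_root i) (z_reg i) hL) mulr0 add0r => <-.
  rewrite /pole_functional hE//; congr (_ + _ * csum _).
  by apply/funext => h; rewrite /term hE.
move=> i1; apply/eqP/negPn/negP => la1.
(* Among the poles with a nonzero coefficient, the one with the largest [ep] dominates every series
   part, by the additional factor b^K. *)
pose i0 := [arg max_(i > i1 | la i != 0) cabs (ep (z_ i))]%O.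
have [la0 hmax] : la i0 != 0 /\ forall i, la i != 0 -> cabs (ep (z_ i)) <= cabs (ep (z_ i0)).
  by rewrite /i0; case: Order.TotalTheory.arg_maxP => // i lai hi; split.
pose q : {poly C} := 'X * \prod_(i | i != i0) ('X - (z_ i)%:P).
have sq : (size q <= n.+1)%N.
  rewrite /q mulrC size_mulX ?ltnS; last by apply/prodf_neq0 => i _; rewrite polyXsubC_eq0.
  rewrite -big_filter size_prod_XsubC size_filter.
  have := count_predC (pred1 i0) (index_enum 'I_m).
  rewrite count_uniq_mem ?index_enum_uniq// mem_index_enum add1n => ->.
  by rewrite -[index_enum _]enumT size_enum_ord.
have q0 : q.[0] = 0 by rewrite hornerM hornerX mul0r.
have qi i : i != i0 -> q.[z_ i] = 0.
  by move=> ii; rewrite hornerM (bigD1 i)//= hornerM hornerXsubC subrr mul0r mulr0.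
have qi0 : q.[z_ i0] != 0.
  rewrite hornerM hornerX mulf_neq0// horner_prod prodf_seq_neq0.
  apply/allP => j _; apply/implyP => ji; rewrite hornerXsubC subr_eq0.
  by apply: contraNneq ji => /z_inj->.
have hL i : exists L : R, 0 <= L /\
    forall K, cabs (csum (term (z_ i) (E K q))) <= L * (b * cabs (ep (z_ i))) ^+ K.
  by have [|L L0 hL] := @E_functional_bound (z_ i) q; [rewrite sD|exists L].
have [L hL'] := choice hL.
pose M := \sum_i cabs (la i * (c%:C * N.[z_ i])) * L i.
have e0 : 0 < cabs (ep (z_ i0)) by rewrite cabs_gt0 ep_neq0.
have key K : cabs (la i0 * q.[z_ i0]) <= M * b ^+ K.
  have := LE K q sq q0; rewrite /pole_functional.
  under eq_bigr do rewrite mulrDr.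
  rewrite big_split /= (bigD1 i0)//= [X in _ + X + _]big1 ?addr0; last first.
    by move=> i ii; rewrite /E qi// !mulr0.
  move/eqP; rewrite addr_eq0 => /eqP e.
  rewrite -(ler_pM2r (exprn_gt0 K e0)) -cabsX -cabsM.
  have -> : la i0 * q.[z_ i0] * ep (z_ i0) ^+ K = la i0 * E K q (z_ i0) by rewrite /E; ring.
  rewrite e cabsN; apply: le_trans (ler_cabs_sum _ _ _) _.
  rewrite /M cabsX !mulr_suml; apply: ler_sum => i _.
  have [lai|lai] := eqVneq (la i) 0; first by rewrite lai !mul0r cabs0 !mul0r.
  rewrite mulrA cabsM -!mulrA ler_wpM2l ?cabs_ge0//.
  apply: le_trans ((hL' i).2 K) _; rewrite ler_wpM2l ?(hL' i).1//.
  rewrite exprMn ler_wpM2l ?exprn_ge0 ?(ltW b_gt0)//.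
  by apply: lerXn2r; rewrite ?nnegrE ?cabs_ge0 ?hmax.
have : cabs (la i0 * q.[z_ i0]) <= 0.
  have b1 : `|b| < 1 by rewrite gtr0_norm.
  have cl : (fun=> cabs (la i0 * q.[z_ i0])) @ \oo --> cabs (la i0 * q.[z_ i0]).
    exact: cvg_cst.
  by apply: (ler_cvg_to cl (@cvg_geometric R M b b1)); apply: nearW => K; exact: key.
by rewrite leNgt cabs_gt0 mulf_neq0.
Qed.

End PoleFunctionals.

(** * Nonsingularity of the combined linear system *)

Section SystemMatrix.
Variable F : fieldType.
Variables (m l : nat) (al : 'I_m -> nat -> F) (dk : 'I_l -> nat -> F) (X : 'I_l -> {poly F}).

(* A row relation between the equations loses its second half when tested on
   the [X j], and its first half by assumption. *)
Lemma system_unique (x : {poly F}) :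
  (forall j, (size (X j) <= (m + l).+1)%N) -> (forall j, (X j).[0] = 0) ->
  (forall i j, \sum_(k < (m + l).+1) (X j)`_k * al i k = 0) ->
  (forall i j, \sum_(k < (m + l).+1) (X j)`_k * dk i k = (i == j)%:R) ->
  (forall la : 'I_m -> F, (forall k : 'I_(m + l), \sum_i la i * al i k.+1 = 0) ->
     forall i, la i = 0) ->
  (size x <= (m + l).+1)%N -> x.[0] = 0 ->
  (forall i, \sum_(k < (m + l).+1) x`_k * al i k = 0) ->
  (forall j, \sum_(k < (m + l).+1) x`_k * dk j k = 0) -> x = 0.
Proof.
move=> sX X0 Xal Xdk ind sx x0 xal xdk.
(* Columns are equations and rows are the powers 1 to m + l; the constant coefficient is prescribed
   and drops out, which makes the matrix square. *)
pose M : 'M[F]_(m + l) := \matrix_(k, q < m + l) match fintype.split q with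
  | inl i => al i k.+1 | inr j => dk j k.+1 end.
have Ml k i : M k (lshift l i) = al i k.+1.
  by rewrite mxE; case: splitP => [j /= /ord_inj->|j /= e]//; move: (ltn_ord i); rewrite e ltnNge leq_addr.
have Mr k j : M k (rshift m j) = dk j k.+1.
  rewrite mxE; case: splitP => [i /= e|i /= /addnI/ord_inj->]//.
  by move: (ltn_ord i); rewrite -e ltnNge leq_addr.
have shift0 (y : {poly F}) (f : nat -> F) : y.[0] = 0 ->
    \sum_(k < (m + l).+1) y`_k * f k = \sum_(k < m + l) y`_k.+1 * f k.+1.
  by move=> y0; rewrite big_ord_recl -horner_coef0 y0 mul0r add0r.
have uM : M \in unitmx.
  rewrite -unitmx_tr -row_free_unit; apply: inj_row_free => w wM.
  have rel (k : 'I_(m + l)) : \sum_i w 0 (lshift l i) * al i k.+1 +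
      \sum_j w 0 (rshift m j) * dk j k.+1 = 0.
    have e : (w *m M^T) 0 k = 0 by rewrite wM mxE.
    rewrite -[RHS]e mxE big_split_ord /=.
    by congr (_ + _); apply: eq_bigr => i _; rewrite [M^T _ _]mxE ?Ml ?Mr.
  have wr j : w 0 (rshift m j) = 0.
    have : \sum_(k < m + l) (X j)`_k.+1 * (\sum_i w 0 (lshift l i) * al i k.+1 +
      \sum_j w 0 (rshift m j) * dk j k.+1) = 0.
      by rewrite big1// => k _; rewrite rel mulr0.
    under eq_bigr do rewrite mulrDr !mulr_sumr.
    rewrite big_split /= exchange_big [X in X + _]big1 ?add0r; last first.
      move=> i _; rewrite (eq_bigr (fun k : 'I_(m + l) => w 0 (lshift l i) *
        ((X j)`_k.+1 * al i k.+1))); last by move=> k _; rewrite mulrCA.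
      by rewrite -mulr_sumr -shift0// Xal mulr0.
    rewrite exchange_big (bigD1 j)//= [X in _ + X]big1 ?addr0.
      rewrite (eq_bigr (fun k : 'I_(m + l) => w 0 (rshift m j) *
        ((X j)`_k.+1 * dk j k.+1))); last by move=> k _; rewrite mulrCA.
      by rewrite -mulr_sumr -shift0// Xdk eqxx mulr1.
    move=> i ij; rewrite (eq_bigr (fun k : 'I_(m + l) => w 0 (rshift m i) *
      ((X j)`_k.+1 * dk i k.+1))); last by move=> k _; rewrite mulrCA.
    by rewrite -mulr_sumr -shift0// Xdk (negbTE ij) mulr0.
  have wl i : w 0 (lshift l i) = 0.
    apply: (ind (fun i => w 0 (lshift l i))) => k.
    by rewrite -[RHS](rel k) [X in _ + X]big1 ?addr0// => j _; rewrite wr mul0r.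
  apply/rowP => q; rewrite mxE -(splitK q); case: (fintype.split q) => j /=; [exact: wl|exact: wr].
pose v : 'rV[F]_(m + l) := \row_k x`_k.+1.
have vM : v *m M = 0.
  apply/rowP => q; rewrite !mxE -(splitK q); case: (fintype.split q) => j /=.
    by rewrite -[RHS](xal j) shift0//; apply: eq_bigr => k _; rewrite mxE Ml.
  by rewrite -[RHS](xdk j) shift0//; apply: eq_bigr => k _; rewrite mxE Mr.
have v0 : v = 0 by rewrite -(mulmxK uM v) vM mul0mx.
apply/polyP => -[|k]; first by rewrite coef0 -horner_coef0.
rewrite coef0; have [kn|kn] := ltnP k (m + l).
  by have := congr1 (fun v : 'rV_(m + l) => v 0 (Ordinal kn)) v0; rewrite !mxE.
by rewrite nth_default// (leq_trans sx).
Qed.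

End SystemMatrix.

(** * Exchange of a sum and an integral under absolute convergence *)

Section AbsoluteSeries.
Context {R : realType} d {T : measurableType d} (mu : {measure set T -> \bar R}).
Local Notation C := R[i].

(** The sum [G] of the moduli is integrable by Tonelli, hence finite almost everywhere, and
    dominates the partial sums. *)
Lemma cint_abs_csum (D : set T) (c : R) (f : nat -> T -> C) (g : T -> C) :
  measurable D -> 0 < c -> (forall h, cmeasurable D (f h)) ->
  (forall y, D y -> has_csum (fun h => (c ^+ h)%:C * f h y) (g y)) ->
  (\sum_(0 <= h <oo) ((c ^+ h)%:E * \int[mu]_(y in D) (cabs (f h y))%:E) < +oo)%E ->
  cintegrable mu D g /\
  has_csum (fun h => (c ^+ h)%:C * cint mu D (f h)) (cint mu D g).
Proof.
move=> mD c0 mf fg abs.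
have ch0 h : 0 <= c ^+ h by rewrite exprn_ge0// ltW.
pose u h y : C := (c ^+ h)%:C * f h y.
have mu_ h : cmeasurable D (u h) by apply: cmeasurableM => //; exact: cmeasurable_cst.
pose G y : \bar R := (\sum_(0 <= h <oo) (cabs (u h y))%:E)%E.
have mcu h : measurable_fun D (fun y => (cabs (u h y))%:E).
  exact/measurable_EFinP/cmeasurable_cabs.
have u_ge0 h y : (0 <= (cabs (u h y))%:E)%E by rewrite lee_fin cabs_ge0.
have uE h : (\int[mu]_(y in D) (cabs (u h y))%:E =
    (c ^+ h)%:E * \int[mu]_(y in D) (cabs (f h y))%:E)%E.
  rewrite -ge0_integralZl_EFin//.
  - by apply: eq_integral => y _; rewrite /u cabsM cabs_real ger0_norm.
  - by move=> y _; rewrite lee_fin cabs_ge0.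
  - exact/measurable_EFinP/cmeasurable_cabs.
have Gint : (\int[mu]_(y in D) G y < +oo)%E.
  rewrite integral_nneseries//; first by under eq_eseriesr do rewrite uE.
have G_ge0 y : (0 <= G y)%E by apply: nneseries_ge0 => h _ _; exact: u_ge0.
have mG : measurable_fun D G.
  have := @ge0_emeasurable_sum _ T R D (fun h y => (cabs (u h y))%:E) xpredT
    (fun h y _ _ => u_ge0 h y) (fun h _ => mcu h).
  exact.
have iG : mu.-integrable D G.
  apply/integrableP; split => //.
  rewrite (eq_integral G)// => y _; exact: gee0_abs.
have mfG : measurable_fun D (fun y => fine (G y)) by exact: measurableT_comp.
have ifG : mu.-integrable D (EFin \o (fun y => fine (G y))).
  apply: (le_integrable mD _ _ iG); first exact/measurable_EFinP.
  move=> y _ /=; case: (G y) (G_ge0 y) => [x|//|//] _ //=.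
  by rewrite normr0 leey.
have Gfin := integrable_ae mD iG.
have dom y n : G y \is a fin_num -> \sum_(0 <= h < n) cabs (u h y) <= fine (G y).
  move=> Gy; rewrite -lee_fin fineK// -sumEFin.
  exact: (@nneseries_lim_ge R (fun h => (cabs (u h y))%:E) xpredT 0%N n (fun h _ _ => u_ge0 h y)).
have mg : cmeasurable D g.
  apply: (cmeasurable_cvg (u := fun n y => \sum_(0 <= h < n) u h y)).
    by move=> n; apply: cmeasurable_sum.
  by move=> y /fg /has_csumP.
have iu h : cintegrable mu D (u h).
  apply: (cintegrable_le (g := fun y => cabs (u h y))) => //.
  apply/integrableP; split; first exact: mcu.
  rewrite (eq_integral (fun y => (cabs (u h y))%:E)); last by move=> y _; apply: gee0_abs; exact: u_ge0.
  rewrite uE; apply: le_lt_trans abs.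
  apply: le_trans (nneseries_lim_ge h.+1 _).
    rewrite big_nat_recr//= leeDr// sume_ge0// => i _.
    by apply: mule_ge0; [rewrite lee_fin|apply: integral_ge0 => y _; rewrite lee_fin cabs_ge0].
  by move=> i _ _; apply: mule_ge0; [rewrite lee_fin|apply: integral_ge0 => y _; rewrite lee_fin cabs_ge0].
have cvgu : ccvg \oo (fun n => cint mu D (fun y => \sum_(0 <= h < n) u h y)) (cint mu D g).
  apply: (cint_dct (g := fun y => fine (G y))) => //.
  - by move=> n; exact: cmeasurable_sum.
  - by apply: aeW => y /fg /has_csumP.
  - apply: filterS Gfin => y Gy n /Gy Gyn.
    by apply: le_trans (dom y n Gyn); exact: ler_cabs_sum.
split.
  have dg y : D y -> ((cabs (g y))%:E <= G y)%E.
    move=> Dy; have [Gy|] := boolP (G y \is a fin_num); last first.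
      by rewrite ge0_fin_numE// -leNgt leye_eq => /eqP ->; rewrite leey.
    have h := ccvg_cabs ((has_csumP _ _).1 (fg y Dy)).
    have cK : (fun=> fine (G y)) @ \oo --> fine (G y) by exact: cvg_cst.
    rewrite -[G y]fineK// lee_fin; apply: (ler_cvg_to (h _) cK); apply: nearW => n.
    by apply: le_trans (dom y n Gy); exact: ler_cabs_sum.
  have [mr mi] := mg; split; apply: (le_integrable mD _ _ iG);
    try exact/measurable_EFinP; move=> y Dy; rewrite [leRHS]gee0_abs//;
    apply: le_trans (dg y Dy); rewrite lee_fin; [exact: ler_Re_cabs|exact: ler_Im_cabs].
apply/has_csumP; move: cvgu; congr ccvg; apply/funext => n.
rewrite cint_sum//; apply: eq_bigr => h _.
have ch : ((c ^+ h)%:C : C) != 0 by rewrite fmorph_eq0 expf_neq0// gt_eqF.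
rewrite /u cintZ//.
rewrite (_ : f h = fun y => (c ^+ h)%:C^-1 * u h y); first exact: cintegrableZ.
by apply/funext => y; rewrite /u mulKf.
Qed.

End AbsoluteSeries.

(** * The linear systems for a != 1 *)

Section Systems.
Context {R : realType}.
Local Notation C := R[i].
Variables (l m : nat) (s_ : 'I_l -> C) (t_ : 'I_m -> C) (NB NA : {poly C}).
Variables (w a p r : R) (nu : probability R R).
Local Notation n := (m + l)%N.
Local Notation DY := (D_Y s_ t_).
Local Notation NY := (N_Y NB NA).
Local Notation c := (r * p).
Hypotheses (s_neg : forall j, Re (s_ j) < 0) (t_neg : forall i, Re (t_ i) < 0).
Hypotheses (sD : size DY = n.+1) (sN : (size NY <= n)%N) (D0 : DY.[0] != 0)
  (ND0 : NY.[0] = DY.[0]).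
Hypotheses (a_gt0 : 0 < a) (w_ge0 : 0 <= w) (r_gt0 : 0 < r) (r_lt1 : r < 1)
  (p_gt0 : 0 < p) (p_lt1 : p < 1).

Let c_gt0 : 0 < c. Proof. exact: mulr_gt0. Qed.
Let c_ge0 : 0 <= c. Proof. exact: ltW. Qed.
Let c_lt1 : c < 1. Proof. by rewrite mulr_ilt1// ltW. Qed.
Let sND : (size NY < size DY)%N. Proof. by rewrite sD ltnS. Qed.

Definition poly_of_coefs (b : 'I_n.+1 -> C) : {poly C} := \poly_(k < n.+1) b (inord k).

Lemma coef_poly_of_coefs b (k : 'I_n.+1) : (poly_of_coefs b)`_k = b k.
Proof. by rewrite coef_poly ltn_ord inord_val. Qed.

Lemma horner_poly_of_coefs b s : (poly_of_coefs b).[s] = polyval b s.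
Proof.
by rewrite horner_poly; apply: eq_bigr => k _; rewrite inord_val.
Qed.

Lemma polyval_coef (q : {poly C}) s : (size q <= n.+1)%N ->
  polyval (fun k : 'I_n.+1 => q`_k) s = q.[s].
Proof. by move=> sq; rewrite (horner_coef_wide _ sq). Qed.

Local Notation sol := (transform_solution DY NY n.+1 a p r).
Local Notation defect := (s_defect NY p r nu).
Local Notation orbit h s := ((a ^+ h)%:C * s).
Local Notation wt := (weight DY NY a c).

Lemma DY_root_t i : root DY (- t_ i).
Proof.
apply/rootP; rewrite hornerM horner_compN opprK /prod_roots !horner_prod.
by rewrite [X in _ * X](bigD1 i)//= hornerXsubC subrr mul0r mulr0.
Qed.

Let Re_orbit h s : 0 <= Re s -> 0 <= Re (orbit h s).
Proof. by move=> s0; rewrite ReMl mulr_ge0// exprn_ge0// ltW. Qed.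

Lemma solution_orbit psi U Cp s h : sol psi U Cp -> 0 <= Re s ->
  DY.[orbit h s] * (U (orbit h s) - psi (orbit h s)) =
  c%:C * NY.[orbit h s] * U (orbit h.+1 s) + Cp.[orbit h s].
Proof.
move=> hs s0; have -> : orbit h.+1 s = a%:C * orbit h s by rewrite exprS rmorphM mulrA.
by rewrite (ts_eq hs) ?Re_orbit.
Qed.

(** D_Y vanishes at -t_i, which lies in the right half-plane, where the functional equation
    holds. *)
Lemma t_equation psi U Cp i : sol psi U Cp ->
  - c%:C * NY.[- t_ i] * U (- (a%:C * t_ i)) = Cp.[- t_ i].
Proof.
move=> hs; have t0 : 0 <= Re (- t_ i) by rewrite ReN oppr_ge0 ltW.
have := ts_eq hs t0; rewrite (rootP (DY_root_t i)) mul0r => /esym/eqP.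
by rewrite addrC addr_eq0 mulrN => /eqP ->; rewrite !mulNr.
Qed.

Hypothesis a_neq1 : a != 1.

Section TSystem.
Variable i : 'I_m.
Let z := - t_ i.
Let az := a%:C * z.

Let z_neq0 : z != 0.
Proof. by rewrite oppr_eq0; apply: contraTneq (t_neg i) => ->; rewrite ltxx. Qed.

Let Re_az : 0 <= Re az.
Proof. by rewrite ReMl mulr_ge0 ?(ltW a_gt0)// ReN oppr_ge0 ltW. Qed.

Let orbit_az h : orbit h az = - ((a ^+ h.+1)%:C * t_ i).
Proof. by rewrite /az /z exprSr rmorphM; ring. Qed.

Let t_prodE h : \prod_(j < h) Phi_Y s_ t_ NB NA (- ((a ^+ j.+1)%:C * t_ i)) =
  \prod_(j < h) (NY.[orbit j az] / DY.[orbit j az]).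
Proof. by apply: eq_bigr => j _; rewrite /Phi_Y orbit_az. Qed.

Lemma has_csum_t_coef (k : 'I_n.+1) : has_csum (t_coef_term s_ t_ NB NA a p r i k)
  (z ^- k * csum (monomial_term DY NY a c az k)).
Proof.
have kD : (k < size DY)%N by rewrite sD.
have := has_csumZ (c := z ^- k)
  (has_csum_monomial sND D0 ND0 a_gt0 a_neq1 c_ge0 c_lt1 (s := az) kD).
congr has_csum; apply/funext => h.
rewrite /t_coef_term /monomial_term /weight t_prodE orbit_az.
have -> : (- ((a ^+ h.+1)%:C * t_ i)) ^+ k = (a ^+ (k * h.+1))%:C * z ^+ k.
  by rewrite -mulrN exprMn -rmorphXn -exprM mulnC.
have zk : z ^+ k != 0 by rewrite expf_neq0.
rewrite -[RHS]mul1r -(mulVf zk); ring.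
Qed.

Lemma t_coef_functional (k : 'I_n.+1) :
  z ^+ k * (1 + c%:C * NY.[z] * csum (t_coef_term s_ t_ NB NA a p r i k)) =
  pole_functional DY NY a c z (fun y => y ^+ k).
Proof.
rewrite (has_csumE (has_csum_t_coef (k := k))) /pole_functional.
have zk : z ^+ k != 0 by rewrite expf_neq0.
rewrite mulrDr mulr1; congr (_ + _).
by rewrite mulrCA mulrA -mulrA [z ^+ k * _]mulrA mulfV// mul1r.
Qed.

Lemma t_rhsE h : t_rhs_term s_ t_ NB NA w a p r i h =
  wt az h * cexp (- (orbit h az * w%:C)).
Proof.
rewrite /t_rhs_term /weight t_prodE orbit_az mulNr opprK; ring.
Qed.

Lemma t_convergent_holds : t_convergent s_ t_ NB NA w a p r i.
Proof.
split=> [k|]; first exact: has_csum_cvg (has_csum_t_coef (k := k)).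
have h := @weight_bounded_csum _ _ _ _ _ sND D0 ND0 a_gt0 a_neq1 c_ge0 c_lt1 az
  (fun h => cexp (- (orbit h az * w%:C))) 1 ler01.
apply: (@has_csum_cvg _ _ (csum (fun h => wt az h * cexp (- (orbit h az * w%:C))))).
rewrite (_ : t_rhs_term _ _ _ _ _ _ _ _ _ = fun h => wt az h * cexp (- (orbit h az * w%:C))).
  by apply: h => h; apply: cabs_cexp_line_le1 => //; exact: Re_orbit.
by apply/funext => h'; exact: t_rhsE.
Qed.

(** The orbit expansion at -a t_i is inserted into [t_equation]. The source is arbitrary: the
    exponential gives the system of the theorem, and 0 gives the homogeneous equations met by the
    dual remainders. *)
Lemma t_functional_solution psi U Cp (L : R) : sol psi U Cp ->
  0 <= L -> (forall s, 0 <= Re s -> cabs (psi s) <= L) -> t_regular s_ t_ a i ->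
  \sum_(k < n.+1) Cp`_k * pole_functional DY NY a c z (fun y => y ^+ k) =
  - c%:C * NY.[z] * csum (fun h => wt az h * psi (orbit h az)).
Proof.
move=> hs L0 hpsi reg.
have [K K0 hK] := ts_bnd hs.
have := @orbit_expansion_split _ _ _ _ _ sND D0 ND0 a_gt0 a_neq1 c_ge0 c_lt1 U psi Cp az K L.
rewrite sD => /(_ (ts_size hs) L0) hU.
have {}hU := hU (fun h => hpsi _ (Re_orbit h Re_az)) (fun h => hK _ (Re_orbit h Re_az)).
have {}hU : U az = csum (fun h => wt az h * psi (orbit h az)) +
    \sum_(k < n.+1) Cp`_k * csum (monomial_term DY NY a c az k).
  apply: hU => h; last exact: solution_orbit.
  by rewrite orbit_az; exact: reg.
have := t_equation i hs; rewrite -mulrN -/z -/az hU => e.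
have -> : \sum_(k < n.+1) Cp`_k * pole_functional DY NY a c z (fun y => y ^+ k) =
    Cp.[z] + c%:C * NY.[z] * \sum_(k < n.+1) Cp`_k * csum (monomial_term DY NY a c az k).
  rewrite (horner_coef_wide _ (ts_size hs)) mulr_sumr -big_split /=.
  by apply: eq_bigr => k _; rewrite /pole_functional mulrDr; congr (_ + _); rewrite mulrCA.
by rewrite -e; ring.
Qed.

End TSystem.

Section SSystem.
Variable j : 'I_l.
Let s := s_ j.
Let D : set R := `]-oo, 0[%classic.
Let mD : measurable D. Proof. exact: measurable_itv. Qed.

Let s_neq0 : s != 0.
Proof. by apply: contraTneq (s_neg j) => e; rewrite -/s e ltxx. Qed.

Let ray (y : R) : D y -> 0 <= Re (s * y%:C).
Proof. by rewrite /D /= in_itv /= => y0; rewrite ReMr mulr_le0 ?ltW// s_neg. Qed.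

Let orbit_ray h (y : R) : (a ^+ h)%:C * s * y%:C = orbit h (s * y%:C).
Proof. by rewrite mulrA. Qed.

Let ray_prod h (y : R) : \prod_(i < h) Phi_Y s_ t_ NB NA ((a ^+ i)%:C * s * y%:C) =
  \prod_(i < h) (NY.[orbit i (s * y%:C)] / DY.[orbit i (s * y%:C)]).
Proof. by apply: eq_bigr => i _; rewrite /Phi_Y orbit_ray. Qed.

Let d_int k := d_integrand s_ t_ NB NA a j k.

Let d_intE k h y : s ^+ k * ((c ^+ h)%:C * d_int k h y) = monomial_term DY NY a c (s * y%:C) k h.
Proof.
rewrite /d_int /d_integrand ray_prod orbit_ray /monomial_term /weight.
have -> : orbit h (s * y%:C) ^+ k = s ^+ k * ((a ^+ h * y) ^+ k)%:C.
  have -> : ((a ^+ h * y) ^+ k)%:C = ((a ^+ h)%:C * y%:C) ^+ k by rewrite rmorphXn rmorphM.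
  by rewrite -[RHS]exprMn; congr (_ ^+ _); ring.
ring.
Qed.

Let cm_orbit h : cmeasurable D (fun y : R => (a ^+ h)%:C * s * y%:C).
Proof.
apply: cmeasurableM; first exact: cmeasurable_cst.
by apply: cmeasurable_real; exact: measurable_id.
Qed.

Let cm_Phi i : cmeasurable D (fun y : R => Phi_Y s_ t_ NB NA ((a ^+ i)%:C * s * y%:C)).
Proof.
apply: cmeasurableM; first exact: cmeasurable_horner.
by apply: cmeasurableV; exact: cmeasurable_horner.
Qed.

Let cm_d_int k h : cmeasurable D (d_int k h).
Proof.
apply: cmeasurableM; last by apply: cmeasurableV; exact: cmeasurable_horner.
apply: cmeasurableM; last by apply: cmeasurable_prod => i _; exact: cm_Phi.
apply: cmeasurable_real; apply: measurable_funX; apply: measurable_funM => //.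
Qed.

Let gk (k : nat) (y : R) : C := s ^- k * csum (monomial_term DY NY a c (s * y%:C) k).

Let has_gk (k : 'I_n.+1) (y : R) : has_csum (fun h => (c ^+ h)%:C * d_int k h y) (gk k y).
Proof.
have kD : (k < size DY)%N by rewrite sD.
have := has_csumZ (c := s ^- k)
  (has_csum_monomial sND D0 ND0 a_gt0 a_neq1 c_ge0 c_lt1 (s := s * y%:C) kD).
congr has_csum; apply/funext => h; rewrite -d_intE mulrA mulVf ?mul1r//.
by rewrite expf_neq0.
Qed.

Definition psi_integrand (psi : C -> C) (h : nat) (y : R) : C :=
  psi (orbit h (s * y%:C)) * \prod_(i < h) (NY.[orbit i (s * y%:C)] / DY.[orbit i (s * y%:C)]).

(** The expansion of U along the ray s_j y is integrated term by term. Keeping the source and the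
    defect general makes it serve both for U, with defect 0, and for the dual solutions, with source
    0. *)
Lemma s_functional_solution psi U Cp (L : R) : sol psi U Cp ->
  0 <= L -> (forall s, 0 <= Re s -> cabs (psi s) <= L) ->
  (forall h, cmeasurable D (fun y : R => psi (orbit h (s * y%:C)))) ->
  {ae nu, forall y, forall h : nat, DY.[(a ^+ h)%:C * s * y%:C] != 0} ->
  (forall k : 'I_n.+1, abs_convergent p r nu (d_int k)) ->
  abs_convergent p r nu (psi_integrand psi) ->
  \sum_(k < n.+1) d_coef s_ t_ NB NA a p r nu j k * Cp`_k =
  defect U Cp s + (r * (1 - p))%:C * NY.[s] *
    csum (fun h => (c ^+ h)%:C * cint nu D (psi_integrand psi h)).
Proof.
move=> hs L0 hpsi mpsi reg dabs pabs.
pose g (y : R) := csum (fun h => wt (s * y%:C) h * psi (orbit h (s * y%:C))).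
have pE h y : (c ^+ h)%:C * psi_integrand psi h y = wt (s * y%:C) h * psi (orbit h (s * y%:C)).
  by rewrite /psi_integrand /weight; ring.
have hg y : D y -> has_csum (fun h => (c ^+ h)%:C * psi_integrand psi h y) (g y).
  move=> /ray y0.
  have := @weight_bounded_csum _ _ _ _ _ sND D0 ND0 a_gt0 a_neq1 c_ge0 c_lt1 (s * y%:C)
    (fun h => psi (orbit h (s * y%:C))) L L0 (fun h => hpsi _ (Re_orbit h y0)).
  by congr has_csum; apply/funext => h; rewrite pE.
have mp h : cmeasurable D (psi_integrand psi h).
  apply: cmeasurableM; first exact: mpsi.
  under [X in cmeasurable _ X]eq_fun do rewrite -ray_prod.
  by apply: cmeasurable_prod => i _; exact: cm_Phi.
have [ig /has_csumE eg] := cint_abs_csum mD c_gt0 mp hg pabs.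
have hk (k : 'I_n.+1) := cint_abs_csum mD c_gt0 (cm_d_int k) (fun y _ => @has_gk k y) (dabs k).
have [K K0 hK] := ts_bnd hs.
(* The expansion fails only where the orbit of s_j y meets a zero of D_Y, which is negligible for
   [nu] by assumption. *)
have UE : {ae nu, forall y, D y ->
    U (s * y%:C) = g y + \sum_(k < n.+1) (s ^+ k * Cp`_k) * gk k y}.
  apply: filterS reg => y hreg /ray y0.
  have := @orbit_expansion_split _ _ _ _ _ sND D0 ND0 a_gt0 a_neq1 c_ge0 c_lt1 U psi Cp
    (s * y%:C) K L.
  rewrite sD => /(_ (ts_size hs) L0) hU.
  rewrite (hU (fun h => hpsi _ (Re_orbit h y0)) (fun h => hK _ (Re_orbit h y0))
    (fun h => _) (fun h => solution_orbit h hs y0)); last first.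
    by move=> h; rewrite -orbit_ray.
  congr (_ + _); apply: eq_bigr => k _.
  have sk : s ^+ k != 0 by rewrite expf_neq0.
  by rewrite /gk -[LHS]mul1r -(mulfV sk); ring.
have isum : cintegrable nu D (fun y => \sum_(k < n.+1) (s ^+ k * Cp`_k) * gk k y).
  by apply: cintegrable_sum => // k; apply: cintegrableZ => //; have [] := hk k.
have intU : cint nu D (fun y => U (s * y%:C)) =
    cint nu D g + \sum_(k < n.+1) (s ^+ k * Cp`_k) * cint nu D (gk k).
  rewrite (ae_eq_cint mD _ _ UE); last 2 first.
  - exact: (ts_meas hs (s_neg j)).
  - exact: (cintegrable_measurable (cintegrableD mD ig isum)).
  rewrite cintD// cint_sum//; last first.
    by move=> k; apply: cintegrableZ => //; have [] := hk k.
  by congr (_ + _); apply: eq_bigr => k _; rewrite cintZ//; have [] := hk k.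
have -> : csum (fun h => (c ^+ h)%:C * cint nu D (psi_integrand psi h)) = cint nu D g.
  exact: eg.
rewrite /s_defect intU (horner_coef_wide _ (ts_size hs)).
have dE (k : 'I_n.+1) : d_coef s_ t_ NB NA a p r nu j k =
    s ^+ k * (1 - (r * (1 - p))%:C * NY.[s] * cint nu D (gk k)).
  by rewrite /d_coef; have [_ /has_csumE <-] := hk k.
transitivity (\sum_(k < n.+1) (Cp`_k * s ^+ k - (r * (1 - p))%:C * NY.[s] *
    (s ^+ k * Cp`_k * cint nu D (gk k)))).
  by apply: eq_bigr => k _; rewrite dE; ring.
by rewrite sumrB -mulr_sumr; ring.
Qed.

End SSystem.


Variables (U : C -> C) (Cp : {poly C}).
Let psi (s : C) : C := cexp (- (s * w%:C)).
Hypothesis U_sol : sol psi U Cp.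
Hypothesis U_defect : forall j, defect U Cp (s_ j) = 0.
Hypothesis dual : injective s_ -> exists (v : 'I_l -> C -> C) (X : 'I_l -> {poly C}),
  [/\ forall j, sol (fun=> 0) (v j) (X j), forall j, (X j).[0] = 0 &
      forall i j, defect (v j) (X j) (s_ i) = (i == j)%:R].

Let psi_le1 s : 0 <= Re s -> cabs (psi s) <= 1.
Proof. by move=> s0; exact: cabs_cexp_line_le1. Qed.

Lemma t_system_sum b i : t_system s_ t_ NB NA w a p r b i <->
  \sum_(k < n.+1) b k * pole_functional DY NY a c (- t_ i) (fun y => y ^+ k) =
  - c%:C * NY.[- t_ i] * csum (fun h => wt (a%:C * - t_ i) h * psi (orbit h (a%:C * - t_ i))).
Proof.
rewrite /t_system (_ : t_rhs_term _ _ _ _ _ _ _ _ _ =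
  fun h => wt (a%:C * - t_ i) h * psi (orbit h (a%:C * - t_ i))); last first.
  by apply/funext => h; rewrite t_rhsE.
rewrite (_ : \sum_(k < _) _ = \sum_(k < n.+1) b k *
  pole_functional DY NY a c (- t_ i) (fun y => y ^+ k))//.
by apply: eq_bigr => k _; rewrite -t_coef_functional; ring.
Qed.

Let psi_ray j h : cmeasurable (`]-oo, 0[%classic : set R)
  (fun y : R => psi (orbit h (s_ j * y%:C))).
Proof.
apply: cmeasurable_cexp; apply: cmeasurableN; apply: cmeasurableM; last exact: cmeasurable_cst.
apply: cmeasurableM; first exact: cmeasurable_cst.
apply: cmeasurableM; first exact: cmeasurable_cst.
by apply: cmeasurable_real; exact: measurable_id.
Qed.

Let s_rhs_integrandE j : s_rhs_integrand s_ t_ NB NA w a j = psi_integrand j psi.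
Proof.
apply/funext => h; apply/funext => y; rewrite /s_rhs_integrand /psi_integrand /psi.
rewrite (mulrA _ (s_ j)); congr (_ * _).
by apply: eq_bigr => i _; rewrite /Phi_Y !mulrA.
Qed.

Lemma s_system_sum j : s_regular s_ t_ NB NA w a p r nu j ->
  s_system s_ t_ NB NA w a p r nu (fun k => Cp`_k) j.
Proof.
move=> [reg dabs pabs]; rewrite /s_system; rewrite s_rhs_integrandE in pabs *.
have := s_functional_solution U_sol ler01 psi_le1 (psi_ray j) reg dabs pabs.
by rewrite U_defect add0r.
Qed.

(** For uniqueness, the difference of two candidates solves the homogeneous systems with constant
    coefficient 0. [system_unique] applies, fed with the dual remainders and with the independence
    of the pole functionals. *)
Lemma series_systems : exists ak : 'I_n.+1 -> C,
 [/\ ak ord0 = Cp.[0],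
     forall s : C, 0 <= Re s -> (forall h : nat, DY.[orbit h s] != 0) ->
       has_csum (U_term s_ t_ NB NA w a p r ak s) (U s),
     (forall i, - c%:C * NY.[- t_ i] * U (- (a%:C * t_ i)) = polyval ak (- t_ i)) /\
     (forall j, s_system1 s_ NB NA p r nu ak U j),
     (forall i, t_regular s_ t_ a i ->
        t_convergent s_ t_ NB NA w a p r i /\ t_system s_ t_ NB NA w a p r ak i) /\
     (forall j, s_regular s_ t_ NB NA w a p r nu j ->
        s_system s_ t_ NB NA w a p r nu ak j) &
     injective s_ -> injective t_ -> (forall i, t_regular s_ t_ a i) ->
     (forall j, s_regular s_ t_ NB NA w a p r nu j) ->
     forall b : 'I_n.+1 -> C, b ord0 = Cp.[0] ->
       (forall i, t_system s_ t_ NB NA w a p r b i) ->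
       (forall j, s_system s_ t_ NB NA w a p r nu b j) -> b =1 ak].
Proof.
have sC := ts_size U_sol; have [K K0 hK] := ts_bnd U_sol.
have tsys i : t_regular s_ t_ a i -> t_system s_ t_ NB NA w a p r (fun k => Cp`_k) i.
  by move=> reg; apply/t_system_sum; exact: (t_functional_solution U_sol ler01 psi_le1 reg).
exists (fun k : 'I_n.+1 => Cp`_k); split.
- by rewrite -horner_coef0.
- move=> s s0 Ds.
  have := @orbit_expansion _ _ _ _ _ sND D0 ND0 a_gt0 a_neq1 c_ge0 c_lt1 U psi Cp s K
    (fun h => hK _ (Re_orbit h s0)) Ds (fun h => solution_orbit h U_sol s0).
  congr has_csum; apply/funext => h.
  by rewrite /U_term polyval_coef// /weight /Phi_Y /psi; ring.
- split=> [i|j]; first by rewrite polyval_coef// (t_equation _ U_sol).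
  by rewrite /s_system1 polyval_coef//; apply/esym/eqP; rewrite -subr_eq0; apply/eqP; exact: U_defect.
- split=> [i reg|j]; last exact: s_system_sum.
  by split; [exact: t_convergent_holds|exact: tsys].
move=> s_inj t_inj treg sreg b b0 tb sb.
have [v [X [hv X0 vX]]] := dual s_inj.
pose al i (k : nat) := pole_functional DY NY a c (- t_ i) (fun y => y ^+ k).
pose dk j k := d_coef s_ t_ NB NA a p r nu j k.
pose x := poly_of_coefs b - Cp.
have xk (k : 'I_n.+1) : x`_k = b k - Cp`_k by rewrite coefB coef_poly_of_coefs.
suff x0 : x = 0 by move=> k; apply/eqP; rewrite -subr_eq0 -xk x0 coef0.
have zero1 (s : C) : 0 <= Re s -> cabs (0 : C) <= 0 by rewrite cabs0.
have azt i h : DY.[orbit h (a%:C * - t_ i)] != 0.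
  have -> : orbit h (a%:C * - t_ i) = - ((a ^+ h.+1)%:C * t_ i).
    by rewrite exprSr rmorphM; ring.
  exact: treg.
have csum00 : has_csum (fun=> 0 : C) 0.
  apply/has_csumP; rewrite (_ : (fun n => _) = fun=> 0); first exact: ccvg_cst.
  by apply/funext => k; rewrite big1.
apply: (@system_unique _ m l al dk X) => //.
- by move=> j; exact: (ts_size (hv j)).
- move=> i j; rewrite (t_functional_solution (hv j) (lexx 0) zero1 (treg i)).
  rewrite (_ : (fun h => _) = fun=> 0); last by apply/funext => h; rewrite mulr0.
  by rewrite (has_csumE csum00) mulr0.
- move=> i j; have [reg dabs _] := sreg i.
  have p0 : psi_integrand i (fun=> 0) = fun _ _ => 0.
    by apply/funext => h; apply/funext => y; rewrite /psi_integrand mul0r.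
  have pabs : abs_convergent p r nu (psi_integrand i (fun=> 0)).
    rewrite p0 /abs_convergent eseries0 ?ltry// => h _ _.
    by rewrite integral0_eq ?mule0// => y _; rewrite cabs0.
  have := s_functional_solution (hv j) (lexx 0) zero1
    (fun h => cmeasurable_cst _ 0) reg dabs pabs.
  rewrite vX (_ : (fun h => (c ^+ h)%:C * _) = fun=> 0); last first.
    by apply/funext => h; rewrite p0 cint0 mulr0.
  rewrite (has_csumE csum00) mulr0 addr0 => <-; apply: eq_bigr => k _; exact: mulrC.
- move=> la hla.
  apply: (@pole_functional_free _ DY NY a c n sD sN D0 ND0 a_gt0 a_neq1 c_ge0 c_lt1 m
    (fun i => - t_ i)) => //.
  + exact: leq_addr.
  + by move=> i j /oppr_inj/t_inj.
  + by move=> i; rewrite oppr_eq0; apply: contraTneq (t_neg i) => ->; rewrite ltxx.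
  + exact: DY_root_t.
- apply: leq_trans (size_polyD _ _) _; rewrite geq_max size_polyN sC andbT.
  exact: size_poly.
- rewrite hornerD hornerN horner_poly_of_coefs -b0 /polyval big_ord_recl expr0 mulr1.
  by rewrite big1 ?addr0 ?subrr// => k _; rewrite expr0n mulr0.
- move=> i; under eq_bigr do rewrite xk mulrBl.
  rewrite sumrB; apply/eqP; rewrite subr_eq0; apply/eqP.
  by rewrite (t_system_sum _ _).1// -((t_system_sum _ _).1 (tsys i (treg i))).
move=> j; under eq_bigr do rewrite xk mulrBl.
rewrite sumrB; apply/eqP; rewrite subr_eq0; apply/eqP.
transitivity (\sum_(k < n.+1) d_coef s_ t_ NB NA a p r nu j k * b k).
  by apply: eq_bigr => k _; rewrite mulrC.
rewrite sb -(s_system_sum (sreg j)).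
by apply: eq_bigr => k _; rewrite mulrC.
Qed.

End Systems.

(** * Zeros and value at 0 of D_Y *)

Section RootProducts.
Context {R : realType}.
Local Notation C := R[i].

Lemma prod_rootsE k (z_ : 'I_k -> C) : prod_roots z_ = poly_of_roots [seq z_ i | i <- enum 'I_k].
Proof. by rewrite /poly_of_roots big_map big_enum. Qed.

Lemma size_prod_roots k (z_ : 'I_k -> C) : size (prod_roots z_) = k.+1.
Proof. by rewrite prod_rootsE size_poly_of_roots size_map size_enum_ord. Qed.

Lemma root_prod_roots k (z_ : 'I_k -> C) i : root (prod_roots z_) (z_ i).
Proof. by rewrite prod_rootsE root_prod_XsubC map_f// mem_enum. Qed.

Lemma prod_roots_neq0 k (z_ : 'I_k -> C) s : (forall i, Re (z_ i) < 0) -> 0 <= Re s ->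
  (prod_roots z_).[s] != 0.
Proof.
move=> z0 s0; rewrite -[_ == 0]/(root _ s) prod_rootsE root_prod_XsubC.
by apply/negP => /mapP[i _ sz]; have := z0 i; rewrite -sz ltNge s0.
Qed.

Lemma prod_roots_opp k (z_ : 'I_k -> C) :
  prod_roots z_ \Po (- 'X) = (-1) ^+ k *: prod_roots (fun i => - z_ i).
Proof.
rewrite /prod_roots rmorph_prod /=.
rewrite (eq_bigr (fun i => (-1) *: ('X - (- z_ i)%:P))); last first.
  by move=> i _; rewrite comp_polyB comp_polyX comp_polyC scaleN1r polyCN opprB addrC.
by rewrite scaler_prod prodr_const card_ord.
Qed.

Lemma prod_roots_at0 k (z_ : 'I_k -> C) : (prod_roots z_).[0] = (-1) ^+ k * \prod_i z_ i.
Proof.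
rewrite /prod_roots horner_prod (eq_bigr (fun i => - z_ i)); last first.
  by move=> i _; rewrite hornerXsubC sub0r.
by rewrite prodrN card_ord.
Qed.

Variables (l m : nat) (s_ : 'I_l -> C) (t_ : 'I_m -> C).

Lemma D_Y_roots : D_Y s_ t_ =
  (-1) ^+ m *: poly_of_roots ([seq s_ j | j <- enum 'I_l] ++ [seq - t_ i | i <- enum 'I_m]).
Proof.
rewrite /D_Y prod_roots_opp -scalerAr prod_rootsE (prod_rootsE (fun i => - t_ i)).
by rewrite /poly_of_roots big_cat.
Qed.

Lemma size_D_Y : size (D_Y s_ t_) = (m + l).+1.
Proof.
rewrite D_Y_roots size_scale ?signr_eq0// size_poly_of_roots size_cat (size_map s_) (size_map (fun i => - t_ i)) !size_enum_ord.
by rewrite addnC.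
Qed.

Lemma const_a0E p r : const_a0 s_ t_ p r = (r / (1 - r) * (1 - p))%:C * (D_Y s_ t_).[0].
Proof.
rewrite /const_a0 /D_Y hornerM horner_compN oppr0 !prod_roots_at0 exprD; ring.
Qed.

End RootProducts.

(** * The linear systems for a = 1 *)

Section UnitSlopeSystems.
Context {R : realType}.
Local Notation C := R[i].
Variables (l m : nat) (s_ : 'I_l -> C) (t_ : 'I_m -> C) (NB NA : {poly C}).
Variables (w p r : R) (nu : probability R R).
Local Notation n := (m + l)%N.
Local Notation DY := (D_Y s_ t_).
Local Notation NY := (N_Y NB NA).
Local Notation c := (r * p).
Local Notation sol := (transform_solution DY NY n.+1 1 p r).
Local Notation defect := (s_defect NY p r nu).
Hypotheses (s_neg : forall j, Re (s_ j) < 0) (t_neg : forall i, Re (t_ i) < 0).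
Hypotheses (sN : (size NY <= n)%N) (axis : forall s, Re s = 0 -> cabs NY.[s] <= cabs DY.[s]).
Hypotheses (c_ge0 : 0 <= c) (c_lt1 : c < 1).

(** At x = 0 the polynomial D_Y - x N_Y is D_Y, whose zeros are the s_j on the left and the -t_i on
    the right; the continuation to x = r p preserves the number [m]. *)
Lemma den1_rhp_zeros : exists delta : 'I_m -> C, rhp_zeros (den1 s_ t_ NB NA p r) delta.
Proof.
have hE := D_Y_roots s_ t_; set rs := (_ ++ _) in hE.
have k0 : ((-1) ^+ m : C) != 0 by rewrite signr_eq0.
have srs : size rs = n by rewrite size_cat (size_map s_) (size_map (fun i => - t_ i)) !size_enum_ord addnC.
have cnt : count (fun z : C => 0 < Re z) rs = m.
  rewrite count_cat !count_map (eq_count (a2 := pred0)) ?count_pred0 ?add0n; last first.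
    by move=> j /=; rewrite ltNge (ltW (s_neg j)).
  rewrite (eq_count (a2 := predT)) ?count_predT -?enumT ?size_enum_ord// => i /=.
  by rewrite ReN oppr_gt0 t_neg.
have := @rhp_zeros_perturb R DY NY ((-1) ^+ m) rs c k0 hE; rewrite srs cnt.
apply => // z; rewrite mem_cat => /orP[|] /mapP[j _ ->]; first by rewrite lt_eqF.
by rewrite ReN oppr_eq0 lt_eqF.
Qed.

Variables (U : C -> C) (Cp : {poly C}).
Let psi (s : C) : C := cexp (- (s * w%:C)).
Hypothesis U_sol : sol psi U Cp.
Hypothesis U_defect : forall j, defect U Cp (s_ j) = 0.
Hypothesis dual : injective s_ -> exists (v : 'I_l -> C -> C) (X : 'I_l -> {poly C}),
  [/\ forall j, sol (fun=> 0) (v j) (X j), forall j, (X j).[0] = 0 &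
      forall i j, defect (v j) (X j) (s_ i) = (i == j)%:R].

Lemma unit_slope_systems : exists (ak : 'I_n.+1 -> C) (delta : 'I_m -> C),
  [/\ ak ord0 = Cp.[0],
      rhp_zeros (den1 s_ t_ NB NA p r) delta,
      forall s : C, 0 <= Re s -> DY.[s] - c%:C * NY.[s] != 0 ->
        U s = (DY.[s] * cexp (- (s * w%:C)) + polyval ak s) / (DY.[s] - c%:C * NY.[s]),
      (forall j, s_system1 s_ NB NA p r nu ak U j) /\
      (forall i, delta_system s_ t_ w ak delta i) &
      injective s_ -> forall (b : 'I_n.+1 -> C) (u : C -> C), b ord0 = Cp.[0] ->
        rhp_quotient (fun s => DY.[s] * cexp (- (s * w%:C)) + polyval b s)
                     (fun s => DY.[s] - c%:C * NY.[s]) u ->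
        (forall j, s_system1 s_ NB NA p r nu b u j) ->
        (forall i, delta_system s_ t_ w b delta i) -> b =1 ak].
Proof.
have [delta hdelta] := den1_rhp_zeros.
have sC := ts_size U_sol.
have denE s : (den1 s_ t_ NB NA p r).[s] = DY.[s] - c%:C * NY.[s].
  by rewrite /den1 hornerD hornerN hornerZ.
have quot s : 0 <= Re s ->
    (DY.[s] - c%:C * NY.[s]) * U s = DY.[s] * psi s + Cp.[s].
  by move=> s0; rewrite -denE; exact: (unit_slope_quotient U_sol s0).
exists (fun k : 'I_n.+1 => Cp`_k), delta; split => //.
- by rewrite -horner_coef0.
- move=> s s0 ds; rewrite polyval_coef//.
  by apply: (mulIf ds); rewrite divfK// mulrC quot.
- split=> [j|i].
    rewrite /s_system1 polyval_coef//; apply/esym/eqP; rewrite -subr_eq0.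
    by apply/eqP; exact: U_defect.
  rewrite /delta_system.
  have [d0 [g gE _]] := hdelta.
  have root_d : (den1 s_ t_ NB NA p r).[delta i] = 0.
    rewrite gE hornerM horner_prod (bigD1 i)//= hornerXsubC subrr mul0r mulr0//.
  have := quot _ (ltW (d0 i)); rewrite -denE root_d mul0r => /esym/eqP.
  rewrite addrC addr_eq0 (horner_coef_wide _ sC) => /eqP e.
  transitivity (\sum_(k < n.+1) Cp`_k * delta i ^+ k).
    by apply: eq_bigr => k _; rewrite mulrC.
  by rewrite e /psi mulNr mulrC.
move=> s_inj b u b0 qu sys _.
have [v [X [hv X0 vX]]] := dual s_inj.
have pE s : (poly_of_coefs b).[s] = polyval b s by rewrite horner_poly_of_coefs.
have bC : poly_of_coefs b = Cp.
  apply: (unit_slope_unique hdelta s_neg hv X0 vX U_sol U_defect).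
  - exact: size_poly.
  - rewrite pE -b0 /polyval big_ord_recl expr0 mulr1 big1 ?addr0// => k _.
    by rewrite expr0n mulr0.
  - have [h1 h2] := qu; split; last exact: h2.
    by move=> s s0 ds; rewrite pE; exact: h1.
  - move=> j; apply/eqP; rewrite subr_eq0 pE; apply/eqP; apply/esym; exact: sys.
by move=> k; rewrite -bC coef_poly_of_coefs.
Qed.

End UnitSlopeSystems.

Theorem theorem7 (R : realType)
  (d : measure_display) (T : measurableType d) (P : probability T R)
  (V A B : nat -> {RV P >-> R})
  (Vid : identically_distributed V)
  (Aid : identically_distributed A)
  (Bid : identically_distributed B)
  (indep : mutually_independent (joint_family V A B))
  (A_ge0 : {ae P, forall x, 0 <= A 0%N x})
  (B_ge0 : {ae P, forall x, 0 <= B 0%N x})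
  (V_int : P.-integrable setT (fun x => (V 0%N x)%:E))
  (BA_int : P.-integrable setT (fun x => (B 0%N x - A 0%N x)%:E))
  (w : R) (w_ge0 : 0 <= w)
  (a p : R) (a_gt0 : 0 < a) (p_gt0 : 0 < p) (p_lt1 : p < 1)
  (V_a : P [set x | V 0%N x = a] = p%:E)
  (V_neg : P [set x | V 0%N x < 0] = (1 - p)%:E)
  (d' : measure_display) (T' : measurableType d') (P' : probability T' R)
  (Vm : {RV P' >-> R})
  (Vm_law : forall E : set R, measurable E ->
     fine (P' (Vm @^-1` E)) =
       fine (P [set x | E (V 0%N x) /\ V 0%N x < 0])
         / fine (P [set x | V 0%N x < 0]))
  (l m : nat) (s_ : 'I_l -> R[i]) (t_ : 'I_m -> R[i]) (NB NA : {poly R[i]})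
  (s_neg : forall j, complex.Re (s_ j) < 0)
  (t_neg : forall i, complex.Re (t_ i) < 0)
  (NB_deg : (size NB <= l)%N) (NA_deg : (size NA <= m)%N)
  (NB_coprime : forall z, root (prod_roots s_) z -> ~~ root NB z)
  (NA_coprime : forall z, root (prod_roots t_) z -> ~~ root NA z)
  (Phi_B : forall s : R[i], 0 <= complex.Re s ->
     LST P (B 0%N) s = NB.[s] / (prod_roots s_).[s])
  (Phi_A : forall s : R[i], 0 <= complex.Re s ->
     LST P (A 0%N) s = NA.[s] / (prod_roots t_).[s])
  (r : R) (r_gt0 : 0 < r) (r_lt1 : r < 1) :
  let U : R[i] -> R[i] := U_W P V A B w r in
  let nu : probability R R := distribution P' Vm in
  let DY := D_Y s_ t_ in
  let NY := N_Y NB NA in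
  let a0 := const_a0 s_ t_ p r in
  (a = 1 ->
   exists (ak : 'I_(m + l).+1 -> R[i]) (delta : 'I_m -> R[i]),
   [/\ ak ord0 = a0,
       rhp_zeros (den1 s_ t_ NB NA p r) delta,
       forall s : R[i], 0 <= complex.Re s ->
         DY.[s] - (r * p)%:C * NY.[s] != 0 ->
         U s = (DY.[s] * cexp (- (s * w%:C)) + polyval ak s)
                 / (DY.[s] - (r * p)%:C * NY.[s]),
       (forall j, s_system1 s_ NB NA p r nu ak U j) /\
       (forall i, delta_system s_ t_ w ak delta i) &
       (* the systems determine the constants when the s_j are distinct *)
       injective s_ ->
       forall (b : 'I_(m + l).+1 -> R[i]) (u : R[i] -> R[i]),
         b ord0 = a0 ->
         rhp_quotient (fun s => DY.[s] * cexp (- (s * w%:C)) + polyval b s)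
                      (fun s => DY.[s] - (r * p)%:C * NY.[s]) u ->
         (forall j, s_system1 s_ NB NA p r nu b u j) ->
         (forall i, delta_system s_ t_ w b delta i) ->
         b =1 ak])
  /\
  (a <> 1 ->
   exists ak : 'I_(m + l).+1 -> R[i],
   [/\ ak ord0 = a0,
       forall s : R[i], 0 <= complex.Re s ->
         (forall h : nat, DY.[(a ^+ h)%:C * s] != 0) ->
         has_csum (U_term s_ t_ NB NA w a p r ak s) (U s),
       (* both systems before U_W is replaced by its series *)
       (forall i, - (r * p)%:C * NY.[- t_ i] * U (- (a%:C * t_ i))
                    = polyval ak (- t_ i)) /\
       (forall j, s_system1 s_ NB NA p r nu ak U j),
       (forall i, t_regular s_ t_ a i ->
          t_convergent s_ t_ NB NA w a p r i /\
          t_system s_ t_ NB NA w a p r ak i) /\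
       (forall j, s_regular s_ t_ NB NA w a p r nu j ->
          s_system s_ t_ NB NA w a p r nu ak j) &
       (* the systems determine the constants when the s_j and the t_i are
          distinct *)
       injective s_ -> injective t_ ->
       (forall i, t_regular s_ t_ a i) ->
       (forall j, s_regular s_ t_ NB NA w a p r nu j) ->
       forall b : 'I_(m + l).+1 -> R[i],
         b ord0 = a0 ->
         (forall i, t_system s_ t_ NB NA w a p r b i) ->
         (forall j, s_system s_ t_ NB NA w a p r nu b j) ->
         b =1 ak]).
Proof.
move=> U nu DY NY a0.
have DA0 s : 0 <= Re s -> (prod_roots t_).[s] != 0 by exact: prod_roots_neq0.
have DB0 s : 0 <= Re s -> (prod_roots s_).[s] != 0 by exact: prod_roots_neq0.
have overshoot k (z_ : 'I_k -> R[i]) (N : {poly R[i]}) (X : {RV P >-> R}) :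
    (forall i, Re (z_ i) < 0) -> (size N <= k)%N -> {ae P, forall x, 0 <= X x} ->
    (forall s : R[i], 0 <= Re s -> LST P X s = N.[s] / (prod_roots z_).[s]) ->
    exists Q, overshoot_poly P X (prod_roots z_) N k Q.
  move=> z0 sN X0 lst.
  have [||//||Q] := @overshoot_poly_exists R d T P X [seq z_ i | i <- enum 'I_k] N.
  - by move=> z /mapP[i _ ->].
  - by rewrite size_map size_enum_ord.
  - by move=> s s0; rewrite lst// prod_rootsE.
  by rewrite size_map size_enum_ord -/(poly_of_roots _) -prod_rootsE; exists Q.
have [QA opA] := overshoot _ _ _ _ t_neg NA_deg A_ge0 Phi_A.
have [QB opB] := overshoot _ _ _ _ s_neg NB_deg B_ge0 Phi_B.
have lstA (s : R[i]) : 0 <= Re s -> (prod_roots t_).[s] * LST P (A 0%N) s = NA.[s].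
  by move=> s0; rewrite Phi_A// mulrC divfK// DA0.
have lstB (s : R[i]) : 0 <= Re s -> (prod_roots s_).[s] * LST P (B 0%N) s = NB.[s].
  by move=> s0; rewrite Phi_B// mulrC divfK// DB0.
(* The conditional law enters as a quotient of probabilities; the integrals use it as a measure
   scaled by 1 - p. *)
have nuE E : measurable E ->
    P (V 0%N @^-1` E `&` [set t | V 0%N t < 0]) = ((1 - p)%:E * nu E)%E.
  move=> mE; have := Vm_law E mE; rewrite V_neg [fine (1 - p)%:E]/= => e.
  have p1 : 1 - p != 0 by rewrite subr_eq0 gt_eqF.
  have mS : measurable (V 0%N @^-1` E `&` [set t | V 0%N t < 0]).
    apply: measurableI; first exact: measurable_preimage_fun.
    rewrite (_ : [set t | _] = V 0%N @^-1` `]-oo, 0[); last first.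
      by apply/seteqP; split=> t; rewrite /= in_itv.
    by apply: measurable_preimage_fun => //; exact: measurable_itv.
  rewrite -[LHS]fineK ?fin_num_measure//.
  rewrite -[nu E]fineK ?fin_num_measure// -EFinM; congr EFin.
  by rewrite /nu /distribution /pushforward e mulrC divfK.
have ord0m : 0 <= Re (0 : R[i]) by [].
have [Cp [U_sol U_def C0]] := reflected_solution Vid Aid Bid indep A_ge0 B_ge0 a_gt0 p_lt1
  V_a V_neg nuE opA opB (size_prod_roots t_) (size_prod_roots s_) NA_deg (DA0 _ ord0m)
  lstA lstB w_ge0 r_gt0 r_lt1.
have a0C : a0 = Cp.[0] by rewrite /a0 const_a0E C0.
have defect0 j : s_defect NY p r nu U Cp (s_ j) = 0.
  by apply: U_def => //; exact: root_prod_roots.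
have NBs j : NB.[s_ j] != 0 by exact: (NB_coprime (s_ j) (root_prod_roots s_ j)).
have DAs j : (prod_roots t_).[- s_ j] != 0 by apply: DA0; rewrite ReN oppr_ge0 ltW.
have dual (s_inj : injective s_) := dual_basis Vid Aid Bid indep A_ge0 B_ge0 a_gt0 p_lt1
  V_a V_neg nuE opA opB (size_prod_roots t_) (size_prod_roots s_) NA_deg (DA0 _ ord0m)
  lstA lstB r_gt0 r_lt1 (DB0 _ ord0m) s_neg s_inj (root_prod_roots s_) NBs DAs.
have sNY : (size NY <= m + l)%N.
  apply: leq_trans (size_polyMleq _ _) _; rewrite size_compN.
  by apply: leq_trans (leq_pred _) _; rewrite addnC leq_add.
have c0 : 0 <= r * p by rewrite mulr_ge0// ltW.
have c1 : r * p < 1 by rewrite mulr_ilt1// ltW.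
split=> [a1|a1].
  (* On the imaginary axis both transforms have modulus at most 1, and N_Y is D_Y times their
     product. *)
  have axis (s : R[i]) : Re s = 0 -> cabs NY.[s] <= cabs DY.[s].
    move=> s0.
    have lst1 (X : {RV P >-> R}) (z : R[i]) : Re z = 0 -> cabs (LST P X z) <= 1.
      move=> z0; apply: cabs_cint_bounded => //.
        exact: (cmeasurable_comp (cmeasurable_cexp_line setT z) (measurable_funPT X)).
      by move=> t _; rewrite cabs_cexp ReN ReMr z0 mul0r oppr0 expR0.
    rewrite /NY /DY !hornerM !horner_compN -lstB ?s0// -lstA ?ReN ?s0 ?oppr0//.
    rewrite mulrACA cabsM; rewrite ler_piMr ?cabs_ge0// cabsM.
    by rewrite mulr_ile1 ?cabs_ge0 ?lst1// ReN s0 oppr0.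
  rewrite a1 in U_sol dual.
  have [ak [delta [h1 h2 h3 h4 h5]]] :=
    unit_slope_systems s_neg t_neg sNY axis c0 c1 U_sol defect0 dual.
  by exists ak, delta; rewrite a0C.
have a1' : a != 1 by apply/eqP.
have DY0 : DY.[0] != 0.
  by rewrite hornerM horner_compN oppr0 mulf_neq0 ?DA0 ?DB0.
have := series_systems s_neg t_neg (size_D_Y s_ t_) sNY DY0 (DY0_NY0 lstA lstB) a_gt0 w_ge0
  r_gt0 r_lt1 p_gt0 p_lt1 a1' U_sol defect0 dual.
by rewrite -a0C.
Qed.
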